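(* There exist positive absolute constants $c_0,c_1,c_2,c_3,c_4$ such that the following holds. Let $n>1$ and let $G$ be an $n$-layer ReLU network whose weights $W_i$ satisfy the Weight Distribution Condition (WDC) with constant $\varepsilon_{\mathrm{WDC}}>0$ for all $i\in\{1,\dots,n\}$, where $c_1n^3\varepsilon_{\mathrm{WDC}}^{1/4}\le1$. Put $C_{a,\xi,R}=\max\{c_0(R\|a\|_{\psi_1}+\|\xi\|_{\psi_1}),1\}$, let $u\ge0$, and suppose $$\lambda\ge4C_{a,\xi,R}\cdot\log(64\,C_{a,\xi,R}\cdot\varepsilon_{\mathrm{WDC}}^{-1}),\qquad m\ge c_2\lambda^2\log^2(\lambda m)\big(kn\log(ed)+k\log(2R)+k\log m+u\big)/\varepsilon_{\mathrm{WDC}}^2 .$$ Then with probability at least $1-2c_3\exp(-u)$, for every nonzero $x_0\in\mathbb R^k$ with $\|x_0\|_2\le R(1/2+\varepsilon_{\mathrm{WDC}})^{-n/2}$ and $\|x_0\|_2\ge\check\delta=2^{n/2}\varepsilon_{\mathrm{WDC}}^{1/2}$, and for any scalars $\varphi,\zeta\in[\rho_n,1]$, $$L(x)<L(z)\qquad\forall x\in\mathcal B(\varphi x_0,\delta_3)\ \text{ and }\ \forall z\in\mathcal B(-\zeta x_0,\delta_3),$$ where $\delta_3=c_4n^{-5}\|x_0\|_2$. In particular, $\delta_3<\rho_n\|x_0\|_2$ for all $n>1$, so that $0\notin\mathcal B(\varphi x_0,\delta_3)$ and $0\notin\mathcal B(-\zeta x_0,\delta_3)$.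
   Context: ReLU network: $G:\mathbb R^k\to\mathbb R^d$, $G(x)=\sigma\circ(W_n\,\sigma\circ(W_{n-1}\cdots\sigma\circ(W_1x)))$, where $\sigma(t)=\max\{t,0\}$ is applied entrywise, $W_i\in\mathbb R^{d_i\times d_{i-1}}$, $d_0=k$, $d_n=d$, $d_i\le d$, and $n<d$. Norms: $\|X\|_{\psi_1}=\sup_{p\ge1}p^{-1}(\mathbb E|X|^p)^{1/p}$ for a real random variable (sub-exponential if finite); for a random vector, $\|a\|_{\psi_1}=\sup_{t\in\mathcal S^{d-1}}\|\langle a,t\rangle\|_{\psi_1}$. Model: $a\in\mathbb R^d$ is a mean-zero, isotropic ($\mathbb E[aa^\top]=\mathbf I_d$), sub-exponential random vector; $\xi$ is a sub-exponential random variable; $\tau\sim\mathrm{Unif}[-\lambda,\lambda]$; $a,\xi,\tau$ are independent; $(a_i,\xi_i,\tau_i)_{i=1}^m$ are i.i.d. copies of $(a,\xi,\tau)$; $R\ge1$ is fixed. For $x_0\in\mathbb R^k$, $y_i=\mathrm{sign}(\langle a_i,G(x_0)\rangle+\xi_i+\tau_i)$ and $$L(x)=\|G(x)\|_2^2-\frac{2\lambda}{m}\sum_{i=1}^m y_i\langle a_i,G(x)\rangle .$$ WDC: for a matrix $W$ with $p$ columns and $x\in\mathbb R^p$ let $W_{+,x}=\mathrm{diag}(Wx>0)W$, i.e. rows of $W$ having positive inner product with $x$ are kept and all other rows are set to zero. $W$ satisfies the WDC with constant $\varepsilon_{\mathrm{WDC}}>0$ if for all nonzero $x,z\in\mathbb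 R^p$, $\|W_{+,x}^\top W_{+,z}-Q_{x,z}\|_2\le\varepsilon_{\mathrm{WDC}}$ (spectral norm), where $$Q_{x,z}=\frac{\pi-\angle(x,z)}{2\pi}\mathbf I_p+\frac{\sin\angle(x,z)}{2\pi}M_{\hat x\leftrightarrow\hat z},\qquad \hat x=x/\|x\|_2,\ \hat z=z/\|z\|_2,$$ and $M_{\hat x\leftrightarrow\hat z}$ is the matrix mapping $\hat x\mapsto\hat z$, $\hat z\mapsto\hat x$, and $\vartheta\mapsto0$ for all $\vartheta\in\mathrm{span}(\{x,z\})^\perp$ (with $M_{\hat x\leftrightarrow\hat z}=\hat x\hat x^\top$ if $\angle(x,z)=0$ and $-\hat x\hat x^\top$ if $\angle(x,z)=\pi$). $\rho_n$: $\rho_n=\sum_{i=0}^{n-1}\frac{\sin\check\varrho_i}{\pi}\prod_{j=i+1}^{n-1}\frac{\pi-\check\varrho_j}{\pi}$, where $\check\varrho_0=\pi$, $\check\varrho_i=g(\check\varrho_{i-1})$ and $g(\varrho)=\cos^{-1}\!\big(\frac{(\pi-\varrho)\cos\varrho+\sin\varrho}{\pi}\big)$; one has $0<\rho_n\le1$. $\mathcal B(x,r)$ is the Euclidean ball of radius $r$ centered at $x$ in $\mathbb R^k$. ''Absolute constant'' means independent of all other quantities. *)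

(* Defs.v *)
From HB Require Import structures.
From mathcomp Require Import all_boot all_order all_algebra.
From mathcomp Require Import ring lra.
From mathcomp Require Import all_classical all_reals all_analysis.

Set Implicit Arguments.
Unset Strict Implicit.
Unset Printing Implicit Defensive.

Import Order.TTheory GRing.Theory Num.Theory.
Import numFieldNormedType.Exports.

Local Open Scope classical_set_scope.
Local Open Scope ring_scope.

Section Euclidean.
Context {R : realType}.

Definition dotv p (x z : 'cV[R]_p) : R := \sum_i x i 0 * z i 0.

(* The library's norm on matrices is the sup norm, hence this definition. *)
Definition l2norm p (x : 'cV[R]_p) : R := Num.sqrt (dotv x x).

Definition l2ball p (x : 'cV[R]_p) (r : R) : set 'cV[R]_p :=
  [set z | l2norm (z - x) <= r].

Definition spectral_norm p q (A : 'M[R]_(p, q)) : R :=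
  sup [set l2norm (A *m x) | x in [set x : 'cV[R]_q | l2norm x <= 1]].

Definition normalize p (x : 'cV[R]_p) : 'cV[R]_p := (l2norm x)^-1 *: x.

Definition angle p (x z : 'cV[R]_p) : R :=
  acos (dotv x z / (l2norm x * l2norm z)).

End Euclidean.

Section WeightDistributionCondition.
Context {R : realType}.

Definition active_mx q p (W : 'M[R]_(q, p)) (x : 'cV[R]_p) : 'M[R]_(q, p) :=
  diag_mx (\row_i (0 < (W *m x) i 0)%R%:R) *m W.

(* M maps u to v, v to u, and the orthogonal complement of span{u, v} to 0. *)
Definition is_swap p (u v : 'cV[R]_p) (M : 'M[R]_p) : Prop :=
  [/\ M *m u = v, M *m v = u &
      forall t, dotv t u = 0 -> dotv t v = 0 -> M *m t = 0].

(* For unit vectors u, v there is exactly one such M: see swap_mxP, is_swap_uniq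
   and, for the collinear cases, swap_mx_same and swap_mx_opp. *)
Definition swap_mx p (u v : 'cV[R]_p) : 'M[R]_p := xget 0 (is_swap u v).

Definition wdc_mx p (x z : 'cV[R]_p) : 'M[R]_p :=
  ((pi - angle x z) / (2 * pi))%:M
  + (sin (angle x z) / (2 * pi)) *: swap_mx (normalize x) (normalize z).

Definition WDC q p (eps : R) (W : 'M[R]_(q, p)) : Prop :=
  forall x z : 'cV[R]_p, x != 0 -> z != 0 ->
    spectral_norm ((active_mx W x)^T *m active_mx W z - wdc_mx x z) <= eps.

End WeightDistributionCondition.

Section SwapMatrix.
Context {R : realType}.
Implicit Types p : nat.

Lemma dotvE p (x z : 'cV[R]_p) : dotv x z = (x^T *m z) 0 0.
Proof. by rewrite mxE; apply: eq_bigr => i _; rewrite mxE. Qed.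

Lemma dotvC p (x z : 'cV[R]_p) : dotv x z = dotv z x.
Proof. by apply: eq_bigr => i _; rewrite mulrC. Qed.

Lemma dotvDr p (x y z : 'cV[R]_p) : dotv x (y + z) = dotv x y + dotv x z.
Proof. by rewrite !dotvE mulmxDr mxE. Qed.

Lemma dotvNr p (x z : 'cV[R]_p) : dotv x (- z) = - dotv x z.
Proof. by rewrite !dotvE mulmxN mxE. Qed.

Lemma dotvZr p (c : R) (x z : 'cV[R]_p) : dotv x (c *: z) = c * dotv x z.
Proof. by rewrite !dotvE -scalemxAr mxE. Qed.

Lemma dotv0r p (x : 'cV[R]_p) : dotv x 0 = 0.
Proof. by rewrite dotvE mulmx0 mxE. Qed.

Lemma outer_mul p (x y z : 'cV[R]_p) : x *m y^T *m z = dotv y z *: x.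
Proof.
rewrite -mulmxA [y^T *m z]mx11_scalar -dotvE.
by rewrite mul_mx_scalar.
Qed.

Lemma dotv_ge0 p (x : 'cV[R]_p) : 0 <= dotv x x.
Proof. by apply: sumr_ge0 => i _; rewrite -expr2 sqr_ge0. Qed.

Lemma dotv_eq0 p (x : 'cV[R]_p) : dotv x x = 0 -> x = 0.
Proof.
move=> /eqP; rewrite /dotv psumr_eq0; last first.
  by move=> i _; rewrite -expr2 sqr_ge0.
move=> /allP h; apply/matrixP => i j; rewrite ord1 mxE.
have := h i (mem_index_enum i); rewrite implyTb mulf_eq0 orbb.
by move/eqP.
Qed.

Lemma dotv_normalize p (x : 'cV[R]_p) : x != 0 ->
  dotv (normalize x) (normalize x) = 1.
Proof.
move=> x0; rewrite dotvZr dotvC dotvZr mulrA -expr2 exprVn sqr_sqrtr ?dotv_ge0//.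
by rewrite mulVf//; apply: contra_neq x0; exact: dotv_eq0.
Qed.

(* 0^-1 = 0 in the library, so a vanishing w is harmless. *)
Let projE p (w : 'cV[R]_p) : ((dotv w w)^-1 * dotv w w) *: w = w.
Proof.
have [w0|w0] := eqVneq (dotv w w) 0; last by rewrite mulVf ?scale1r.
by rewrite (dotv_eq0 w0) scaler0.
Qed.

Let projN p (w x : 'cV[R]_p) :
  dotv w (x - ((dotv w w)^-1 * dotv w x) *: w) = 0.
Proof.
rewrite dotvDr dotvNr dotvZr -mulrA.
have [w0|w0] := eqVneq (dotv w w) 0; last by field.
by rewrite (dotv_eq0 w0) (dotvC 0 x) dotv0r; ring.
Qed.

Let halfD p (u v : 'cV[R]_p) : u = 2^-1 *: ((u + v) + (u - v)).
Proof. by apply/matrixP => i j; rewrite !mxE; lra. Qed.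

Let halfB p (u v : 'cV[R]_p) : v = 2^-1 *: ((u + v) - (u - v)).
Proof. by apply/matrixP => i j; rewrite !mxE; lra. Qed.

Let orthoDB p (u v : 'cV[R]_p) : dotv u u = 1 -> dotv v v = 1 ->
  dotv (u + v) (u - v) = 0.
Proof.
move=> u1 v1; rewrite dotvDr dotvNr ![dotv (u + v) _]dotvC !dotvDr u1 v1.
by rewrite (dotvC v u); lra.
Qed.

Let swap0 p (u v : 'cV[R]_p) : 'M[R]_p :=
  (dotv (u + v) (u + v))^-1 *: ((u + v) *m (u + v)^T)
  - (dotv (u - v) (u - v))^-1 *: ((u - v) *m (u - v)^T).

Let is_swap_swap0 p (u v : 'cV[R]_p) : dotv u u = 1 -> dotv v v = 1 ->
  is_swap u v (swap0 u v).
Proof.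
move=> u1 v1; have st := orthoDB u1 v1.
have ts : dotv (u - v) (u + v) = 0 by rewrite dotvC.
have Ss : swap0 u v *m (u + v) = u + v.
  rewrite mulmxBl -!scalemxAl !outer_mul ts scale0r scaler0 subr0.
  by rewrite scalerA projE.
have St : swap0 u v *m (u - v) = - (u - v).
  rewrite mulmxBl -!scalemxAl !outer_mul st scale0r scaler0 sub0r.
  by rewrite scalerA projE.
split.
- have := congr1 (mulmx (swap0 u v)) (halfD u v).
  by rewrite -scalemxAr [_ *m (_ + (_ - _))]mulmxDr Ss St -halfB.
- have := congr1 (mulmx (swap0 u v)) (halfB u v).
  by rewrite -scalemxAr [_ *m (_ + _ - _)]mulmxBr Ss St opprK -halfD.
- move=> w wu wv; rewrite mulmxBl -!scalemxAl !outer_mul.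
  have -> : dotv (u + v) w = 0 by rewrite dotvC dotvDr wu wv addr0.
  have -> : dotv (u - v) w = 0 by rewrite dotvC dotvDr dotvNr wu wv subr0.
  by rewrite !scale0r !scaler0 subrr.
Qed.

Lemma is_swap_uniq p (u v : 'cV[R]_p) (M N : 'M[R]_p) :
  dotv u u = 1 -> dotv v v = 1 -> is_swap u v M -> is_swap u v N -> M = N.
Proof.
move=> u1 v1 [Mu Mv M0] [Nu Nv N0].
have st := orthoDB u1 v1.
suff MN (w : 'cV[R]_p) : M *m w = N *m w.
  apply/matrixP => i j; have /matrixP/(_ i 0) := MN (delta_mx j 0).
  by rewrite -!colE !mxE.
set s := u + v in st; set t := u - v in st.
have ts : dotv t s = 0 by rewrite dotvC.
pose w' := w - ((dotv s s)^-1 * dotv s w) *: s - ((dotv t t)^-1 * dotv t w) *: t.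
have w's : dotv w' s = 0.
  by rewrite dotvC dotvDr projN dotvNr dotvZr st mulr0 oppr0 addr0.
have w't : dotv w' t = 0.
  rewrite dotvC /w' addrAC dotvDr projN dotvNr dotvZr ts.
  by rewrite mulr0 oppr0 addr0.
have w'u : dotv w' u = 0.
  by rewrite (halfD u v) dotvZr dotvDr w's w't addr0 mulr0.
have w'v : dotv w' v = 0.
  by rewrite (halfB u v) dotvZr dotvDr dotvNr w's w't oppr0 addr0 mulr0.
have wE : w = w' + ((dotv t t)^-1 * dotv t w) *: t
                 + ((dotv s s)^-1 * dotv s w) *: s.
  by rewrite /w' !subrK.
have MNw' : M *m w' = N *m w' by rewrite M0 // N0.
have MNs : M *m s = N *m s by rewrite !mulmxDr Mu Mv Nu Nv.
have MNt : M *m t = N *m t by rewrite !mulmxBr Mu Mv Nu Nv.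
clearbody w' s t.
by rewrite wE !mulmxDr -!scalemxAr MNw' MNs MNt.
Qed.

Lemma swap_mxP p (u v : 'cV[R]_p) : dotv u u = 1 -> dotv v v = 1 ->
  is_swap u v (swap_mx u v).
Proof.
by move=> u1 v1; apply: xgetPex; exists (swap0 u v); exact: is_swap_swap0.
Qed.

Lemma swap_mx_same p (u : 'cV[R]_p) : dotv u u = 1 -> swap_mx u u = u *m u^T.
Proof.
move=> u1; apply: (is_swap_uniq u1 u1 (swap_mxP u1 u1)).
split=> [||w wu _]; rewrite outer_mul ?u1 ?scale1r //.
by rewrite dotvC wu scale0r.
Qed.

Lemma swap_mx_opp p (u : 'cV[R]_p) : dotv u u = 1 ->
  swap_mx u (- u) = - (u *m u^T).
Proof.
move=> u1.
have v1 : dotv (- u) (- u) = 1 by rewrite dotvNr dotvC dotvNr opprK.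
apply: (is_swap_uniq u1 v1 (swap_mxP u1 v1)).
split=> [||w wu _]; rewrite mulNmx outer_mul ?dotvNr ?u1 ?scaleNr ?scale1r //.
  by rewrite opprK.
by rewrite dotvC wu scale0r oppr0.
Qed.

End SwapMatrix.

Section ReluNetwork.
Context {R : realType}.

(* Layer i maps R^(dims i) to R^(dims i.+1): W i is the (i+1)-st weight matrix. *)
Fixpoint relu_net (dims : nat -> nat) (W : forall i, 'M[R]_(dims i.+1, dims i))
    (n : nat) : 'cV[R]_(dims 0) -> 'cV[R]_(dims n) :=
  match n with
  | 0 => fun x => x
  | n'.+1 => fun x => map_mx (fun t => Num.max t 0) (W n' *m relu_net W n' x)
  end.

Definition angle_map (t : R) : R := acos (((pi - t) * cos t + sin t) / pi).

Definition varrho (i : nat) : R := iter i angle_map pi.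

Definition rho (n : nat) : R :=
  \sum_(0 <= i < n) sin (varrho i) / pi
                    * \prod_(i.+1 <= j < n) ((pi - varrho j) / pi).

(* Quantization to {-1, 1}, with value 1 at 0 (unlike Num.sg). *)
Definition sign_bit (t : R) : R := if 0 <= t then 1 else - 1.

Definition loss k d (G : 'cV[R]_k -> 'cV[R]_d) (lambda : R) m
    (y : 'I_m -> R) (a : 'I_m -> 'cV[R]_d) (x : 'cV[R]_k) : R :=
  l2norm (G x) ^+ 2
  - 2 * lambda / m%:R * \sum_(i < m) y i * dotv (a i) (G x).

Definition delta3 (c : R) (n k : nat) (x : 'cV[R]_k) : R :=
  c * n%:R ^- 5 * l2norm x.

End ReluNetwork.

Section Probability.
Context {R : realType} d (T : measurableType d) (P : probability T R).
Local Open Scope ereal_scope.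

Definition psi1 (X : T -> R) : \bar R :=
  ereal_sup [set (p^-1)%:E * 'N[P]_(p%:E)[EFin \o X] | p in [set p : R | (1 <= p)%R]].

(* Random vectors take values in n.-tuple R, which carries the product
   sigma-algebra. *)
Definition cV_of_tuple n (v : n.-tuple R) : 'cV[R]_n := \col_j tnth v j.

Definition psi1_vec n (a : T -> n.-tuple R) : \bar R :=
  ereal_sup [set psi1 (fun w => dotv (cV_of_tuple (a w)) t)
            | t in [set t : 'cV[R]_n | l2norm t = 1%R]].

Definition mean_zero n (a : T -> n.-tuple R) : Prop :=
  forall j, 'E_P[fun w => tnth (a w) j] = 0.

Definition isotropic n (a : T -> n.-tuple R) : Prop :=
  forall i j, 'E_P[fun w => (tnth (a w) i * tnth (a w) j)%R] = (i == j)%:R%:E.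

Definition uniform_on (a b : R) (X : T -> R) : Prop :=
  exists ab : (a < b)%R,
  forall B, measurable B -> P (X @^-1` B) = uniform_prob ab B.

(* Taking some of the sets to be setT gives the rule for pairs. *)
Definition independent3 d1 d2 d3 (T1 : measurableType d1)
    (T2 : measurableType d2) (T3 : measurableType d3)
    (X : T -> T1) (Y : T -> T2) (Z : T -> T3) : Prop :=
  forall A B C, measurable A -> measurable B -> measurable C ->
    P (X @^-1` A `&` Y @^-1` B `&` Z @^-1` C)
    = P (X @^-1` A) * P (Y @^-1` B) * P (Z @^-1` C).

Definition mutually_independent (I : finType) d' (T' : measurableType d')
    (X : I -> T -> T') : Prop :=
  forall (J : {set I}) (B : I -> set T'), (forall i, measurable (B i)) ->
    P (\bigcap_(i in [set i | i \in J]) X i @^-1` B i)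
    = \prod_(i in J) P (X i @^-1` B i).

Definition same_law d' (T' : measurableType d') (X Y : T -> T') : Prop :=
  forall B, measurable B -> P (X @^-1` B) = P (Y @^-1` B).

(* The event E need not be measurable, so we ask for a measurable subset. *)
Definition with_prob_at_least (p : R) (E : set T) : Prop :=
  exists2 A, measurable A & A `<=` E /\ p%:E <= P A.

End Probability.

(* Main.v *)
Require Import Defs.
From HB Require Import structures.
From mathcomp Require Import all_boot all_order all_algebra.
From mathcomp Require Import ring lra.
From mathcomp Require Import all_classical all_reals all_analysis.
From mathcomp Require Import measurable_realfun.

Set Implicit Arguments.
Unset Strict Implicit.
Unset Printing Implicit Defensive.

Import Order.TTheory GRing.Theory Num.Theory.
Import numFieldNormedType.Exports.

Local Open Scope classical_set_scope.
Local Open Scope ring_scope.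

(* The WDC says that one layer maps a pair of vectors at angle t to a pair whose
   inner product is half that of a pair at the angle with cosine
   cosmap (cos t), up to eps. Hence G has norm about 2^(-n/2) on the unit
   sphere, and the cosine of the angle between G x and G (- x) is within O(n eps)
   of the n-th iterate of cosmap at -1, which is exactly rho_n. Since
   1 - rho_n is at least of order 1 / n^2, the functional
     ||G x||^2 - 2 <G x0, G x>
   separates phi x0 from - zeta x0 by a multiple of ||x0||^2 / (2^n n^2).

   It remains to see that (lam / m) sum_i y_i <a_i, G x> is uniformly within
   O(eps) ||x|| / 2^(n/2) of <G x0, G x>. Averaging over the uniform dither turns
   lam * sign (s + tau) into s clipped to [-lam, lam], and the subexponential tail
   makes the clipping bias negligible. Bernstein's inequality, which costs only a
   logarithmic factor because E <a, v>^2 <= 1, gives the estimate on a finite net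
   of size polynomial in m, d, R and 2^n to the power k. A sign that changes
   between x0 and its net point x0' is bracketed by the signs at x0' shifted by a
   margin t, and the dithered sum of the bracket has mean of order t. *)

(** Two Lipschitz estimates for [G] are needed. The net argument wants one without additive error:
    it comes from [W x = relu (W x) - relu (W (- x))] and has constant at most 2. It misses the
    factor 2^(-n/2), but a mesh finer by 2^n repairs this and costs only a term n in the logarithm
    of the net size. The balls around phi x0 and - zeta x0 are too large for such a loss. There a
    sharp estimate with the factor 2^(-n/2) takes over; its additive error, of relative order sqrt
    (n eps), is still below n^-2.

    The quarter power of eps comes from comparing scales. With r = ||x0|| / 2^(n/2) the gap is of
    order r^2 / n^2, while the statistical error eps r is only linear in r. The lower bound r >=
    eps^(1/2) turns it into eps^(1/2) r^2, which n^3 eps^(1/4) <= b makes small against the gap.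

    Homogeneity of [G] reduces the argument x to the unit sphere, but the signs depend on the scale
    of x0. So x0 has to be approximated in a whole ball, the one that [G] maps into the ball of
    radius R. *)

(** * The angle map of a ReLU layer, on angles and on cosines *)

Section AngleMap.
Context {R : realType}.
Implicit Types (c t s : R) (n : nat).

Lemma le_of_derive_ge0 (f df : R -> R) (a b : R) : a <= b ->
  (forall x : R, is_derive x 1 f (df x)) -> (forall x, a <= x <= b -> 0 <= df x) ->
  f a <= f b.
Proof.
move=> ab fdf df0.
have cf : {within `[a, b], continuous f}.
  apply: continuous_subspaceT => x.
  apply: differentiable_continuous; apply/derivable1_diffP.
  by have [] := fdf x.
have [x xab E] := MVT_segment ab (fun x _ => fdf x) cf.
by rewrite -subr_ge0 E mulr_ge0 ?subr_ge0// df0//; move: xab; rewrite in_itv.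
Qed.

(** The normalized arc-cosine kernel of degree one: half of it is the expected product of
    [relu <g, x>] and [relu <g, z>] for a standard Gaussian [g] and unit vectors at angle [t]. *)
Definition cos_angle_map t : R := ((pi - t) * cos t + sin t) / pi.

Let pi_neq0 : (pi : R) != 0. Proof. by rewrite gt_eqF// pi_gt0. Qed.

Instance is_derive_cos_angle_map t :
  is_derive t 1 cos_angle_map (- ((pi - t) * sin t / pi)).
Proof.
rewrite /cos_angle_map.
have -> : (fun s : R => ((pi - s) * cos s + sin s) / pi) =
  (((cst pi - id) * cos + sin) * cst pi^-1 : R -> R).
  by apply/funext => s /=.
apply: is_derive_eq.
rewrite /GRing.scale/= /cst !fctE /= mulr0 add0r sub0r.
by move: pi_neq0; move: pi => p p0; field.
Qed.

Lemma cos_angle_map_nincr s t : 0 <= s -> s <= t -> t <= pi ->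
  cos_angle_map t <= cos_angle_map s.
Proof.
move=> s0 st tpi.
have := @le_of_derive_ge0 (- cos_angle_map) (fun t => - - ((pi - t) * sin t / pi))
  s t st.
rewrite !fctE lerN2; apply.
move=> x /andP[sx xt]; rewrite opprK divr_ge0 ?pi_ge0// mulr_ge0 ?subr_ge0//.
  exact: le_trans tpi.
by apply: sin_ge0_pi; rewrite (le_trans s0 sx) (le_trans xt tpi).
Qed.

(** The difference has derivative [t * sin t / pi]. In the variable [c = cos t] this says that
    [cosmap c - c] decreases, which is the upper half of the 1-Lipschitz bound on [cosmap]. *)
Lemma cos_angle_map_sub_cos s t : 0 <= s -> s <= t -> t <= pi ->
  cos_angle_map s - cos s <= cos_angle_map t - cos t.
Proof.
move=> s0 st tpi.
have := @le_of_derive_ge0 (cos_angle_map - cos)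
  (fun t => - ((pi - t) * sin t / pi) - (- sin t)) s t st.
rewrite !fctE; apply.
move=> x /andP[sx xt]; have -> : - ((pi - x) * sin x / pi) - - sin x = x * sin x / pi.
  by move: pi_neq0; move: pi => p p0; field.
rewrite divr_ge0 ?pi_ge0// mulr_ge0 ?(le_trans s0 sx)//.
by apply: sin_ge0_pi; rewrite (le_trans s0 sx) (le_trans xt tpi).
Qed.

Lemma cos_angle_map0 : cos_angle_map 0 = 1.
Proof. by rewrite /cos_angle_map cos0 sin0 subr0 mulr1 addr0 mulfV. Qed.

Lemma cos_angle_mappi : cos_angle_map pi = 0.
Proof. by rewrite /cos_angle_map subrr mul0r sinpi addr0 mul0r. Qed.

Lemma cos_angle_map_ge_cos t : 0 <= t -> t <= pi -> cos t <= cos_angle_map t.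
Proof.
move=> t0 tpi; have := cos_angle_map_sub_cos (lexx 0) t0 tpi.
by rewrite cos_angle_map0 cos0 subrr subr_ge0.
Qed.

Lemma cos_angle_map_ge0 t : 0 <= t -> t <= pi -> 0 <= cos_angle_map t.
Proof. by move=> t0 tpi; rewrite -cos_angle_mappi cos_angle_map_nincr. Qed.

Lemma cos_angle_map_le1 t : 0 <= t -> t <= pi -> cos_angle_map t <= 1.
Proof. by move=> t0 tpi; rewrite -cos_angle_map0 cos_angle_map_nincr. Qed.

Lemma sin_le_id t : 0 <= t -> sin t <= t.
Proof.
move=> t0; have := @le_of_derive_ge0 (id - sin) (fun t => 1 - cos t) 0 t t0.
rewrite !fctE sin0 subrr subr_ge0; apply => x _.
by rewrite subr_ge0 cos_le1.
Qed.

Lemma cos_angle_map_itv t : 0 <= t <= pi -> -1 <= cos_angle_map t <= 1.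
Proof.
move=> /andP[t0 tpi]; rewrite (cos_angle_map_le1 t0 tpi) andbT.
by rewrite (le_trans _ (cos_angle_map_ge0 t0 tpi))// lerN10.
Qed.

(* [sin t - t cos t <= t (1 - cos t)] is just [sin t <= t]. *)
Lemma one_sub_cos_angle_map t : 0 <= t ->
  (1 - cos t) * (1 - t / pi) <= 1 - cos_angle_map t.
Proof.
move=> t0; rewrite -subr_ge0.
have -> : 1 - cos_angle_map t - (1 - cos t) * (1 - t / pi) = (t - sin t) / pi.
  by rewrite /cos_angle_map; move: pi_neq0; move: pi => p p0; field.
by rewrite divr_ge0 ?pi_ge0// subr_ge0 sin_le_id.
Qed.

(** Working with cosines avoids [acos], which is not Lipschitz at -1 and 1; a layer then acts by a
    1-Lipschitz map and the errors of successive layers merely add. *)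
Definition cosmap c : R := cos_angle_map (acos c).

Lemma cosmap_ge0 c : -1 <= c <= 1 -> 0 <= cosmap c.
Proof. by move=> c1; rewrite cos_angle_map_ge0 ?acos_ge0 ?acos_lepi. Qed.

Lemma cosmap_le1 c : -1 <= c <= 1 -> cosmap c <= 1.
Proof. by move=> c1; rewrite cos_angle_map_le1 ?acos_ge0 ?acos_lepi. Qed.

Lemma cosmap1 : cosmap 1 = 1.
Proof. by rewrite /cosmap acos1 cos_angle_map0. Qed.

Lemma cosmapN1 : cosmap (- 1) = 0.
Proof. by rewrite /cosmap acosN1 cos_angle_mappi. Qed.

Lemma cosmap_ge c : -1 <= c <= 1 -> c <= cosmap c.
Proof.
move=> c1; have := cos_angle_map_ge_cos (acos_ge0 c1) (acos_lepi c1).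
by rewrite acosK// in_itv.
Qed.

Lemma acos_nincr c c' : -1 <= c -> c <= c' -> c' <= 1 -> acos c' <= acos c.
Proof.
move=> c1 cc c'1; have cI : -1 <= c <= 1 by rewrite c1 (le_trans cc).
have c'I : -1 <= c' <= 1 by rewrite c'1 (le_trans c1).
rewrite leNgt; apply/negP => h.
have : cos (acos c') < cos (acos c).
  by rewrite ltr_cos// in_itv/= ?acos_ge0 ?acos_lepi.
by rewrite !acosK ?in_itv//= ltNge cc.
Qed.

Lemma cosmap_le c c' : -1 <= c -> c <= c' -> c' <= 1 -> cosmap c <= cosmap c' <= cosmap c + (c' - c).
Proof.
move=> c1 cc c'1; have cI : -1 <= c <= 1 by rewrite c1 (le_trans cc).
have c'I : -1 <= c' <= 1 by rewrite c'1 (le_trans c1).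
have ac := acos_nincr c1 cc c'1.
have a0 := acos_ge0 c'I; have ap := acos_lepi cI.
rewrite /cosmap cos_angle_map_nincr//=.
have := cos_angle_map_sub_cos a0 ac ap.
by rewrite !acosK ?in_itv//= => h; lra.
Qed.

Lemma cosmap_lipschitz c c' : -1 <= c <= 1 -> -1 <= c' <= 1 ->
  `|cosmap c - cosmap c'| <= `|c - c'|.
Proof.
move=> /andP[c0 c1] /andP[c0' c1']; have [cc|/ltW cc] := leP c c'.
  have /andP[h1 h2] := cosmap_le c0 cc c1'.
  by rewrite ler0_norm ?subr_le0// ler0_norm ?subr_le0//; lra.
have /andP[h1 h2] := cosmap_le c0' cc c1.
by rewrite ger0_norm ?subr_ge0// ger0_norm ?subr_ge0//; lra.
Qed.

End AngleMap.

(** * The constants [rho_n] and their distance to 1 *)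

Section Rho.
Context {R : realType}.
Implicit Types (c t s : R) (n : nat).

Lemma varrho0 : varrho 0 = pi :> R.
Proof. by []. Qed.

Lemma varrhoS n : varrho n.+1 = acos (cos_angle_map (varrho n)) :> R.
Proof. by []. Qed.

Lemma varrho_itv n : 0 <= (varrho n : R) <= pi.
Proof.
elim: n => [|n /cos_angle_map_itv c1]; first by rewrite /varrho/= pi_ge0 lexx.
by rewrite varrhoS acos_ge0 ?acos_lepi.
Qed.

Lemma cos_varrho_itv n : -1 <= (cos (varrho n) : R) <= 1.
Proof. by rewrite cos_geN1 cos_le1. Qed.

Lemma cos_varrhoS n : cos (varrho n.+1) = cosmap (cos (varrho n)) :> R.
Proof.
rewrite varrhoS acosK; last by rewrite in_itv/= cos_angle_map_itv// varrho_itv.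
by rewrite /cosmap cosK// in_itv/= varrho_itv.
Qed.

Lemma rhoS n : rho n.+1 =
  sin (varrho n) / pi + (pi - varrho n) / pi * rho n :> R.
Proof.
rewrite /rho big_nat_recr//= (@big_geq _ _ _ n.+1 n.+1)// mulr1 addrC; congr (_ + _).
rewrite mulr_sumr; apply: eq_big_nat => i /andP[_ ilt].
by rewrite big_nat_recr//=; ring.
Qed.

(** Both sides obey the same recursion. They differ at [n = 0] (0 against -1), but the factor
    [pi - varrho 0 = 0] erases this at the first step. *)
Lemma rho_cos n : (0 < n)%N -> rho n = cos (varrho n) :> R.
Proof.
case: n => // n _; elim: n => [|n IH].
  rewrite rhoS cos_varrhoS varrho0 subrr mul0r mul0r addr0 cospi cosmapN1.
  by rewrite sinpi mul0r.
rewrite rhoS IH (cos_varrhoS n.+1) /cosmap cosK; last by rewrite in_itv; exact: varrho_itv.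
by rewrite /cos_angle_map [RHS]mulrDl addrC [X in X + _]mulrAC.
Qed.

(** The cosines increase, because [c <= cosmap c], and at [n = 2] the value is
    [cosmap 0 = 1 / pi]. *)
Lemma cos_varrho_ge n : (1 < n)%N -> 4^-1 <= cos (varrho n) :> R.
Proof.
case: n => // -[//|n] _; elim: n => [|n IH]; last first.
  by rewrite cos_varrhoS (le_trans IH)// cosmap_ge// cos_varrho_itv.
have p4 : (pi : R) <= 4 by have := @pihalf_lt2 R; lra.
rewrite cos_varrhoS (cos_varrhoS 0) varrho0 cospi cosmapN1 /cosmap acos0 /cos_angle_map.
rewrite cos_pihalf sin_pihalf mulr0 add0r mul1r lef_pV2 ?posrE ?pi_gt0//.
Qed.

(** With [1 - c = 2 t^2] the half angle [x] has sine exactly [t], so the angle is at most [4 t], and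
    [1 - cosmap c] loses at most the fraction [4 t / pi <= 2 t] of [1 - c]. *)
Lemma cosmap_near1 t : 0 <= t -> t <= 4^-1 ->
  2 * t ^+ 2 * (1 - 2 * t) <= 1 - cosmap (1 - 2 * t ^+ 2).
Proof.
move=> t0 t4.
have tt : t ^+ 2 <= 16^-1 by rewrite (_ : 16^-1 = 4^-1 ^+ 2 :> R) ?ler_sqr ?nnegrE//; field.
have c0 : 0 <= t ^+ 2 by rewrite sqr_ge0.
have cI : -1 <= 1 - 2 * t ^+ 2 <= 1 by apply/andP; split; lra.
set c := 1 - 2 * t ^+ 2 in cI *; set th := acos c.
have cth : cos th = c by rewrite acosK// in_itv.
have th0 : 0 <= th by exact: acos_ge0.
have thp : th <= pi by exact: acos_lepi.
pose x := th / 2; have xth : th = x *+ 2 by rewrite /x -mulr_natr; field.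
have x0 : 0 <= x by rewrite divr_ge0.
have xp : x <= pi / 2 by rewrite ler_pM2r// invr_gt0.
have p0 := @pi_gt0 R.
have cx0 : 0 <= cos x by rewrite cos_ge0_pihalf// xp andbT (le_trans _ x0)// oppr_le0 ltW// divr_gt0.
have sx0 : 0 <= sin x by rewrite sin_ge0_pi// x0/= (le_trans xp)// ler_pdivrMr//; lra.
have cc : cos x ^+ 2 = 1 - t ^+ 2.
  have : cos (x *+ 2) = c by rewrite -xth.
  rewrite cos_mulr2n /c -mulr_natr; lra.
have sx : sin x = t.
  apply/eqP; rewrite -(@eqrXn2 _ 2)//; apply/eqP.
  by have := cos2Dsin2 x; rewrite cc; lra.
have cx : 2^-1 <= cos x.
  rewrite -(@ler_pXn2r _ 2)// ?nnegrE// cc; lra.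
(* This is [cos x <= cos_angle_map x] multiplied by [pi] and rearranged. *)
have xs : x * cos x <= sin x.
  have xpi : x <= pi by lra.
  have := cos_angle_map_ge_cos x0 xpi; rewrite /cos_angle_map.
  by rewrite ler_pdivlMr//; lra.
have xt : x <= 2 * t by rewrite -sx; nra.
have := one_sub_cos_angle_map th0; rewrite -/(cosmap c) cth => h.
have c2 : 1 - c = 2 * t ^+ 2 by rewrite /c; ring.
rewrite c2 in h; apply: le_trans h; rewrite ler_wpM2l ?mulr_ge0//.
rewrite lerD2l lerN2 ler_pdivrMr// xth -mulr_natr.
have := @pi_ge2 R; nra.
Qed.

(** The sequence [t = 1 / (4 (n + 1))] decays fast enough to be preserved: its next square is at
    most [t^2 (1 - 2 t)], the bound left by one application of [cosmap]. *)
Lemma cos_varrho_le n : cos (varrho n) <= 1 - 2 * ((4 * n.+1%:R)^-1) ^+ 2 :> R.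
Proof.
elim: n => [|n IH].
  rewrite varrho0 cospi mulr1; lra.
set a : R := n.+1%:R in IH *.
have a1 : 1 <= a by rewrite ler1n.
have -> : n.+2%:R = a + 1 :> R by rewrite /a -natr1.
pose t := (4 * a)^-1.
have t0 : 0 <= t by rewrite invr_ge0; lra.
have t4 : t <= 4^-1 by rewrite lef_pV2 ?posrE; lra.
have tt : t ^+ 2 <= 16^-1 by rewrite (_ : 16^-1 = 4^-1 ^+ 2 :> R) ?ler_sqr ?nnegrE//; field.
have c0 : 0 <= t ^+ 2 by rewrite sqr_ge0.
rewrite cos_varrhoS.
have /andP[h1 h2] := cos_varrho_itv n.
have t1 : 1 - 2 * t ^+ 2 <= 1 by lra.
have /andP[+ _] := cosmap_le h1 IH t1.
move/le_trans; apply.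
have := cosmap_near1 t0 t4.
suff : (4 * (a + 1))^-1 ^+ 2 <= t ^+ 2 * (1 - 2 * t) by lra.
rewrite -subr_ge0 /t.
have -> : (4 * a)^-1 ^+ 2 * (1 - 2 * (4 * a)^-1) - (4 * (a + 1))^-1 ^+ 2 =
  (3 * a ^+ 2 - 1) / (32 * a ^+ 3 * (a + 1) ^+ 2).
  by field; lra.
by apply: divr_ge0; [nra|rewrite !mulr_ge0 ?exprn_ge0//; lra].
Qed.

End Rho.

(** * Euclidean geometry and the quadratic form of the WDC matrix *)

Section EuclideanSpace.
Context {R : realType}.
Implicit Types p q : nat.

Lemma dotvDl p (x y z : 'cV[R]_p) : dotv (x + y) z = dotv x z + dotv y z.
Proof. by rewrite dotvC dotvDr !(dotvC z). Qed.

Lemma dotvNl p (x z : 'cV[R]_p) : dotv (- x) z = - dotv x z.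
Proof. by rewrite dotvC dotvNr dotvC. Qed.

Lemma dotvZl p (c : R) (x z : 'cV[R]_p) : dotv (c *: x) z = c * dotv x z.
Proof. by rewrite dotvC dotvZr dotvC. Qed.

Lemma dotvBl p (x y z : 'cV[R]_p) : dotv (x - y) z = dotv x z - dotv y z.
Proof. by rewrite dotvDl dotvNl. Qed.

Lemma dotvBr p (x y z : 'cV[R]_p) : dotv z (x - y) = dotv z x - dotv z y.
Proof. by rewrite dotvDr dotvNr. Qed.

Lemma dotv0l p (z : 'cV[R]_p) : dotv 0 z = 0.
Proof. by rewrite dotvC dotv0r. Qed.

Lemma l2norm_ge0 p (x : 'cV[R]_p) : 0 <= l2norm x.
Proof. exact: sqrtr_ge0. Qed.

Lemma l2norm_sqr p (x : 'cV[R]_p) : l2norm x ^+ 2 = dotv x x.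
Proof. by rewrite sqr_sqrtr// dotv_ge0. Qed.

Lemma l2norm0 p : l2norm (0 : 'cV[R]_p) = 0.
Proof. by rewrite /l2norm dotv0r sqrtr0. Qed.

Lemma l2norm_eq0 p (x : 'cV[R]_p) : (l2norm x == 0) = (x == 0).
Proof.
apply/eqP/eqP => [h|->]; last exact: l2norm0.
by apply: dotv_eq0; rewrite -l2norm_sqr h expr0n.
Qed.

Lemma l2norm_gt0 p (x : 'cV[R]_p) : (0 < l2norm x) = (x != 0).
Proof. by rewrite lt_def l2norm_ge0 andbT l2norm_eq0. Qed.

Lemma l2normZ p (c : R) (x : 'cV[R]_p) : l2norm (c *: x) = `|c| * l2norm x.
Proof.
by rewrite /l2norm dotvZr dotvZl mulrA -expr2 sqrtrM ?sqr_ge0// sqrtr_sqr.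
Qed.

Lemma l2normN p (x : 'cV[R]_p) : l2norm (- x) = l2norm x.
Proof. by rewrite -scaleN1r l2normZ normrN1 mul1r. Qed.

Lemma dotv_sqr_le p (x z : 'cV[R]_p) : dotv x z ^+ 2 <= dotv x x * dotv z z.
Proof.
have [z0|z0] := eqVneq (dotv z z) 0.
  by rewrite (dotv_eq0 z0) !dotv0r expr0n mulr0.
have zp : 0 < dotv z z by rewrite lt_def z0 dotv_ge0.
have := dotv_ge0 (dotv z z *: x - dotv x z *: z).
have -> : dotv (dotv z z *: x - dotv x z *: z) (dotv z z *: x - dotv x z *: z)
  = dotv z z * (dotv x x * dotv z z - dotv x z ^+ 2).
  by rewrite !(dotvBl, dotvBr, dotvZl, dotvZr) (dotvC z x); ring.
by rewrite pmulr_rge0// subr_ge0.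
Qed.

Lemma cauchy_schwarz p (x z : 'cV[R]_p) : `|dotv x z| <= l2norm x * l2norm z.
Proof.
rewrite -(@ler_pXn2r _ 2)// ?nnegrE ?mulr_ge0 ?l2norm_ge0//.
by rewrite exprMn !l2norm_sqr real_normK ?num_real// dotv_sqr_le.
Qed.

Lemma dotv_le p (x z : 'cV[R]_p) : dotv x z <= l2norm x * l2norm z.
Proof. exact: le_trans (ler_norm _) (cauchy_schwarz _ _). Qed.

Lemma l2norm_sqrD p (x z : 'cV[R]_p) :
  l2norm (x + z) ^+ 2 = l2norm x ^+ 2 + 2 * dotv x z + l2norm z ^+ 2.
Proof. by rewrite !l2norm_sqr !(dotvDl, dotvDr) (dotvC z x); ring. Qed.

Lemma l2norm_sqrB p (x z : 'cV[R]_p) :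
  l2norm (x - z) ^+ 2 = l2norm x ^+ 2 - 2 * dotv x z + l2norm z ^+ 2.
Proof. by rewrite l2norm_sqrD l2normN dotvNr; ring. Qed.

Lemma l2norm_le_sqr p (x : 'cV[R]_p) (b : R) : 0 <= b ->
  l2norm x ^+ 2 <= b ^+ 2 -> l2norm x <= b.
Proof. by move=> b0; rewrite ler_sqr ?nnegrE ?l2norm_ge0. Qed.

Lemma l2norm_triangle p (x z : 'cV[R]_p) : l2norm (x + z) <= l2norm x + l2norm z.
Proof.
rewrite -(@ler_pXn2r _ 2)// ?nnegrE ?addr_ge0 ?l2norm_ge0//.
by rewrite l2norm_sqrD; have := dotv_le x z; lra.
Qed.

Lemma l2norm_triangleB p (x z : 'cV[R]_p) : l2norm x <= l2norm z + l2norm (x - z).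
Proof. by rewrite -{1}(subrK z x) addrC l2norm_triangle. Qed.

Lemma l2norm_le_entries p (x : 'cV[R]_p) (h : R) : 0 <= h ->
  (forall i, `|x i 0| <= h) -> l2norm x <= p%:R * h.
Proof.
move=> h0 xh.
rewrite -(@ler_pXn2r _ 2)// ?nnegrE ?mulr_ge0 ?l2norm_ge0//.
rewrite l2norm_sqr (@le_trans _ _ (\sum_(i < p) h ^+ 2))//.
  apply: ler_sum => i _; rewrite -expr2 -[_ ^+ 2]real_normK ?num_real//.
  by rewrite ler_sqr ?nnegrE.
rewrite sumr_const card_ord exprMn -[X in X <= _]mulr_natl ler_wpM2r ?sqr_ge0//.
by rewrite -natrX ler_nat; case: (p) => // r; rewrite expnS leq_pmulr.
Qed.

(** A Frobenius bound, serving to show that the set in [spectral_norm] is bounded above, so that its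
    [sup] is a true upper bound. *)
Lemma spectral_norm_bounded p q (A : 'M[R]_(p, q)) (x : 'cV[R]_q) :
  l2norm (A *m x) ^+ 2 <= (\sum_i dotv (row i A)^T (row i A)^T) * l2norm x ^+ 2.
Proof.
rewrite l2norm_sqr mulr_suml; apply: ler_sum => i _.
rewrite -expr2 l2norm_sqr.
have -> : (A *m x) i 0 = dotv (row i A)^T x.
  by rewrite mxE; apply: eq_bigr => j _; rewrite !mxE.
exact: dotv_sqr_le.
Qed.

Lemma l2norm_spectral p q (A : 'M[R]_(p, q)) (x : 'cV[R]_q) :
  l2norm (A *m x) <= spectral_norm A * l2norm x.
Proof.
have [->|x0] := eqVneq x 0; first by rewrite mulmx0 !l2norm0 mulr0.
have nx : 0 < l2norm x by rewrite l2norm_gt0.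
rewrite -ler_pdivrMr//.
have -> : l2norm (A *m x) / l2norm x = l2norm (A *m normalize x).
  rewrite /normalize -scalemxAr l2normZ ger0_norm ?invr_ge0 ?l2norm_ge0//.
  by rewrite mulrC.
apply: ub_le_sup; last first.
  exists (normalize x) => //=; rewrite /normalize l2normZ.
  by rewrite ger0_norm ?invr_ge0 ?l2norm_ge0// mulVf// gt_eqF.
pose S := \sum_i dotv (row i A)^T (row i A)^T.
have S0 : 0 <= S by apply: sumr_ge0 => i _; exact: dotv_ge0.
exists (Num.sqrt S) => _ [y /= y1 <-].
rewrite -(@ler_pXn2r _ 2)// ?nnegrE ?sqrtr_ge0 ?l2norm_ge0// [leRHS]sqr_sqrtr//.
apply: le_trans (spectral_norm_bounded A y) _.
by rewrite ler_piMr// expr_le1// l2norm_ge0.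
Qed.

Lemma dotv_spectral p (A : 'M[R]_p) (x z : 'cV[R]_p) :
  `|dotv x (A *m z)| <= spectral_norm A * (l2norm x * l2norm z).
Proof.
apply: le_trans (cauchy_schwarz _ _) _.
by rewrite mulrCA ler_wpM2l ?l2norm_ge0// l2norm_spectral.
Qed.

Lemma cos_itv p (x z : 'cV[R]_p) :
  -1 <= dotv x z / (l2norm x * l2norm z) <= 1.
Proof.
have [xz0|xz0] := eqVneq (l2norm x * l2norm z) 0.
  by rewrite xz0 invr0 mulr0 lerN10 ler01.
rewrite -ler_norml normrM normfV [X in _ / X]ger0_norm ?mulr_ge0 ?l2norm_ge0//.
have xz : 0 < l2norm x * l2norm z by rewrite lt_def xz0 mulr_ge0 ?l2norm_ge0.
by rewrite ler_pdivrMr// mul1r cauchy_schwarz.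
Qed.

Lemma l2norm_normalize p (x : 'cV[R]_p) : x != 0 -> x = l2norm x *: normalize x.
Proof.
by move=> x0; rewrite /normalize scalerA mulfV ?scale1r// l2norm_eq0.
Qed.

(** Since the swap sends the direction of [z] to that of [x], the form sees only the angle: the
    scalar part gives [(pi - t) cos t] and the swap gives [sin t]. *)
Lemma dotv_wdc_mx p (x z : 'cV[R]_p) : x != 0 -> z != 0 ->
  dotv x (wdc_mx x z *m z) =
  2^-1 * (l2norm x * l2norm z * cosmap (dotv x z / (l2norm x * l2norm z))).
Proof.
move=> x0 z0; rewrite /wdc_mx /angle; set c := dotv x z / _.
have cI : -1 <= c <= 1 by exact: cos_itv.
have [_ swapz _] := swap_mxP (dotv_normalize x0) (dotv_normalize z0).
have swapE S : S *m normalize z = normalize x -> S *m z = l2norm z *: normalize x.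
  by move=> h; rewrite {1}(l2norm_normalize z0) -scalemxAr h.
rewrite mulmxDl mul_scalar_mx -scalemxAl (swapE _ swapz).
rewrite dotvDr !dotvZr -l2norm_sqr.
have nx : l2norm x != 0 by rewrite l2norm_eq0.
have nz : l2norm z != 0 by rewrite l2norm_eq0.
have -> : dotv x z = l2norm x * l2norm z * c by rewrite /c; field; rewrite nx nz.
rewrite /cosmap /cos_angle_map acosK ?in_itv//=.
have : (pi : R) != 0 by rewrite gt_eqF// pi_gt0.
by move: pi => p0 p0n; field; rewrite p0n nx.
Qed.

End EuclideanSpace.

(** * One layer under the WDC *)

Section WDCLayer.
Context {R : realType}.
Implicit Types p q : nat.

Definition relu p (v : 'cV[R]_p) : 'cV[R]_p := map_mx (fun t => Num.max t 0) v.

Lemma relu_active q p (W : 'M[R]_(q, p)) (x : 'cV[R]_p) :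
  relu (W *m x) = active_mx W x *m x.
Proof.
apply/matrixP => i j.
rewrite ord1 /active_mx -mulmxA mul_diag_mx !mxE; set s := \sum_k _.
by rewrite maxEle; case: ltP => _; rewrite ?mul1r ?mul0r.
Qed.

Lemma reluZ p (c : R) (v : 'cV[R]_p) : 0 <= c -> relu (c *: v) = c *: relu v.
Proof. by move=> c0; apply/matrixP => i j; rewrite !mxE maxr_pMr// mulr0. Qed.

Lemma relu0 p : relu (0 : 'cV[R]_p) = 0.
Proof. by apply/matrixP => i j; rewrite !mxE maxxx. Qed.

Lemma relu_lipschitz p (u v : 'cV[R]_p) : l2norm (relu u - relu v) <= l2norm (u - v).
Proof.
apply: ler_wsqrtr; apply: ler_sum => i _; rewrite -!expr2 !mxE.
move: (u i 0) (v i 0) => a b.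
have [a0|a0] := leP a 0; have [b0|b0] := leP b 0; rewrite -subr_ge0.
- by rewrite subrr expr0n subr0 sqr_ge0.
- have -> : (a - b) ^+ 2 - (0 - b) ^+ 2 = a ^+ 2 + 2 * (- a * b) by ring.
  by rewrite addr_ge0 ?sqr_ge0// !mulr_ge0 ?oppr_ge0// ltW.
- have -> : (a - b) ^+ 2 - (a - 0) ^+ 2 = b ^+ 2 + 2 * (a * - b) by ring.
  by rewrite addr_ge0 ?sqr_ge0// !mulr_ge0 ?oppr_ge0// ltW.
- by rewrite subrr.
Qed.

Lemma relu_split p (v : 'cV[R]_p) :
  l2norm v ^+ 2 = l2norm (relu v) ^+ 2 + l2norm (relu (- v)) ^+ 2.
Proof.
rewrite !l2norm_sqr /dotv -big_split/=; apply: eq_bigr => i _; rewrite !mxE.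
have [?|?] := leP (v i 0) 0; have [?|?] := leP (- v i 0) 0; nra.
Qed.

Variables (q p : nat) (W : 'M[R]_(q, p)) (eps : R).
Hypothesis wdc : WDC eps W.

Lemma wdc_dotv (x z : 'cV[R]_p) : x != 0 -> z != 0 ->
  `|dotv (relu (W *m x)) (relu (W *m z)) -
    2^-1 * (l2norm x * l2norm z * cosmap (dotv x z / (l2norm x * l2norm z)))| <=
  eps * (l2norm x * l2norm z).
Proof.
move=> x0 z0; rewrite -dotv_wdc_mx// !relu_active.
have -> : dotv (active_mx W x *m x) (active_mx W z *m z) =
  dotv x ((active_mx W x)^T *m active_mx W z *m z).
  by rewrite !dotvE trmx_mul !mulmxA.
rewrite -dotvBr -mulmxBl; apply: le_trans (dotv_spectral _ _ _) _.
by rewrite ler_wpM2r ?mulr_ge0 ?l2norm_ge0// wdc.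
Qed.

Lemma wdc_norm (x : 'cV[R]_p) :
  (2^-1 - eps) * l2norm x ^+ 2 <= l2norm (relu (W *m x)) ^+ 2 <=
  (2^-1 + eps) * l2norm x ^+ 2.
Proof.
have [->|x0] := eqVneq x 0; first by rewrite mulmx0 relu0 !l2norm0 expr0n !mulr0 lexx.
have := wdc_dotv x0 x0; rewrite -!l2norm_sqr -expr2 divff ?cosmap1; last first.
  by rewrite expf_eq0/= l2norm_eq0.
by rewrite mulr1 ler_norml => /andP[h1 h2]; apply/andP; split; lra.
Qed.

(** The positive and negative parts of [W x] are orthogonal and are images of [x] and [- x] under
    the layer, each with squared norm at most [(1/2 + eps) ||x||^2]. As [W] is linear, this is a
    Lipschitz bound without additive error. *)
Lemma wdc_lipschitz (x : 'cV[R]_p) : l2norm (W *m x) ^+ 2 <= (1 + 2 * eps) * l2norm x ^+ 2.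
Proof.
rewrite relu_split -mulmxN.
have /andP[_ h1] := wdc_norm x; have /andP[_ h2] := wdc_norm (- x).
by rewrite l2normN in h2; lra.
Qed.

(** By [c <= cosmap c] the inner product of the images is at least half that of the arguments, up to
    [eps]. The factor 1/2 is the right one, at the price of a term that does not vanish as [x]
    approaches [z]. *)
Lemma wdc_approx_lipschitz (x z : 'cV[R]_p) : 0 <= eps ->
  l2norm (relu (W *m x) - relu (W *m z)) ^+ 2 <=
  2^-1 * l2norm (x - z) ^+ 2 + eps * (l2norm x + l2norm z) ^+ 2.
Proof.
move=> eps0; rewrite !l2norm_sqrB.
have /andP[_ hx] := wdc_norm x; have /andP[_ hz] := wdc_norm z.
have [x0|x0] := eqVneq x 0.
  by rewrite x0 mulmx0 relu0 !dotv0l !l2norm0 expr0n/=; lra.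
have [z0|z0] := eqVneq z 0.
  by rewrite z0 mulmx0 relu0 !dotv0r !l2norm0 expr0n/=; lra.
have := wdc_dotv x0 z0; rewrite ler_norml => /andP[+ _].
have := cosmap_ge (cos_itv x z); set c := dotv x z / _.
have xz : 0 < l2norm x * l2norm z by rewrite mulr_gt0 ?l2norm_gt0.
have -> : dotv x z = l2norm x * l2norm z * c by rewrite /c mulrC divfK// gt_eqF.
move=> h h2; have := ler_wpM2l (ltW xz) h; lra.
Qed.

End WDCLayer.

(** * Norms, distances and angles through the whole network *)

Section NetworkGeometry.
Context {R : realType}.
Variables (dims : nat -> nat) (W : forall i, 'M[R]_(dims i.+1, dims i)).
Variables (eps : R).
Hypothesis eps_ge0 : 0 <= eps.
Implicit Types (n : nat) (x z : 'cV[R]_(dims 0)).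

Lemma relu_netS n x : relu_net W n.+1 x = relu (W n *m relu_net W n x).
Proof. by []. Qed.

Lemma relu_netZ n (c : R) x : 0 <= c -> relu_net W n (c *: x) = c *: relu_net W n x.
Proof.
move=> c0; elim: n => [//|n IH].
by rewrite !relu_netS IH -scalemxAr reluZ.
Qed.

Lemma relu_net_norm_le n x : (forall i, (i < n)%N -> WDC eps (W i)) ->
  l2norm (relu_net W n x) ^+ 2 <= (2^-1 + eps) ^+ n * l2norm x ^+ 2.
Proof.
elim: n => [_|n IH wdc]; first by rewrite expr0 mul1r.
have /andP[_ h] := wdc_norm (wdc n (leqnn _)) (relu_net W n x).
rewrite relu_netS (le_trans h)// (exprS _ n) -mulrA ler_wpM2l//; first by have := eps_ge0; lra.
by apply: IH => i ilt; apply: wdc; rewrite ltnS ltnW.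
Qed.

Lemma relu_net_norm_ge n x : eps <= 2^-1 -> (forall i, (i < n)%N -> WDC eps (W i)) ->
  (2^-1 - eps) ^+ n * l2norm x ^+ 2 <= l2norm (relu_net W n x) ^+ 2.
Proof.
move=> eps2; elim: n => [_|n IH wdc]; first by rewrite expr0 mul1r.
have /andP[h _] := wdc_norm (wdc n (leqnn _)) (relu_net W n x).
rewrite relu_netS; apply: le_trans h; rewrite (exprS _ n) -mulrA ler_wpM2l//; first by have := eps_ge0; lra.
by apply: IH => i ilt; apply: wdc; rewrite ltnS ltnW.
Qed.

Lemma relu_net_lipschitz n x z : (forall i, (i < n)%N -> WDC eps (W i)) ->
  l2norm (relu_net W n x - relu_net W n z) ^+ 2 <= (1 + 2 * eps) ^+ n * l2norm (x - z) ^+ 2.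
Proof.
elim: n => [_|n IH wdc]; first by rewrite expr0 mul1r.
rewrite !relu_netS.
apply: (@le_trans _ _ (l2norm (W n *m (relu_net W n x - relu_net W n z)) ^+ 2)).
  by rewrite mulmxBr ler_sqr ?nnegrE ?l2norm_ge0// relu_lipschitz.
apply: le_trans (wdc_lipschitz (wdc n (leqnn _)) _) _.
rewrite (exprS _ n) -mulrA ler_wpM2l//; first by have := eps_ge0; lra.
by apply: IH => i ilt; apply: wdc; rewrite ltnS ltnW.
Qed.

(** The error of a layer is relative to its input, which has itself shrunk by [(1/2 + eps)^n].
    Relative to the contracted scale each layer therefore adds at most [2 * eps]. *)
Lemma relu_net_approx_lipschitz n x z : (forall i, (i < n)%N -> WDC eps (W i)) ->
  l2norm (relu_net W n x - relu_net W n z) ^+ 2 <= (2^-1 + eps) ^+ n *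
    (l2norm (x - z) ^+ 2 + 2 * n%:R * eps * (l2norm x + l2norm z) ^+ 2).
Proof.
elim: n => [_|n IH wdc].
  by rewrite expr0 mul1r mulr0 !mul0r addr0.
have wdc' i : (i < n)%N -> WDC eps (W i) by move=> ilt; apply: wdc; rewrite ltnS ltnW.
have {}IH := IH wdc'.
rewrite !relu_netS.
apply: le_trans (wdc_approx_lipschitz (wdc n (leqnn _)) _ _ eps_ge0) _.
have hx := relu_net_norm_le x wdc'; have hz := relu_net_norm_le z wdc'.
set D := l2norm (_ - _) in IH *.
set X := l2norm (relu_net W n x) in hx *; set Z := l2norm (relu_net W n z) in hz *.
set Q := (2^-1 + eps) ^+ n in IH hx hz *.
have Q0 : 0 <= Q by rewrite exprn_ge0// addr_ge0.
have XZ : (X + Z) ^+ 2 <= Q * (l2norm x + l2norm z) ^+ 2.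
  have X0 := l2norm_ge0 (relu_net W n x); have Z0 := l2norm_ge0 (relu_net W n z).
  have x0 := l2norm_ge0 x; have z0 := l2norm_ge0 z.
  have XZ2 : X * Z <= Q * (l2norm x * l2norm z).
    rewrite -(@ler_pXn2r _ 2)// ?nnegrE ?mulr_ge0// !exprMn.
    have -> : Q ^+ 2 * (l2norm x ^+ 2 * l2norm z ^+ 2) =
      (Q * l2norm x ^+ 2) * (Q * l2norm z ^+ 2) by ring.
    by rewrite ler_pM// sqr_ge0.
  rewrite !sqrrD; lra.
set S := (l2norm x + l2norm z) ^+ 2 in IH XZ *.
have S0 : 0 <= S by rewrite sqr_ge0.
set d := l2norm (x - z) ^+ 2 in IH *.
have d0 : 0 <= d by rewrite sqr_ge0.
rewrite (exprS _ n) -/Q -[n.+1%:R]natr1.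
clearbody S d D X Z Q.
have h1 := ler_wpM2l eps_ge0 XZ.
have n0 : 0 <= n%:R :> R by [].
have h2 : 0 <= eps * (Q * (d + 2 * n%:R * eps * S)).
  have h20 : 0 <= 2 * n%:R * eps * S by rewrite !mulr_ge0.
  by rewrite mulr_ge0 ?eps_ge0 ?mulr_ge0 ?addr_ge0.
have h3 : 0 <= eps * (Q * (eps * S)) by rewrite !mulr_ge0.
nra.
Qed.

(** The cosine starts at exactly -1; each layer applies [cosmap] up to [8 * eps], and a 1-Lipschitz
    map does not amplify the errors inherited from below. *)
Lemma relu_net_cos n x : x != 0 -> eps <= 4^-1 ->
  (forall i, (i < n)%N -> WDC eps (W i)) ->
  `|dotv (relu_net W n x) (relu_net W n (- x)) /
      (l2norm (relu_net W n x) * l2norm (relu_net W n (- x))) - cos (varrho n)|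
  <= 8 * n%:R * eps.
Proof.
move=> x0 eps4; elim: n => [_|n IH wdc].
  rewrite /= dotvNr l2normN -l2norm_sqr -expr2 mulNr mulfV ?varrho0 ?cospi; last first.
    by rewrite expf_eq0/= l2norm_eq0.
  by rewrite subrr normr0 mulr0 mul0r.
have wdc' i : (i < n)%N -> WDC eps (W i) by move=> ilt; apply: wdc; rewrite ltnS ltnW.
have net_neq0 (y : 'cV[R]_(dims 0)) : y != 0 -> relu_net W n y != 0.
  move=> y0; have eps2 : eps <= 2^-1 by lra.
  have := relu_net_norm_ge y eps2 wdc'.
  rewrite -l2norm_gt0 => h; rewrite lt_def l2norm_ge0 andbT.
  apply/eqP => e; move: h; rewrite e expr0n/= leNgt mulr_gt0//.
    by rewrite exprn_gt0//; lra.
  by rewrite exprn_gt0// l2norm_gt0.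
have u0 := net_neq0 _ x0.
have /net_neq0 v0 : - x != 0 by rewrite oppr_eq0.
move: IH => /(_ wdc'); rewrite !relu_netS.
set u := relu_net W n x in u0 *; set v := relu_net W n (- x) in v0 *.
have := wdc_dotv (wdc n (leqnn _)) u0 v0.
have /andP[Hu Hu'] := wdc_norm (wdc n (leqnn _)) u.
have /andP[Hv Hv'] := wdc_norm (wdc n (leqnn _)) v.
have cI := cos_itv u v.
set c := dotv u v / _ in cI *.
set N := l2norm u * l2norm v.
have N0 : 0 < N by rewrite mulr_gt0 ?l2norm_gt0.
set N' := l2norm (relu (W n *m u)) * l2norm (relu (W n *m v)).
have E1 : (2^-1 - eps) * N <= N'.
  rewrite -(@ler_pXn2r _ 2)// ?nnegrE ?mulr_ge0 ?l2norm_ge0 ?(ltW N0)//; last lra.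
  rewrite /N' /N !exprMn.
  have -> : (2^-1 - eps) ^+ 2 * (l2norm u ^+ 2 * l2norm v ^+ 2) =
    ((2^-1 - eps) * l2norm u ^+ 2) * ((2^-1 - eps) * l2norm v ^+ 2) by ring.
  by rewrite ler_pM// mulr_ge0 ?sqr_ge0//; lra.
have E2 : N' <= (2^-1 + eps) * N.
  have eps20 : 0 <= 2^-1 + eps by rewrite addr_ge0.
  rewrite -(@ler_pXn2r _ 2)// ?nnegrE ?mulr_ge0 ?l2norm_ge0 ?(ltW N0)//.
  rewrite /N' /N !exprMn.
  have -> : (2^-1 + eps) ^+ 2 * (l2norm u ^+ 2 * l2norm v ^+ 2) =
    ((2^-1 + eps) * l2norm u ^+ 2) * ((2^-1 + eps) * l2norm v ^+ 2) by ring.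
  by rewrite ler_pM// sqr_ge0.
set p' := dotv _ _ => wp cn.
have N'0 : 0 < N' by apply: lt_le_trans E1; rewrite mulr_gt0//; lra.
have ps0 := cosmap_ge0 cI; have ps1 := cosmap_le1 cI.
(* The inner product and the product of norms are each off by at most [eps * N], and dividing by
   [N' >= N / 4] gives the factor 8. *)
have step : `|p' / N' - cosmap c| <= 8 * eps.
  have -> : p' / N' - cosmap c = (p' - N' * cosmap c) / N'.
    by field; rewrite gt_eqF.
  rewrite normrM normfV (gtr0_norm N'0) ler_pdivrMr//.
  move: wp; rewrite !ler_norml => /andP[w1 w2].
  have h1 : N' * cosmap c <= (2^-1 + eps) * N * cosmap c by rewrite ler_wpM2r.
  have h2 : (2^-1 - eps) * N * cosmap c <= N' * cosmap c by rewrite ler_wpM2r.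
  have h3 : eps * (N * cosmap c) <= eps * N by rewrite ler_wpM2l// ler_piMr// ltW.
  have h4 : eps * (4^-1 * N) <= eps * N'.
    by rewrite ler_wpM2l//; apply: le_trans E1; rewrite ler_wpM2r ?(ltW N0)//; lra.
  by apply/andP; split; lra.
have lip : `|cosmap c - cosmap (cos (varrho n))| <= 8 * n%:R * eps.
  by apply: le_trans cn; apply: cosmap_lipschitz => //; exact: cos_varrho_itv.
rewrite cos_varrhoS -(subrKA (cosmap c)) -[n.+1%:R]natr1.
by apply: le_trans (ler_normD _ _) _; lra.
Qed.

End NetworkGeometry.

(** * The deterministic landscape *)

Section Landscape.
Context {R : realType}.
Variables (dims : nat -> nat) (W : forall i, 'M[R]_(dims i.+1, dims i)).

Lemma expr1D_le (t : R) n : 0 <= t -> n%:R * t <= 2^-1 -> (1 + t) ^+ n <= 1 + 2 * n%:R * t.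
Proof.
move=> t0; elim: n => [_|n IH]; first by rewrite expr0 mulr0 mul0r addr0.
rewrite -[n.+1%:R]natr1 => h; have n0 : 0 <= n%:R :> R by [].
have nt : n%:R * t <= 2^-1 by lra.
rewrite exprS; apply: (@le_trans _ _ ((1 + t) * (1 + 2 * n%:R * t))).
  by rewrite ler_wpM2l// ?IH// addr_ge0.
have := ler_wpM2l t0 h; nra.
Qed.

Lemma expr1B_ge (t : R) n : 0 <= t -> t <= 1 -> 1 - n%:R * t <= (1 - t) ^+ n.
Proof.
move=> t0 t1; elim: n => [|n IH]; first by rewrite expr0 mul0r subr0.
rewrite (exprS _ n) -[n.+1%:R]natr1; apply: (@le_trans _ _ ((1 - t) * (1 - n%:R * t))); last first.
  by rewrite ler_wpM2l// subr_ge0.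
have n0 : 0 <= n%:R :> R by [].
have := mulr_ge0 n0 (sqr_ge0 t); lra.
Qed.

(** The part linear in [h] is [- 2 (1 - c) <g, h>], at most [4 mu r^2]; the square of [h] adds
    [mu r^2]. *)
Lemma quad_perturb_le p (g h : 'cV[R]_p) (c r mu : R) : 0 <= c <= 1 -> 0 <= r ->
  0 <= mu <= 1 -> l2norm g <= 2 * r -> l2norm h <= mu * r ->
  l2norm (c *: g + h) ^+ 2 - 2 * dotv g (c *: g + h) <=
  (c ^+ 2 - 2 * c) * l2norm g ^+ 2 + 5 * mu * r ^+ 2.
Proof.
move=> /andP[c0 c1] r0 /andP[mu0 mu1] gr hr.
rewrite l2norm_sqrD dotvDr dotvZl dotvZr l2normZ (ger0_norm c0) -!l2norm_sqr exprMn.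
have gh : `|dotv g h| <= 2 * r * (mu * r).
  by apply: le_trans (cauchy_schwarz _ _) _; rewrite ler_pM ?l2norm_ge0.
have hh : l2norm h ^+ 2 <= mu * r ^+ 2.
  apply: (@le_trans _ _ ((mu * r) ^+ 2)).
    by rewrite ler_sqr ?nnegrE ?l2norm_ge0 ?mulr_ge0.
  by rewrite exprMn ler_wpM2r ?sqr_ge0// expr2 ler_piMr.
have : (1 - c) * (- dotv g h) <= 1 * (2 * r * (mu * r)).
  apply: (@le_trans _ _ ((1 - c) * (2 * r * (mu * r)))).
    rewrite ler_wpM2l ?subr_ge0//; apply: le_trans gh.
    by rewrite -normrN ler_norm.
  by rewrite ler_wpM2r//; [exact: le_trans gh|lra].
lra.
Qed.

Lemma quad_perturb_ge p (g g' h : 'cV[R]_p) (c r mu : R) : 0 <= c <= 1 -> 0 <= r ->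
  l2norm g <= 2 * r -> l2norm g' <= 2 * r -> l2norm h <= mu * r ->
  c ^+ 2 * l2norm g' ^+ 2 - 2 * c * dotv g g' - 8 * mu * r ^+ 2 <=
  l2norm (c *: g' + h) ^+ 2 - 2 * dotv g (c *: g' + h).
Proof.
move=> /andP[c0 c1] r0 gr gr' hr.
rewrite l2norm_sqrD dotvDr dotvZl dotvZr l2normZ (ger0_norm c0) exprMn.
have mr0 : 0 <= mu * r by exact: le_trans (l2norm_ge0 h) hr.
have gh : dotv g h <= 2 * r * (mu * r).
  by apply: le_trans (dotv_le _ _) _; rewrite ler_pM ?l2norm_ge0.
have gh' : - dotv g' h <= 2 * r * (mu * r).
  apply: le_trans (_ : l2norm g' * l2norm h <= _); last by rewrite ler_pM ?l2norm_ge0.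
  by rewrite -dotvNr (le_trans (dotv_le _ _))// l2normN.
have : c * (- dotv g' h) <= 1 * (2 * r * (mu * r)).
  apply: (@le_trans _ _ (c * (2 * r * (mu * r)))); first by rewrite ler_wpM2l.
  rewrite ler_wpM2r//; apply: le_trans (_ : l2norm g * l2norm h <= _).
    by rewrite mulr_ge0 ?l2norm_ge0.
  by rewrite ler_pM ?l2norm_ge0.
have := sqr_ge0 (l2norm h); lra.
Qed.

Variables (n : nat) (y b : R).
Hypothesis n_gt1 : (1 < n)%N.
Hypothesis b_gt0 : 0 < b.
Hypothesis b_small : 1000 * b <= 1.
Hypothesis y_gt0 : 0 < y.
Hypothesis y_small : n%:R ^+ 3 * y <= b.
Hypothesis wdc : forall i, (i < n)%N -> WDC (y ^+ 4) (W i).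

(** Taking the fourth root [y] of the WDC constant as the parameter keeps every estimate polynomial.
    [T] is the nominal shrinkage 2^(n/2), and [w = n^-2] is the order of [1 - rho n], against which
    all errors are measured. *)
Let eps := y ^+ 4.
Let T : R := Num.sqrt 2 ^+ n.
Let w : R := (n%:R ^+ 2)^-1.

Let T_gt0 : 0 < T. Proof. by rewrite exprn_gt0// sqrtr_gt0. Qed.

Let T2 : T ^+ 2 = 2 ^+ n.
Proof. by rewrite /T -exprM mulnC exprM sqr_sqrtr. Qed.

Let n_ge2 : 2 <= n%:R :> R. Proof. by rewrite ler_nat. Qed.

Let w_gt0 : 0 < w. Proof. by rewrite invr_gt0 exprn_gt0// (lt_le_trans _ n_ge2). Qed.

Let w_le4 : w <= 4^-1.
Proof.
have n2 := n_ge2; rewrite lef_pV2 ?posrE ?exprn_gt0//; last by lra.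
by have := sqr_ge0 (n%:R - 2 : R); nra.
Qed.

Let b_le : b <= 10^-1.
Proof. by have := b_small; have := b_gt0; lra. Qed.

Let b2_le : b ^+ 2 <= b / 10.
Proof. by rewrite expr2 ler_wpM2l ?b_le// ltW. Qed.

Let b4_le : b ^+ 4 <= b ^+ 2 / 1000.
Proof.
rewrite (exprD b 2 2) ler_wpM2l ?sqr_ge0// expr2.
apply: le_trans (_ : b * 1 <= _); first by rewrite ler_wpM2l ?ltW//; have := b_le; lra.
by have := b_small; lra.
Qed.

Let ny_le : n%:R * y <= w * b.
Proof.
have n2 := n_ge2; rewrite /w ler_pdivlMl; last by rewrite exprn_gt0//; lra.
by apply: le_trans y_small; rewrite le_eqVlt; apply/orP; left; apply/eqP; ring.
Qed.

Let y_le : y <= w * b.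
Proof. by apply: le_trans ny_le; have n2 := n_ge2; rewrite ler_peMl ?(ltW y_gt0)//; lra. Qed.

Let neps_le : n%:R * eps <= w ^+ 2 * b ^+ 4.
Proof.
have -> : n%:R * eps = (n%:R * y) * y ^+ 3 by rewrite /eps; ring.
apply: (@le_trans _ _ ((w * b) * (w * b) ^+ 3)).
  apply: ler_pM; [by rewrite mulr_ge0// ltW|by rewrite exprn_ge0// ltW|exact: ny_le|].
  by rewrite lerXn2r ?nnegrE ?(ltW y_gt0) ?mulr_ge0 ?(ltW w_gt0) ?(ltW b_gt0) ?y_le.
have -> : w * b * (w * b) ^+ 3 = w ^+ 2 * b ^+ 4 * w ^+ 2 by ring.
apply: ler_piMr; first by rewrite mulr_ge0 ?sqr_ge0 ?exprn_ge0 ?(ltW b_gt0).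
by have := w_le4; have := w_gt0; nra.
Qed.

Let eps_gt0 : 0 < eps. Proof. exact: exprn_gt0. Qed.

(** Relative error of [||G x||^2] against [||x||^2 / 2^n], read off from
    [(1 + 2 eps)^n <= 1 + 2 n (2 eps)]. *)
Let kappa : R := 4 * n%:R * eps.

Let w2_le : w ^+ 2 <= w / 4.
Proof. by rewrite expr2 ler_wpM2l// ltW. Qed.

Let kappa_ge0 : 0 <= kappa.
Proof. by rewrite /kappa mulr_ge0 ?mulr_ge0// ltW. Qed.

Let kappa_le : kappa <= w * b ^+ 2.
Proof.
rewrite /kappa -mulrA; have := neps_le.
have : w ^+ 2 * b ^+ 4 <= (w / 4) * b ^+ 2.
  apply: ler_pM; rewrite ?sqr_ge0 ?exprn_ge0 ?(ltW b_gt0) ?w2_le//.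
  by have := b4_le; have := sqr_ge0 b; lra.
lra.
Qed.

Let kappa_le1 : kappa <= 400^-1.
Proof.
apply: le_trans kappa_le _; apply: le_trans (_ : 4^-1 * (b / 10) <= _).
  by apply: ler_pM; rewrite ?sqr_ge0 ?(ltW w_gt0).
by have := b_le; lra.
Qed.

Let eps_le : eps <= 4^-1.
Proof.
have := kappa_le1; rewrite /kappa; have := n_ge2.
have := ltW eps_gt0 => e0 n2; have := ler_wpM2r e0 n2; lra.
Qed.

Let up_le : (1 + 2 * eps) ^+ n <= 1 + kappa.
Proof.
have -> : kappa = 2 * n%:R * (2 * eps) by rewrite /kappa; ring.
apply: expr1D_le; first by rewrite mulr_ge0// ltW.
have := kappa_le1; rewrite /kappa; lra.
Qed.

Let dn_ge : 1 - kappa <= (1 - 2 * eps) ^+ n.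
Proof.
apply: le_trans (expr1B_ge n (_ : 0 <= 2 * eps) _); last 2 first.
- by rewrite mulr_ge0// ltW.
- by have := eps_le; lra.
rewrite /kappa lerD2l lerN2.
have : 0 <= n%:R * eps by rewrite mulr_ge0// ltW.
by lra.
Qed.

Let up_eq (t : R) : (2^-1 + eps) ^+ n * t ^+ 2 = (1 + 2 * eps) ^+ n * (t / T) ^+ 2.
Proof.
have -> : 2^-1 + eps = (1 + 2 * eps) / 2 by field.
by rewrite expr_div_n exprMn exprVn T2 -exprVn; ring.
Qed.

Let dn_eq (t : R) : (2^-1 - eps) ^+ n * t ^+ 2 = (1 - 2 * eps) ^+ n * (t / T) ^+ 2.
Proof.
have -> : 2^-1 - eps = (1 - 2 * eps) / 2 by field.
by rewrite expr_div_n exprMn exprVn T2 -exprVn; ring.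
Qed.

Let G := relu_net W n.

Let G_sqr x : (1 - kappa) * (l2norm x / T) ^+ 2 <= l2norm (G x) ^+ 2 <=
  (1 + kappa) * (l2norm x / T) ^+ 2.
Proof.
have e2 : eps <= 2^-1 by have := eps_le; lra.
apply/andP; split.
  apply: le_trans (relu_net_norm_ge (ltW eps_gt0) x e2 wdc).
  by rewrite dn_eq ler_wpM2r// sqr_ge0.
apply: le_trans (relu_net_norm_le (ltW eps_gt0) x wdc) _.
by rewrite up_eq ler_wpM2r// sqr_ge0.
Qed.

Let ball_norm_le (t : R) (x0 x : 'cV[R]_(dims 0)) : 0 <= t <= 1 ->
  l2norm (x - t *: x0) <= delta3 (b / 4) n x0 ->
  l2norm (x - t *: x0) <= w * (b / 4) * l2norm x0 /\ l2norm x <= 2 * l2norm x0.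
Proof.
move=> /andP[t0 t1] xt; have x00 := l2norm_ge0 x0.
have n5 : n%:R ^- 5 <= w.
  rewrite /w lef_pV2 ?posrE ?exprn_gt0 ?ltr0n ?(ltn_trans _ n_gt1)//.
  by rewrite ler_weXn2l// ler1n ltnW.
have h1 : l2norm (x - t *: x0) <= w * (b / 4) * l2norm x0.
  by apply: le_trans xt _; rewrite /delta3 ler_wpM2r// mulrC ler_wpM2r// divr_ge0 ?(ltW b_gt0).
split => //; apply: le_trans (l2norm_triangleB x (t *: x0)) _.
rewrite l2normZ ger0_norm//.
have h2 : t * l2norm x0 <= 1 * l2norm x0 by rewrite ler_wpM2r.
have h3 : w * (b / 4) * l2norm x0 <= 1 * l2norm x0.
  rewrite ler_wpM2r// (@le_trans _ _ (4^-1 * 1))//; last by lra.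
  by rewrite ler_pM ?divr_ge0 ?(ltW w_gt0) ?(ltW b_gt0)//; have := b_le; lra.
lra.
Qed.

(** The error-free Lipschitz bound would lose the factor [T] here. The sharp one keeps the scale
    [||x0|| / T], and its additive term of order [n * eps] is dominated by [w^2 b^2]. *)
Let G_near (t : R) (x0 x : 'cV[R]_(dims 0)) : 0 <= t <= 1 ->
  l2norm (x - t *: x0) <= delta3 (b / 4) n x0 ->
  l2norm (G x - t *: G x0) <= w * b * (l2norm x0 / T).
Proof.
move=> t01 xt; have [xt' x2] := ball_norm_le t01 xt.
have /andP[t0 t1] := t01; have x00 := l2norm_ge0 x0.
rewrite /G -relu_netZ// -(@ler_pXn2r _ 2)// ?nnegrE ?l2norm_ge0//; last first.
  by rewrite !mulr_ge0 ?invr_ge0 ?(ltW w_gt0) ?(ltW b_gt0) ?(ltW T_gt0).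
apply: le_trans (relu_net_approx_lipschitz (ltW eps_gt0) _ _ wdc) _.
set X := l2norm x0 in xt' x2 x00 *.
have h1 : l2norm (x - t *: x0) ^+ 2 <= w ^+ 2 * (b ^+ 2 / 16) * X ^+ 2.
  have -> : w ^+ 2 * (b ^+ 2 / 16) * X ^+ 2 = (w * (b / 4) * X) ^+ 2 by field.
  by rewrite ler_sqr ?nnegrE ?l2norm_ge0// (le_trans _ xt')// l2norm_ge0.
have h2 : (l2norm x + l2norm (t *: x0)) ^+ 2 <= 9 * X ^+ 2.
  have -> : 9 * X ^+ 2 = (3 * X) ^+ 2 by ring.
  rewrite ler_sqr ?nnegrE ?addr_ge0 ?l2norm_ge0 ?mulr_ge0//.
  have : t * X <= 1 * X by rewrite ler_wpM2r.
  rewrite l2normZ ger0_norm// -/X; lra.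
have ne0 : 0 <= n%:R * y ^+ 4 by rewrite mulr_ge0// ltW.
have h3 := ler_wpM2l ne0 h2.
have h4 : n%:R * y ^+ 4 * X ^+ 2 <= w ^+ 2 * (b ^+ 2 / 1000) * X ^+ 2.
  rewrite ler_wpM2r ?sqr_ge0//; apply: le_trans neps_le _.
  by rewrite ler_wpM2l ?sqr_ge0.
have h5 : l2norm (x - t *: x0) ^+ 2 +
  2 * n%:R * y ^+ 4 * (l2norm x + l2norm (t *: x0)) ^+ 2 <=
  (w * (b / 2) * X) ^+ 2.
  have := mulr_ge0 (mulr_ge0 (sqr_ge0 w) (sqr_ge0 b)) (sqr_ge0 X); lra.
apply: (@le_trans _ _ ((2^-1 + eps) ^+ n * (w * (b / 2) * X) ^+ 2)).
  by rewrite ler_wpM2l// exprn_ge0// addr_ge0// ltW.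
rewrite up_eq.
have -> : (w * b * (X / T)) ^+ 2 = 4 * (w * (b / 2) * X / T) ^+ 2.
  by field; rewrite gt_eqF.
rewrite ler_wpM2r ?sqr_ge0//; have := up_le; have := kappa_le1; lra.
Qed.

(** With exact norms and cosines the values at the centers, in units of [r^2], are [phi^2 - 2 phi],
    at most [rho^2 - 2 rho] because [phi >= rho], and [zeta^2 - 2 zeta rho], at least [- rho^2] by
    completing the square. They differ by [2 rho (1 - rho)], which is at least [w / 36]. *)
Lemma landscape_gap (x0 : 'cV[R]_(dims 0)) (L : 'cV[R]_(dims 0) -> R) :
  x0 != 0 -> y ^+ 2 <= l2norm x0 / Num.sqrt 2 ^+ n ->
  (forall x, `|L x - (l2norm (relu_net W n x) ^+ 2
                      - 2 * dotv (relu_net W n x0) (relu_net W n x))| <=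
             32 * y ^+ 4 * (l2norm x / Num.sqrt 2 ^+ n)) ->
  forall phi zeta : R, rho n <= phi <= 1 -> rho n <= zeta <= 1 ->
  forall x z, l2ball (phi *: x0) (delta3 (b / 4) n x0) x ->
    l2ball (- zeta *: x0) (delta3 (b / 4) n x0) z -> L x < L z.
Proof.
move=> x00 yr Lapprox phi zeta /andP[phi0 phi1] /andP[zeta0 zeta1] x z xB zB.
rewrite -/T in yr Lapprox; set r := l2norm x0 / T in yr.
have n0 : (0 < n)%N by exact: ltn_trans n_gt1.
have rho4 : 4^-1 <= rho n :> R by rewrite rho_cos// cos_varrho_ge.
have r_gt0 : 0 < r by rewrite divr_gt0// l2norm_gt0.
(* From [1 - rho n >= 1 / (8 (n + 1)^2)] and [n + 1 <= 3 n / 2]. *)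
have rho_le : rho n <= 1 - w / 18 :> R.
  rewrite rho_cos//; apply: le_trans (cos_varrho_le n) _.
  rewrite lerD2l lerN2 -[n.+1%:R]natr1.
  have n2 := n_ge2.
  have h : (n%:R * (3 / 2)) ^- 2 <= ((n%:R + 1) ^+ 2)^-1 :> R.
    rewrite lef_pV2 ?posrE ?exprn_gt0 ?mulr_gt0//; try lra.
    by rewrite ler_sqr ?nnegrE ?mulr_ge0//; lra.
  have -> : (4 * (n%:R + 1))^-1 ^+ 2 = ((n%:R + 1) ^+ 2)^-1 / 16 :> R by field; lra.
  have -> : w = (n%:R * (3 / 2)) ^- 2 * (9 / 4) by rewrite /w; field; lra.
  lra.
(* [G] is only positively homogeneous, so the second ball is centered at [zeta] times [- x0]. *)
have zB' : l2norm (z - zeta *: (- x0)) <= delta3 (b / 4) n (- x0).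
  by move: zB; rewrite /l2ball /= /delta3 l2normN scalerN scaleNr.
have phi01 : 0 <= phi <= 1 by rewrite phi1 andbT; lra.
have zeta01 : 0 <= zeta <= 1 by rewrite zeta1 andbT; lra.
have [_ x2] := ball_norm_le phi01 xB.
have [_ z2] := ball_norm_le zeta01 zB'.
have xG := G_near phi01 xB; have zG := G_near zeta01 zB'.
rewrite l2normN in z2 zG; rewrite -/r in xG zG.
set g := G x0 in xG; set g' := G (- x0) in zG.
have w0 := w_gt0; have w4 := w_le4; have k0 := kappa_ge0; have k1 := kappa_le1.
have mu01 : 0 <= w * b <= 1.
  rewrite mulr_ge0 ?(ltW b_gt0) ?(ltW w0)//= (@le_trans _ _ (4^-1 * 1))//; last by lra.
  by rewrite ler_pM ?(ltW b_gt0) ?(ltW w0)//; have := b_le; lra.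
have r2 : 0 < r ^+ 2 by rewrite exprn_gt0.
have /andP[g1 g2] : (1 - kappa) * r ^+ 2 <= l2norm g ^+ 2 <= (1 + kappa) * r ^+ 2.
  exact: G_sqr.
have /andP[g'1 g'2] : (1 - kappa) * r ^+ 2 <= l2norm g' ^+ 2 <= (1 + kappa) * r ^+ 2.
  by have := G_sqr (- x0); rewrite l2normN.
have kr : kappa * r ^+ 2 <= r ^+ 2 by rewrite ler_piMl ?ltW//; lra.
have gr : l2norm g <= 2 * r.
  apply: l2norm_le_sqr; first by rewrite mulr_ge0 ?(ltW r_gt0).
  rewrite exprMn; lra.
have gr' : l2norm g' <= 2 * r.
  apply: l2norm_le_sqr; first by rewrite mulr_ge0 ?(ltW r_gt0).
  rewrite exprMn; lra.
have upper := quad_perturb_le phi01 (ltW r_gt0) mu01 gr xG.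
have lower := quad_perturb_ge zeta01 (ltW r_gt0) gr gr' zG.
rewrite !(addrC (_ *: _) (_ - _)) !subrK in upper lower.
have gg' : dotv g g' <= (1 + kappa) * r ^+ 2 * (rho n + 2 * kappa).
  have := relu_net_cos (ltW eps_gt0) x00 eps_le wdc.
  rewrite -/(G x0) -/(G (- x0)) -/g -/g' -rho_cos// ler_norml.
  set c := dotv g g' / _ => /andP[_ c1].
  have c2 : c <= rho n + 2 * kappa by rewrite /kappa; move: c1; rewrite -/eps; lra.
  have ng : 0 < l2norm g.
    rewrite lt_def l2norm_ge0 andbT; apply/eqP => e; move: g1.
    by rewrite e expr0n/= leNgt mulr_gt0//; lra.
  have ng' : 0 < l2norm g'.
    rewrite lt_def l2norm_ge0 andbT; apply/eqP => e; move: g'1.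
    by rewrite e expr0n/= leNgt mulr_gt0//; lra.
  have -> : dotv g g' = l2norm g * l2norm g' * c by rewrite /c; field; rewrite !gt_eqF.
  apply: le_trans (_ : l2norm g * l2norm g' * (rho n + 2 * kappa) <= _).
    by rewrite ler_wpM2l ?mulr_ge0 ?l2norm_ge0.
  rewrite ler_wpM2r//; first by lra.
  have M0 : 0 <= (1 + kappa) * r ^+ 2 by rewrite mulr_ge0 ?addr_ge0// ltW.
  rewrite -ler_sqr ?nnegrE//; last by rewrite mulr_ge0 ?l2norm_ge0.
  by rewrite exprMn [leRHS]expr2 ler_pM ?sqr_ge0.
have y2w : y ^+ 2 <= w * b / 40.
  have y1 := y_le; have y0 := y_gt0.
  have : y * y <= (w * b) * (w * b) by rewrite ler_pM// ltW.
  have : w ^+ 2 * b ^+ 2 <= w / 4 * (b / 10) by apply: ler_pM; rewrite ?sqr_ge0.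
  by rewrite -expr2; lra.
(* The lower bound [y^2 <= r] makes the error quadratic in [r], like the gap. *)
have errT (u : 'cV[R]_(dims 0)) : l2norm u <= 2 * l2norm x0 ->
  32 * y ^+ 4 * (l2norm u / T) <= 64 * y ^+ 2 * r ^+ 2.
  move=> u2; have uT : l2norm u / T <= 2 * r by rewrite /r mulrA ler_wpM2r// invr_ge0 ltW.
  apply: le_trans (_ : 32 * y ^+ 4 * (2 * r) <= _).
    by rewrite ler_wpM2l// mulr_ge0// exprn_ge0// ltW.
  have : y ^+ 2 * r * y ^+ 2 <= y ^+ 2 * r * r.
    by rewrite ler_wpM2l// mulr_ge0 ?sqr_ge0 ?ltW.
  lra.
have yr2 : y ^+ 2 * r ^+ 2 <= w * b / 40 * r ^+ 2 by rewrite ler_wpM2r// ltW.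
have := le_trans (Lapprox x) (errT x x2); rewrite ler_norml => /andP[_ Lx].
have := le_trans (Lapprox z) (errT z z2); rewrite ler_norml => /andP[Lz _].
have kw : kappa * r ^+ 2 <= w * (b / 10) * r ^+ 2.
  rewrite ler_wpM2r ?(ltW r2)//; apply: le_trans kappa_le _.
  by rewrite ler_wpM2l// ltW.
have kr0 : 0 <= kappa * r ^+ 2 by exact: mulr_ge0 k0 (ltW r2).
have kkr0 := mulr_ge0 k0 kr0.
have A1 : (phi ^+ 2 - 2 * phi) * l2norm g ^+ 2 <=
  (rho n ^+ 2 - 2 * rho n + kappa) * r ^+ 2.
  have p0 : 0 <= 2 * phi - phi ^+ 2 by nra.
  have p1 : 2 * phi - phi ^+ 2 <= 1 by have := sqr_ge0 (1 - phi); lra.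
  have := ler_wpM2l p0 g1.
  have : (2 * phi - phi ^+ 2) * (kappa * r ^+ 2) <= 1 * (kappa * r ^+ 2).
    by rewrite ler_wpM2r.
  have : (2 * rho n - rho n ^+ 2) * r ^+ 2 <= (2 * phi - phi ^+ 2) * r ^+ 2.
    by rewrite ler_wpM2r ?(ltW r2)//; nra.
  lra.
have kk : kappa * (kappa * r ^+ 2) <= kappa * r ^+ 2.
  by rewrite ler_piMl//; lra.
have A2 : - rho n ^+ 2 * r ^+ 2 - 11 * (kappa * r ^+ 2) <=
  zeta ^+ 2 * l2norm g' ^+ 2 - 2 * zeta * dotv g g'.
  have z0 : 0 <= zeta by case/andP: zeta01.
  have := ler_wpM2l z0 gg'; have := ler_wpM2l (sqr_ge0 zeta) g'1.
  have : zeta ^+ 2 * (kappa * r ^+ 2) <= 1 * (kappa * r ^+ 2).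
    by rewrite ler_wpM2r ?expr_le1.
  have zz : zeta * (kappa * r ^+ 2) <= 1 * (kappa * r ^+ 2).
    by rewrite ler_wpM2r.
  have : zeta * (kappa * (kappa * r ^+ 2)) <= 1 * (kappa * (kappa * r ^+ 2)).
    by rewrite ler_wpM2r.
  have : rho n * (zeta * (kappa * r ^+ 2)) <= 1 * (zeta * (kappa * r ^+ 2)).
    rewrite ler_wpM2r//; last by lra.
    exact: mulr_ge0.
  have := mulr_ge0 (sqr_ge0 (zeta - rho n)) (ltW r2).
  nra.
have gap : w / 36 * r ^+ 2 <= 2 * (rho n * (1 - rho n)) * r ^+ 2.
  rewrite ler_wpM2r ?(ltW r2)//.
  have : 4^-1 * (w / 18) <= rho n * (1 - rho n) by rewrite ler_pM ?divr_ge0 ?(ltW w0)//; lra.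
  by lra.
(* The perturbations cost 5 and 8, the approximation of [L] at most 3.2 and the [kappa] terms 1.2,
   in units of [b w r^2]. With [1000 b <= 1] their sum stays below [w r^2 / 36]. *)
have wr : 0 < w * r ^+ 2 by rewrite mulr_gt0.
have wb : 1000 * b * (w * r ^+ 2) <= 1 * (w * r ^+ 2) by rewrite ler_wpM2r// ltW.
lra.
Qed.

End Landscape.

(** * Expectation of a product of independent factors *)

Section IndependentProducts.
Context {R : realType} d (T : measurableType d) (P : probability T R).
Context d' (T' : measurableType d').
Local Open Scope ereal_scope.

Import HBNNSimple.

(** A factorization known for the events [Z in B] is lifted to simple functions of [Z], and then by
    monotone convergence to nonnegative ones. [H] will be the product of all other factors. *)
Let nnsfun_mul_comp (Z : T -> T') (H : T -> R) (c : R) (f : {nnsfun T' >-> R}) :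
  measurable_fun setT Z -> measurable_fun setT H -> (forall w, 0 <= H w)%R ->
  (0 <= c)%R ->
  (forall B, measurable B -> \int[P]_w (\1_B (Z w) * H w)%:E = c%:E * P (Z @^-1` B)) ->
  \int[P]_w (f (Z w) * H w)%:E = c%:E * \int[P]_w (f (Z w))%:E.
Proof.
move=> mZ mH H0 c0 ZH.
have mI r : measurable_fun setT (fun w => \1_(f @^-1` [set r]) (Z w) : R).
  by apply: measurableT_comp mZ => //; exact: measurable_indic.
have fr0 r x : (0 <= r * \1_(f @^-1` [set r]) x)%R.
  by have := nnfun_muleindic_ge0 f r x; rewrite -EFinM lee_fin.
under eq_integral do rewrite fimfunE mulr_fsuml// -fsumEFin//.
under [in RHS]eq_integral do rewrite fimfunE -fsumEFin//.
rewrite ge0_integral_fsum//; last 2 first.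
- move=> r; apply/measurable_EFinP; apply: measurable_funM => //.
  by apply: measurable_funM.
- by move=> r w _; rewrite lee_fin mulr_ge0.
rewrite ge0_integral_fsum//; last 2 first.
- by move=> r; apply/measurable_EFinP; apply: measurable_funM.
- by move=> r w _; rewrite lee_fin.
rewrite ge0_mule_fsumr; last by move=> r; apply: integral_ge0 => w _; rewrite lee_fin.
apply: eq_fsbigr => r /set_mem[x _ fxr].
have r0 : (0 <= r)%R by rewrite -fxr.
under eq_integral do rewrite -mulrA EFinM.
rewrite ge0_integralZl//; last 2 first.
- by apply/measurable_EFinP; apply: measurable_funM.
- by move=> w _; rewrite lee_fin mulr_ge0.
rewrite ZH//.
under [in RHS]eq_integral do rewrite EFinM.
rewrite ge0_integralZl//; last by apply/measurable_EFinP.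
rewrite muleCA; congr (_ * (_ * _)).
have mZr : measurable (Z @^-1` (f @^-1` [set r])).
  by rewrite -[X in measurable X]setTI; apply: mZ.
by rewrite -[RHS]/(\int[P]_w (\1_(Z @^-1` (f @^-1` [set r])) w)%:E) integral_indic// setIT.
Qed.

Lemma ge0_integral_mul_comp (Z : T -> T') (H : T -> R) (c : R) (g : T' -> R) :
  measurable_fun setT Z -> measurable_fun setT H -> (forall w, 0 <= H w)%R ->
  (0 <= c)%R ->
  (forall B, measurable B -> \int[P]_w (\1_B (Z w) * H w)%:E = c%:E * P (Z @^-1` B)) ->
  measurable_fun setT g -> (forall x, 0 <= g x)%R ->
  \int[P]_w (g (Z w) * H w)%:E = c%:E * \int[P]_w (g (Z w))%:E.
Proof.
move=> mZ mH H0 c0 ZH mg g0.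
have mg' : measurable_fun setT (EFin \o g) by apply/measurable_EFinP.
pose f_ := nnsfun_approx measurableT mg'.
have f_cvg x : (f_ n x)%:E @[n --> \oo] --> (g x)%:E.
  by apply: (cvg_nnsfun_approx measurableT mg') => // y _; rewrite lee_fin.
have f_nd x : {homo (fun n => f_ n x) : a b / (a <= b)%N >-> (a <= b)%R}.
  by move=> a b ab; exact/lefP/nd_nnsfun_approx.
have mfZ n : measurable_fun setT (fun w => f_ n (Z w)) by apply: measurableT_comp.
transitivity (lim (\int[P]_w (f_ n (Z w) * H w)%:E @[n --> \oo])).
  rewrite -monotone_convergence//=.
  - apply: eq_integral => w _; apply/esym/cvg_lim => //.
    rewrite EFinM; under eq_fun do rewrite EFinM.
    by apply: cvgeZr => //; exact: f_cvg.
  - by move=> n; apply/measurable_EFinP; exact: measurable_funM.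
  - by move=> n w _; rewrite lee_fin mulr_ge0.
  - by move=> w _ a b ab; rewrite lee_fin ler_wpM2r// f_nd.
transitivity (c%:E * lim (\int[P]_w (f_ n (Z w))%:E @[n --> \oo])); last first.
  congr (_ * _); rewrite -monotone_convergence//=.
  - by apply: eq_integral => w _; apply/cvg_lim => //; exact: f_cvg.
  - by move=> n; apply/measurable_EFinP.
  - by move=> n w _; rewrite lee_fin.
  - by move=> w _ a b ab; rewrite lee_fin f_nd.
rewrite -limeMl//.
  by apply: congr_lim; apply/funext => n /=; exact: nnsfun_mul_comp.
apply/ereal_nondecreasing_is_cvgn => x y xy; apply: ge0_le_integral => //=.
- by move=> w _; rewrite lee_fin.
- exact/measurable_EFinP.
- exact/measurable_EFinP.
- by move=> w _; rewrite lee_fin f_nd.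
Qed.

(* The indices of [A] carry an arbitrary factor, the others an indicator, so
   that the product rule on events is the case [A = set0]. *)
Let integral_prod_mixed m (Z : 'I_m -> T -> T') (g : 'I_m -> T' -> R) (e : 'I_m -> R) :
  mutually_independent P Z -> (forall i, measurable_fun setT (Z i)) ->
  (forall i, measurable_fun setT (g i)) -> (forall i x, 0 <= g i x)%R ->
  (forall i, \int[P]_w (g i (Z i w))%:E = (e i)%:E) ->
  forall (s : seq 'I_m) (B : 'I_m -> set T'), uniq s -> (forall i, measurable (B i)) ->
  \int[P]_w (\prod_i (if i \in s then g i (Z i w) else \1_(B i) (Z i w)))%R%:E
  = (\prod_i (if i \in s then e i else fine (P (Z i @^-1` B i))))%R%:E.
Proof.
move=> indep mZ mg g0 ge; elim=> [|i0 s IH] B us mB.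
  have mZB i : measurable (Z i @^-1` B i).
    by rewrite -[X in measurable X]setTI; apply: mZ.
  pose A := \bigcap_(i in [set i | i \in [set: 'I_m]%SET]) Z i @^-1` B i.
  have mA : measurable A by apply: fin_bigcap_measurable.
  transitivity (P A).
    rewrite -(setIT A) -integral_indic//; apply: eq_integral => w _.
    congr EFin; rewrite (eq_bigr (fun i => \1_(B i) (Z i w)))//.
    rewrite indicE; have [wA|wA] := boolP (w \in A).
      rewrite big1// => i _; rewrite indicE mem_set//.
      by move/set_mem: wA; apply => /=; rewrite inE.
    have [i wi] : exists i, ~ (Z i @^-1` B i) w.
      by apply/existsNP => h; move/negP: wA; apply; apply/mem_set => i _; exact: h.
    by apply/eqP/prodf_eq0; exists i => //; rewrite indicE memNset.
  rewrite /A indep// -prodEFin.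
  apply: eq_big => [i|i _]; first by rewrite inE.
  by rewrite fineK ?fin_num_measure.
move: us => /= /andP[i0s us].
pose H w := (\prod_(i | i != i0) (if i \in s then g i (Z i w) else \1_(B i) (Z i w)))%R.
pose c := (\prod_(i | i != i0) (if i \in s then e i else fine (P (Z i @^-1` B i))))%R.
have e0 i : (0 <= e i)%R.
  by rewrite -lee_fin -ge; apply: integral_ge0 => w _; rewrite lee_fin.
have mH : measurable_fun setT H.
  rewrite (_ : H = fun w => \prod_i (if i != i0 then
      if i \in s then g i (Z i w) else \1_(B i) (Z i w) else 1))%R; last first.
    by apply/funext => w; rewrite /H big_mkcond.
  apply: measurable_prod => i _; case: (i != i0) => //; case: (i \in s); first exact: measurableT_comp.
  by apply: measurableT_comp (mZ i); exact: measurable_indic.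
have H0 w : (0 <= H w)%R.
  by apply: prodr_ge0 => i _; case: ifP.
have c0 : (0 <= c)%R.
  by apply: prodr_ge0 => i _; case: ifP => // _; rewrite fine_ge0.
have neq0 i : i != i0 -> (i \in i0 :: s) = (i \in s).
  by move=> ii0; rewrite inE (negbTE ii0).
under eq_integral.
  move=> w _; rewrite (bigD1 i0)//= mem_head.
  rewrite (eq_bigr (fun i => if i \in s then g i (Z i w) else \1_(B i) (Z i w))); last first.
    by move=> i /neq0 ->.
  rewrite -/(H w); over.
rewrite (@ge0_integral_mul_comp _ _ c)//; last first.
  (* The induction hypothesis holds for every family of sets; putting an arbitrary [B'] at index
     [i0] yields exactly the factorization required of [H]. *)
  move=> B' mB'; pose B2 i := if i == i0 then B' else B i.
  have B20 : B2 i0 = B' by rewrite /B2 eqxx.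
  have mB2 i : measurable (B2 i) by rewrite /B2; case: ifP.
  have := IH B2 us mB2.
  rewrite (bigD1 i0)//= (negbTE i0s) B20.
  rewrite (eq_bigr (fun i => if i \in s then e i else fine (P (Z i @^-1` B i)))); last first.
    by move=> i ii0; rewrite /B2 (negbTE ii0).
  rewrite -/c EFinM fineK; last by rewrite fin_num_measure// -[X in measurable X]setTI; exact: mZ.
  rewrite muleC => <-; apply: eq_integral => w _; congr EFin.
  rewrite (bigD1 i0)//= (negbTE i0s) B20; congr (_ * _)%R.
  by apply: eq_bigr => i ii0; rewrite /B2 (negbTE ii0).
rewrite ge -EFinM (bigD1 i0)//= mem_head mulrC; congr (_ * _)%:E.
by apply: eq_bigr => i /neq0 ->.
Qed.

Lemma expectation_prod_indep m (Z : 'I_m -> T -> T') (g : 'I_m -> T' -> R) (e : 'I_m -> R) :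
  mutually_independent P Z -> (forall i, measurable_fun setT (Z i)) ->
  (forall i, measurable_fun setT (g i)) -> (forall i x, 0 <= g i x)%R ->
  (forall i, \int[P]_w (g i (Z i w))%:E = (e i)%:E) ->
  \int[P]_w (\prod_i g i (Z i w))%R%:E = (\prod_i e i)%R%:E.
Proof.
move=> indep mZ mg g0 ge.
have := integral_prod_mixed indep mZ mg g0 ge (enum_uniq 'I_m) (fun i => measurableT).
under eq_integral do under eq_bigr do rewrite mem_enum.
by under eq_bigr do rewrite mem_enum.
Qed.

End IndependentProducts.

(** * Elementary exponential inequalities *)

Section ExponentialBounds.
Context {R : realType}.
Implicit Types (x z lam L : R).

Lemma expR_le_quadratic x : expR x <= 1 + x + x ^+ 2 * expR `|x|.
Proof.
have [x0|x0] := leP 0 x.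
  rewrite ger0_norm//; have e0 := expR_gt0 x.
  have h1 : expR x * (1 - x) <= 1.
    by have := expR_ge1Dx (- x); rewrite expRN -(ler_pM2l e0) mulfV ?gt_eqF.
  have h2 : expR x - 1 <= x * expR x by lra.
  have := ler_wpM2l x0 h2; lra.
rewrite ltr0_norm//; have y0 : 0 < - x by rewrite oppr_gt0.
have e1 : 1 <= expR (- x) by rewrite -expR0 ler_expR ltW.
have h : expR x <= 1 + x + x ^+ 2.
  have h1 := expR_ge1Dx (- x).
  rewrite -[x in expR x]opprK expRN.
  apply: (@le_trans _ _ (1 - x)^-1); first by rewrite lef_pV2 ?posrE//; lra.
  rewrite -div1r ler_pdivrMr; last by lra.
  have := mulr_ge0 (sqr_ge0 x) (ltW y0); lra.
apply: le_trans h _; rewrite lerD2l ler_peMr ?sqr_ge0//.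
Qed.

Lemma expR1_le4 : expR 1 <= 4 :> R.
Proof.
have h : 2^-1 <= expR (- 2^-1) :> R by have := @expR_ge1Dx R (- 2^-1); lra.
have : expR (2^-1) <= 2 :> R.
  by rewrite -[2^-1 in leLHS]opprK expRN -[leRHS]invrK lef_pV2 ?posrE ?expR_gt0.
have -> : expR 1 = expR 2^-1 * expR 2^-1 :> R by rewrite -expRD; congr expR; field.
have := @expR_gt0 R 2^-1; nra.
Qed.

Lemma sqr_le_expR x : 0 <= x -> x ^+ 2 <= 2 * expR x.
Proof.
move=> x0; have h : 1 + x ^+ 2 / 2 <= expR x := expR_ge1Dxn 1 x0.
lra.
Qed.

(** Below [z = 4 lam L] the exponential is at most 4. Above it, [z^2] is at most
    [32 lam^2 expR (z / (4 lam))], and [lam^2 <= expR (2 L) <= expR (z / (2 lam))] absorbs the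
    factor [lam^2]. Stretching the exponential scale by [L] is thus the price for keeping the
    variance of order 1 instead of [lam^2]. *)
Lemma sqr_expR_le lam L z : 1 <= lam -> 1 <= L -> lam <= expR L -> 0 <= z ->
  z ^+ 2 * expR (z / (4 * lam * L)) <= 4 * z ^+ 2 + 32 * expR (z / lam).
Proof.
move=> lam1 L1 lamL z0.
have lam0 : 0 < lam by lra.
have L0 : 0 < L by lra.
have lamL0 : 0 < 4 * lam * L by rewrite !mulr_gt0.
have [h|h] := leP (z / (4 * lam * L)) 1.
  have : expR (z / (4 * lam * L)) <= 4 by apply: le_trans expR1_le4; rewrite ler_expR.
  have := expR_gt0 (z / lam); have := sqr_ge0 z => z2 e0 e4.
  by have := ler_wpM2l z2 e4; lra.
have zL : 2 * L <= z / (2 * lam).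
  have {}h := ltW h; rewrite ler_pdivlMr ?mulr_gt0//.
  by move: h; rewrite ler_pdivlMr// mul1r; lra.
have z4 : 0 <= z / (4 * lam) by rewrite divr_ge0// mulr_ge0 ?ltW.
have z2 : z ^+ 2 <= 32 * lam ^+ 2 * expR (z / (4 * lam)).
  have := sqr_le_expR z4; rewrite expr_div_n ler_pdivrMr ?exprn_gt0 ?mulr_gt0//.
  by rewrite exprMn; lra.
have lam2 : lam ^+ 2 <= expR (z / (2 * lam)).
  apply: (@le_trans _ _ (expR L ^+ 2)).
    by rewrite ler_sqr ?nnegrE ?expR_ge0// ltW.
  by rewrite -expRM_natl ler_expR mulrC; lra.
have eL : expR (z / (4 * lam * L)) <= expR (z / (4 * lam)).
  by rewrite ler_expR ler_wpM2l// lef_pV2 ?posrE ?mulr_gt0// ler_peMr// mulr_ge0 ?ltW.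
have -> : z / lam = z / (2 * lam) + z / (4 * lam) + z / (4 * lam) by field; rewrite gt_eqF.
rewrite !expRD; set A := expR (z / (2 * lam)) in lam2 *.
set B := expR (z / (4 * lam)) in z2 eL *.
have B0 : 0 <= B := expR_ge0 _.
have A0 : 0 <= A := expR_ge0 _.
have h1 : z ^+ 2 * expR (z / (4 * lam * L)) <= (32 * lam ^+ 2 * B) * B.
  by rewrite ler_pM ?sqr_ge0 ?expR_ge0.
have h2 : (32 * lam ^+ 2 * B) * B <= 32 * (A * B * B).
  have := ler_wpM2r (mulr_ge0 B0 B0) lam2; lra.
by have := sqr_ge0 z; lra.
Qed.

End ExponentialBounds.

(** * Bernstein's inequality with a logarithmic loss *)

Section Bernstein.
Context {R : realType} d (T : measurableType d) (P : probability T R).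
Context d' (T' : measurableType d').
Local Open Scope ereal_scope.

Lemma measurable_preimage (Z : T -> T') (B : set T') :
  measurable_fun setT Z -> measurable B -> measurable (Z @^-1` B).
Proof. by move=> mZ mB; rewrite -[X in measurable X]setTI; exact: mZ. Qed.

Lemma same_law_integral (X Y : T -> T') (g : T' -> R) :
  measurable_fun setT X -> measurable_fun setT Y -> same_law P X Y ->
  measurable_fun setT g -> (forall x, 0 <= g x)%R ->
  \int[P]_w (g (X w))%:E = \int[P]_w (g (Y w))%:E.
Proof.
move=> mX mY XY mg g0.
have mg' : measurable_fun setT (EFin \o g) by apply/measurable_EFinP.
have push (U : T -> T') (mU : measurable_fun setT U) :
    \int[P]_w (g (U w))%:E = \int[pushforward P U]_x (g x)%:E.
  by rewrite ge0_integral_pushforward//= => x _; rewrite lee_fin.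
rewrite !push//; apply: eq_measure_integral => B mB _.
exact: XY.
Qed.

Variables (m : nat) (Z : 'I_m -> T -> T') (Z0 : T -> T').
Hypothesis mZ : forall i, measurable_fun setT (Z i).
Hypothesis mZ0 : measurable_fun setT Z0.
Hypothesis indepZ : mutually_independent P Z.
Hypothesis lawZ : forall i, same_law P (Z i) Z0.

Variables (lam L : R) (f h : T' -> R).
Hypothesis lam_ge1 : (1 <= lam)%R.
Hypothesis L_ge1 : (1 <= L)%R.
Hypothesis lam_le : (lam <= expR L)%R.
Hypothesis mf : measurable_fun setT f.
Hypothesis mh : measurable_fun setT h.
Hypothesis f_le : forall x, (`|f x| <= lam * `|h x|)%R.
Hypothesis h_sqr : \int[P]_w (h (Z0 w) ^+ 2)%:E <= 1.
Hypothesis h_exp : \int[P]_w (expR (`|h (Z0 w)| / lam))%:E <= 2%:E.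

Let lam_gt0 : (0 < lam)%R. Proof. exact: lt_le_trans lam_ge1. Qed.
Let L_gt0 : (0 < L)%R. Proof. exact: lt_le_trans L_ge1. Qed.

Let mhZ : measurable_fun setT (fun w => h (Z0 w)). Proof. exact: measurableT_comp. Qed.
Let mfZ : measurable_fun setT (fun w => f (Z0 w)). Proof. exact: measurableT_comp. Qed.

Let mhexp : measurable_fun setT (fun w => expR (`|h (Z0 w)| / lam)).
Proof.
apply: measurableT_comp => //; apply: measurable_funM => //.
exact: measurableT_comp.
Qed.

Let int_h2 : P.-integrable setT (EFin \o (fun w => h (Z0 w) ^+ 2)%R).
Proof.
apply/integrableP; split; first by apply/measurable_EFinP; exact: measurable_funX.
rewrite (eq_integral (fun w => (h (Z0 w) ^+ 2)%:E)); last first.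
  by move=> w _ /=; rewrite ger0_norm ?sqr_ge0.
exact: le_lt_trans h_sqr (ltry _).
Qed.

Let int_hexp : P.-integrable setT (EFin \o (fun w => expR (`|h (Z0 w)| / lam))).
Proof.
apply/integrableP; split; first exact/measurable_EFinP.
rewrite (eq_integral (fun w => (expR (`|h (Z0 w)| / lam))%:E)); last first.
  by move=> w _ /=; rewrite ger0_norm ?expR_ge0.
exact: le_lt_trans h_exp (ltry _).
Qed.

Lemma bernstein_integrable : P.-integrable setT (EFin \o (fun w => f (Z0 w))).
Proof.
apply: (@le_integrable _ _ _ P setT _ _
  (fun w => lam%:E * ((1 + h (Z0 w) ^+ 2)%:E))) => //.
- exact/measurable_EFinP.
- move=> w _ /=; rewrite lee_fin (le_trans (f_le _))// [leRHS]ger0_norm.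
    rewrite ler_wpM2l// ?ltW//; have := normr_ge0 (h (Z0 w)).
    rewrite -[(h _ ^+ 2)%R]real_normK ?num_real//.
    by have := sqr_ge0 (`|h (Z0 w)| - 2^-1)%R; lra.
  by rewrite mulr_ge0 ?addr_ge0 ?sqr_ge0// ltW.
- apply: integrableZl => //; under eq_fun do rewrite EFinD.
  apply: integrableD => //.
  exact: finite_measure_integrable_cst.
Qed.

Let mean : R := fine (\int[P]_w (f (Z0 w))%:E).

Let meanE : \int[P]_w (f (Z0 w))%:E = mean%:E.
Proof. by rewrite fineK// integrable_fin_num//; exact: bernstein_integrable. Qed.

(** The constant is [68 = 4 * 1 + 32 * 2]: the two terms of [sqr_expR_le] integrated against the
    second moment and the exponential moment of [h]. *)
Lemma bernstein_mgf (t : R) : (0 <= t)%R -> (t * lam * (4 * lam * L) <= 1)%R ->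
  \int[P]_w (expR (t * f (Z0 w)))%:E <=
  (expR (t * mean + 68 * (t * lam) ^+ 2))%:E.
Proof.
move=> t0 tl.
pose q w : R := (1 + t * f (Z0 w) + (t * lam) ^+ 2 *
   (4 * h (Z0 w) ^+ 2 + 32 * expR (`|h (Z0 w)| / lam)))%R.
have le_q w : (expR (t * f (Z0 w)) <= q w)%R.
  apply: le_trans (expR_le_quadratic _) _; rewrite lerD2l.
  have tf : (`|t * f (Z0 w)| <= `|h (Z0 w)| * (t * lam))%R.
    have -> : (`|h (Z0 w)| * (t * lam) = t * (lam * `|h (Z0 w)|))%R by ring.
    by rewrite normrM (ger0_norm t0) ler_wpM2l.
  have h1 : ((t * f (Z0 w)) ^+ 2 <= (t * lam) ^+ 2 * `|h (Z0 w)| ^+ 2)%R.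
    rewrite -exprMn -[leLHS]real_normK ?num_real// ler_sqr ?nnegrE//.
      by rewrite [leRHS]mulrC.
    by rewrite !mulr_ge0// ltW.
  have h2 : (expR `|t * f (Z0 w)| <= expR (`|h (Z0 w)| / (4 * lam * L)))%R.
    rewrite ler_expR; apply: le_trans tf _; rewrite ler_wpM2l//.
    by rewrite -div1r ler_pdivlMr ?mulr_gt0 ?lam_gt0 ?L_gt0.
  apply: (@le_trans _ _ ((t * lam) ^+ 2 * `|h (Z0 w)| ^+ 2 *
      expR (`|h (Z0 w)| / (4 * lam * L))))%R.
    by rewrite ler_pM ?sqr_ge0 ?expR_ge0.
  rewrite -mulrA ler_wpM2l ?sqr_ge0//.
  by rewrite -[in leRHS](real_normK (num_real (h _))); exact: sqr_expR_le.
have int_q : \int[P]_w (q w)%:E = (1 + t * mean)%:E + ((t * lam) ^+ 2)%:E *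
   (4%:E * \int[P]_w (h (Z0 w) ^+ 2)%:E +
    32%:E * \int[P]_w (expR (`|h (Z0 w)| / lam))%:E).
  have i1 : P.-integrable setT (EFin \o (fun=> 1%R : R)).
    exact: finite_measure_integrable_cst.
  have i2 : P.-integrable setT (fun w => t%:E * (f (Z0 w))%:E).
    by apply: integrableZl => //; exact: bernstein_integrable.
  have i3 : P.-integrable setT (fun w => 4%:E * (h (Z0 w) ^+ 2)%:E).
    by apply: integrableZl.
  have i4 : P.-integrable setT (fun w => 32%:E * (expR (`|h (Z0 w)| / lam))%:E).
    by apply: integrableZl.
  rewrite (_ : (fun w => (q w)%:E) = (fun w => (1%:E + t%:E * (f (Z0 w))%:E) +
    ((t * lam) ^+ 2)%:E * (4%:E * (h (Z0 w) ^+ 2)%:E +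
       32%:E * (expR (`|h (Z0 w)| / lam))%:E)))//.
  rewrite integralD//; [|exact: integrableD|by apply: integrableZl => //; exact: integrableD].
  rewrite integralD// integral_cst//= probability_setT mule1.
  rewrite integralZl//; last exact: bernstein_integrable.
  rewrite meanE integralZl//; last exact: integrableD.
  by rewrite integralD// !integralZl.
have mq : measurable_fun setT (fun w => expR (t * f (Z0 w))).
  by apply: measurableT_comp => //; exact: measurable_funM.
apply: (@le_trans _ _ (\int[P]_w (q w)%:E)).
  apply: ge0_le_integral => //.
  - exact/measurable_EFinP.
  - apply/measurable_EFinP; apply: measurable_funD.
      by apply: measurable_funD => //; exact: measurable_funM.
    apply: measurable_funM => //; apply: measurable_funD.
      by apply: measurable_funM => //; exact: measurable_funX.
    exact: measurable_funM.
  - by move=> w _; rewrite lee_fin.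
rewrite int_q; apply: (@le_trans _ _ ((1 + t * mean + (t * lam) ^+ 2 * 68)%:E)).
  rewrite [leRHS]EFinD; apply: leeD => //; rewrite [leRHS]EFinM.
  apply: lee_wpmul2l; first by rewrite lee_fin sqr_ge0.
  have -> : 68%:E = 4%:E * 1 + 32%:E * 2%:E :> \bar R.
    by rewrite mule1 -EFinM -EFinD; congr EFin; ring.
  by apply: leeD; apply: lee_wpmul2l.
rewrite lee_fin; apply: le_trans (expR_ge1Dx _); lra.
Qed.

(** Chernoff with [t = e / (136 lam^2 L)]. As [e <= 1], this [t] is admissible for the moment bound,
    and as [L >= 1] the quadratic term is at most [t e / 2]. Half of the linear gain remains, whence
    272. *)
Lemma bernstein (e : R) : (0 < e <= 1)%R ->
  P [set w | m%:R * (mean + e) <= \sum_i f (Z i w)]%R <=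
  (expR (- (m%:R * e ^+ 2 / (272 * lam ^+ 2 * L))))%:E.
Proof.
move=> /andP[e0 e1].
pose D : R := (136 * lam ^+ 2 * L)%R.
have D0 : (0 < D)%R by rewrite !mulr_gt0// exprn_gt0.
pose t : R := (e / D)%R.
have t0 : (0 < t)%R by rewrite divr_gt0.
have tl : (t * lam * (4 * lam * L) <= 1)%R.
  have -> : (t * lam * (4 * lam * L) = e / 34)%R by rewrite /t /D; field; rewrite !gt_eqF.
  lra.
have int_mgf := bernstein_mgf (ltW t0) tl.
set M := (\int[P]_w _) in int_mgf.
have M0 : 0 <= M by apply: integral_ge0 => w _; rewrite lee_fin expR_ge0.
have Mfin : M \is a fin_num by rewrite ge0_fin_numE// (le_lt_trans int_mgf)// ltry.
have mgfE : \int[P]_w (\prod_i expR (t * f (Z i w)))%R%:E = (\prod_(i < m) fine M)%R%:E.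
  have mg : measurable_fun setT (fun x => expR (t * f x)).
    by apply: measurableT_comp => //; exact: measurable_funM.
  apply: (expectation_prod_indep (g := fun _ x => expR (t * f x)) indepZ) => //.
  move=> i; rewrite fineK// /M.
  by rewrite (same_law_integral (mZ i) mZ0 (lawZ i) mg)// => x; exact: expR_ge0.
have mS : measurable_fun setT (fun w => \sum_i f (Z i w))%R.
  by apply: measurable_sum => i; exact: measurableT_comp.
pose S : {RV P >-> R} := HB.pack (fun w => \sum_i f (Z i w))%R
   (isMeasurableFun.Build _ _ _ _ _ mS).
apply: le_trans (chernoff S (m%:R * (mean + e)) t0) _.
rewrite /mmt_gen_fun unlock.
rewrite (eq_integral (fun w => (\prod_i expR (t * f (Z i w)))%R%:E)); last first.
  by move=> w _ /=; rewrite mulrC mulr_sumr expR_sum.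
rewrite mgfE prodr_const card_ord -EFinM lee_fin.
have {}int_mgf : (fine M <= expR (t * mean + 68 * (t * lam) ^+ 2))%R.
  by rewrite -lee_fin fineK.
apply: (@le_trans _ _ (expR (m%:R * (t * mean + 68 * (t * lam) ^+ 2)) *
   expR (- (t * (m%:R * (mean + e))))))%R.
  rewrite ler_wpM2r ?expR_ge0// expRM_natl lerXn2r ?nnegrE ?expR_ge0//.
  exact: fine_ge0.
rewrite -expRD ler_expR.
have -> : (m%:R * e ^+ 2 / (272 * lam ^+ 2 * L) = m%:R * (t * e / 2))%R.
  by rewrite /t /D; field; rewrite !gt_eqF.
have h1 : (68 * (t * lam) ^+ 2 <= t * e / 2)%R.
  have -> : (68 * (t * lam) ^+ 2 = t * e / 2 * L^-1)%R.
    by rewrite /t /D; field; rewrite !gt_eqF.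
  have te0 : (0 <= t * e / 2)%R by rewrite divr_ge0// mulr_ge0// ltW.
  by apply: ler_piMr => //; rewrite invf_le1.
have := ler_wpM2l (ler0n R m) h1; lra.
Qed.

End Bernstein.

(** * Exponential moments from the psi_1 norm *)

Section SubExponential.
Context {R : realType} d (T : measurableType d) (P : probability T R).
Local Open Scope ereal_scope.

Lemma psi1_moment (X : T -> R) (K : R) (p : nat) : (0 <= K)%R ->
  psi1 P X <= K%:E -> \int[P]_w (`|X w| ^+ p.+1)%:E <= ((p.+1%:R * K) ^+ p.+1)%:E.
Proof.
move=> K0 XK; set q : R := p.+1%:R.
have q1 : (1 <= q)%R by rewrite ler1n.
have q0 : (0 < q)%R by exact: lt_le_trans q1.
have : (q^-1)%:E * 'N[P]_(q%:E)[EFin \o X] <= K%:E.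
  by apply: le_trans XK; apply: ereal_sup_ubound; exists q.
rewrite lee_pdivrMl// -EFinM => Nq.
have := poweR_Lnorm P (EFin \o X) (lt0r_neq0 q0).
rewrite (eq_integral (fun w => (`|X w| ^+ p.+1)%:E)) => [<-|w _]; last first.
  by rewrite /= powR_mulrn.
have qK0 : (0 <= q * K)%R by rewrite mulr_ge0// ltW.
rewrite -(powR_mulrn _ qK0) -poweR_EFin; apply: gt0_ler_poweR => //.
- by rewrite in_itv/= Lnorm_ge0 leey.
- by rewrite in_itv/= lee_fin qK0 leey.
Qed.

Lemma pow_self_le_fact (p : nat) : (p%:R ^+ p <= 4 ^+ p * p`!%:R :> R)%R.
Proof.
case: p => [|p]; first by rewrite !expr0 fact0 mulr1.
have : (1 + p.+1%:R ^+ p.+1 / p.+1`!%:R <= expR p.+1%:R :> R)%R by exact: expR_ge1Dxn.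
have -> : (expR p.+1%:R = expR 1 ^+ p.+1 :> R)%R by rewrite -expRM_natl mulr1.
have e4 : (expR 1 ^+ p.+1 <= 4 ^+ p.+1 :> R)%R.
  by rewrite lerXn2r ?nnegrE ?expR_ge0// expR1_le4.
move=> h; rewrite -ler_pdivrMr ?ltr0n ?fact_gt0//; lra.
Qed.

Lemma expR_nneseries (x : R) : (0 <= x)%R ->
  (expR x)%:E = \sum_(0 <= n <oo) (x ^+ n / n`!%:R)%:E.
Proof.
move=> x0; rewrite expRE -EFin_lim; last first.
  rewrite /pseries/=; under eq_fun do rewrite mulrC.
  exact: is_cvg_series_exp_coeff.
apply/congr_lim/funext => n/=; rewrite /pseries/= /series/= -sumEFin//.
by apply: eq_bigr => i _; rewrite mulrC.
Qed.

(** By [n^n <= 4^n n!] the n-th term of the exponential series has expectation at most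
    [(4 K / c)^n <= 2^-n], and the geometric series sums to 2. *)
Lemma psi1_exp (X : T -> R) (K c : R) : measurable_fun setT X -> (0 < K)%R ->
  (8 * K <= c)%R -> psi1 P X <= K%:E -> \int[P]_w (expR (`|X w| / c))%:E <= 2%:E.
Proof.
move=> mX K0 Kc XK.
have c0 : (0 < c)%R by apply: lt_le_trans Kc; rewrite mulr_gt0.
have Xc0 w : (0 <= `|X w| / c)%R by rewrite divr_ge0// ltW.
under eq_integral do rewrite expR_nneseries//.
have mterm n : measurable_fun setT (fun w => (`|X w| / c) ^+ n / n`!%:R)%R.
  apply: measurable_funM => //; apply: measurable_funX; apply: measurable_funM => //.
  exact: measurableT_comp.
rewrite integral_nneseries//; last 2 first.
- by move=> n; apply/measurable_EFinP.
- by move=> n w _; rewrite lee_fin divr_ge0// exprn_ge0.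
have -> : 2%:E = \sum_(0 <= k <oo) (2 / (2 ^ (k + 1))%:R)%:E :> \bar R.
  have /cvg_lim := @cvg_geometric_eseries_half R 2 0.
  by rewrite expr0 divr1 => <-.
apply: lee_nneseries => [n _ _|n _].
  by apply: integral_ge0 => w _; rewrite lee_fin divr_ge0// exprn_ge0.
have -> : (2 / (2 ^ (n + 1))%:R = 2^-1 ^+ n :> R)%R.
  by rewrite addn1 expnS natrM natrX invfM mulrA mulfV// mul1r exprVn.
case: n => [|p].
  under eq_integral do rewrite expr0 fact0 divr1.
  by rewrite integral_cst//= probability_setT mule1 expr0.
set n := p.+1.
have cn0 : (0 <= (c ^+ n * n`!%:R)^-1)%R by rewrite invr_ge0 mulr_ge0// exprn_ge0// ltW.
under eq_integral do rewrite expr_div_n -mulrA -invfM mulrC EFinM.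
rewrite ge0_integralZl//; last first.
  by apply/measurable_EFinP; apply: measurable_funX; exact: measurableT_comp.
apply: le_trans (lee_wpmul2l _ (psi1_moment p (ltW K0) XK)) _; first by rewrite lee_fin.
rewrite -EFinM lee_fin mulrC ler_pdivrMr ?mulr_gt0 ?exprn_gt0 ?ltr0n ?fact_gt0//.
apply: (@le_trans _ _ ((4 ^+ n * n`!%:R) * K ^+ n))%R.
  by rewrite exprMn ler_wpM2r ?exprn_ge0 ?(ltW K0)// pow_self_le_fact.
have -> : ((4 ^+ n * n`!%:R) * K ^+ n = 2^-1 ^+ n * ((8 * K) ^+ n * n`!%:R))%R.
  by rewrite mulrA -exprMn mulrAC -exprMn; congr (_ ^+ _ * _)%R; field.
rewrite ler_wpM2l ?exprn_ge0// ler_wpM2r// lerXn2r ?nnegrE ?mulr_ge0 ?(ltW K0) ?(ltW c0)//.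
Qed.

End SubExponential.

(** * Independence of a pair from a third variable *)

Section ProductLaws.
Context {R : realType}.
Local Open Scope ereal_scope.

Lemma measure_eq_rectangles d1 d2 (T1 : measurableType d1) (T2 : measurableType d2)
    (m1 m2 : {measure set (T1 * T2) -> \bar R}) :
  m1 setT < +oo ->
  (forall A B, measurable A -> measurable B -> m1 (A `*` B) = m2 (A `*` B)) ->
  forall X, measurable X -> m1 X = m2 X.
Proof.
move=> m1oo m12.
pose C : set (set (T1 * T2)) :=
  [set C | exists A, measurable A /\ exists B, measurable B /\ C = A `*` B].
have CI : setI_closed C.
  move=> /= _ _ [X1 [mX1 [X2 [mX2 ->]]]] [Y1 [mY1 [Y2 [mY2 ->]]]].
  rewrite -setXI; exists (X1 `&` Y1); split; first exact: measurableI.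
  by exists (X2 `&` Y2); split => //; exact: measurableI.
move=> X mX; apply: (measure_unique C (fun=> setT)) => //.
- rewrite measurable_prod_measurableType //; congr (<<s _ >>).
  rewrite predeqE; split => [[A mA [B mB <-]]|[A [mA [B [mB ->]]]]].
    by exists A; split => //; exists B.
  by exists A => //; exists B.
- by move=> _; exists setT; split => //; exists setT; split => //; rewrite setXTT.
- exact: bigcup_const.
- by move=> _ [A [mA [B [mB ->]]]]; exact: m12.
Qed.

Context d (T : measurableType d) (P : probability T R).
Context d1 d2 d3 (T1 : measurableType d1) (T2 : measurableType d2) (T3 : measurableType d3).

(** For fixed [C] both sides are finite measures in [A]; triple independence makes them agree on
    rectangles, hence everywhere. *)
Lemma independent3_pair (X : T -> T1) (Y : T -> T2) (W : T -> T3) :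
  measurable_fun setT X -> measurable_fun setT Y -> measurable_fun setT W ->
  independent3 P X Y W -> forall A C, measurable A -> measurable C ->
  P ((fun w => (X w, Y w)) @^-1` A `&` W @^-1` C) =
  P ((fun w => (X w, Y w)) @^-1` A) * P (W @^-1` C).
Proof.
move=> mX mY mW ind A C mA mC.
have mXY : measurable_fun setT (fun w => (X w, Y w)).
  exact: measurable_fun_pair.
have mWC := measurable_preimage mW mC.
pose XY : {mfun T >-> (T1 * T2)%type} := HB.pack (fun w => (X w, Y w)) (isMeasurableFun.Build _ _ _ _ _ mXY).
pose m1 : {measure set (T1 * T2) -> \bar R} :=
  pushforward (mrestr P mWC) XY.
pose c : {nonneg R} := NngNum (fine_ge0 (measure_ge0 P (W @^-1` C))).
pose m2 : {measure set (T1 * T2) -> \bar R} := mscale c (distribution P XY).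
have cE : c%:num%:E = P (W @^-1` C) by rewrite /= fineK ?fin_num_measure.
have := @measure_eq_rectangles _ _ _ _ (m1 mXY) m2.
rewrite /m1 /m2 /= /pushforward /mrestr /mscale /= => h.
rewrite -[LHS]/(P (XY @^-1` A `&` W @^-1` C)) h//; first by rewrite cE muleC.
  by rewrite preimage_setT setTI (le_lt_trans (probability_le1 P mWC))// ltry.
move=> A' B' mA' mB'; rewrite cE.
have -> : XY @^-1` (A' `*` B') = X @^-1` A' `&` Y @^-1` B' by apply/seteqP; split.
rewrite ind// muleC; congr (_ * _); apply/esym.
by have := ind A' B' setT mA' mB' measurableT; rewrite preimage_setT setIT probability_setT mule1.
Qed.

End ProductLaws.

(** * Fubini's theorem for independent variables *)

Section FubiniIndependent.
Context {R : realType} d (T : measurableType d) (P : probability T R).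
Context d1 d2 (T1 : measurableType d1) (T2 : measurableType d2).
Local Open Scope ereal_scope.
Variables (X : {RV P >-> T1}) (Y : {RV P >-> T2}).
Hypothesis ind : forall A C, measurable A -> measurable C ->
  P (X @^-1` A `&` Y @^-1` C) = P (X @^-1` A) * P (Y @^-1` C).

Let mXY : measurable_fun setT (fun w => (X w, Y w)).
Proof. exact: measurable_fun_pair. Qed.

Let joint (B : set (T1 * T2)) : measurable B ->
  P ((fun w => (X w, Y w)) @^-1` B) = (distribution P X \x distribution P Y) B.
Proof.
move=> mB.
pose m1 : {measure set (T1 * T2) -> \bar R} :=
  pushforward P (fun w => (X w, Y w)).
by rewrite (product_measure_unique (m' := m1 mXY)).
Qed.

Lemma indep_integral (F : T1 * T2 -> R) (Phi : T1 -> R) :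
  measurable_fun setT F -> measurable_fun setT Phi ->
  P.-integrable setT (EFin \o (fun w => F (X w, Y w))) ->
  P.-integrable setT (EFin \o (fun w => Phi (X w))) ->
  (forall x, P.-integrable setT (EFin \o (fun w => F (x, Y w)))) ->
  (forall x, \int[P]_w (F (x, Y w))%:E = (Phi x)%:E) ->
  \int[P]_w (F (X w, Y w))%:E = \int[P]_w (Phi (X w))%:E.
Proof.
move=> mF mPhi iF iPhi iF1 inner.
have mF' : measurable_fun setT (EFin \o F) by apply/measurable_EFinP.
pose XY : {mfun T >-> (T1 * T2)%type} := HB.pack (fun w => (X w, Y w)) (isMeasurableFun.Build _ _ _ _ _ mXY).
have push_int : (pushforward P XY).-integrable setT (EFin \o F).
  by apply: integrable_pushforward => //; rewrite preimage_setT.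
have jointE B : measurable B -> distribution P XY B = (distribution P X \x distribution P Y) B.
  exact: joint.
have prod_int : (distribution P X \x distribution P Y).-integrable setT (EFin \o F).
  apply/integrableP; split => //.
  case/integrableP: push_int => _; apply: le_lt_trans; rewrite le_eqVlt; apply/orP; left; apply/eqP.
  by apply: eq_measure_integral => B mB _; exact: esym (jointE _ mB).
transitivity (\int[pushforward P XY]_z (F z)%:E).
  by rewrite integral_pushforward// preimage_setT.
transitivity (\int[distribution P X \x distribution P Y]_z (F z)%:E).
  by apply: eq_measure_integral => B mB _; exact: jointE.
rewrite -integral12_prod_meas1//.
transitivity (\int[pushforward P X]_x (Phi x)%:E); last first.
  rewrite integral_pushforward//.
  exact/measurable_EFinP.
apply: eq_integral => x _; rewrite /fubini_F -inner.
rewrite -[LHS]/(\int[pushforward P Y]_y (F (x, y))%:E) integral_pushforward//.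
- by apply/measurable_EFinP; apply: measurableT_comp => //; exact: pair1_measurable.
- by rewrite preimage_setT; exact: iF1.
Qed.

End FubiniIndependent.

(** * Moments of linear forms of the data vector *)

Section LinearForms.
Context {R : realType} d (T : measurableType d) (P : probability T R).
Variable D : nat.
Local Open Scope ereal_scope.

Definition lin (v : 'cV[R]_D) (x : D.-tuple R) : R := dotv (cV_of_tuple x) v.

Lemma linE v x : lin v x = (\sum_j tnth x j * v j 0)%R.
Proof. by apply: eq_bigr => j _; rewrite mxE. Qed.

Lemma measurable_lin v : measurable_fun setT (lin v).
Proof.
rewrite (_ : lin v = fun x => (\sum_j tnth x j * v j 0)%R); last first.
  by apply/funext => x; exact: linE.
apply: measurable_sum => j; apply: measurable_funM => //.
exact: measurable_tnth.
Qed.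

Variables (a : {RV P >-> D.-tuple R}) (K : R).
Hypothesis K_gt0 : (0 < K)%R.
Hypothesis psi1_a : psi1_vec P a <= K%:E.

Let measurable_lin_a v : measurable_fun setT (fun w => lin v (a w)).
Proof. by apply: measurableT_comp => //; exact: measurable_lin. Qed.

Lemma psi1_lin t : l2norm t = 1%R -> psi1 P (fun w => lin t (a w)) <= K%:E.
Proof. by move=> t1; apply: le_trans psi1_a; apply: ereal_sup_ubound; exists t. Qed.

Lemma lin_exp_le v c : (l2norm v <= 1)%R -> (8 * K <= c)%R ->
  \int[P]_w (expR (`|lin v (a w)| / c))%:E <= 2%:E.
Proof.
move=> v1 Kc; have c0 : (0 < c)%R by apply: lt_le_trans Kc; rewrite mulr_gt0.
have [->|v0] := eqVneq v 0%R.
  under eq_integral do rewrite /lin dotv0r normr0 mul0r expR0.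
  by rewrite integral_cst//= probability_setT mule1 lee_fin ler1n.
have t1 : l2norm (normalize v) = 1%R.
  by rewrite /normalize l2normZ ger0_norm ?invr_ge0 ?l2norm_ge0// mulVf// l2norm_eq0.
apply: le_trans (psi1_exp (measurable_lin_a (normalize v)) K_gt0 Kc (psi1_lin t1)).
have mexp u : measurable_fun setT (fun w => expR (`|lin u (a w)| / c)).
  by apply: measurableT_comp => //; apply: measurable_funM => //; exact: measurableT_comp.
apply: ge0_le_integral => //; [exact/measurable_EFinP|exact/measurable_EFinP|].
move=> w _; rewrite lee_fin ler_expR ler_wpM2r ?invr_ge0 ?(ltW c0)//.
rewrite /lin {1}(l2norm_normalize v0) dotvZr normrM ger0_norm ?l2norm_ge0//.
by rewrite ler_piMl.
Qed.

Let coordE w j : tnth (a w) j = lin (delta_mx j ord0) (a w).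
Proof.
rewrite linE (bigD1 j)//= mxE !eqxx mulr1 big1 ?addr0// => i ij.
by rewrite mxE (negbTE ij) mulr0.
Qed.

Lemma l2norm_delta (j : 'I_D) : l2norm (delta_mx j ord0 : 'cV[R]_D) = 1%R.
Proof.
rewrite /l2norm /dotv (bigD1 j)//= mxE !eqxx mulr1 big1 ?addr0 ?sqrtr1// => i ij.
by rewrite mxE (negbTE ij) mulr0.
Qed.

Let measurable_coord j : measurable_fun setT (fun w => tnth (a w) j).
Proof. by apply: (measurableT_comp (measurable_tnth j)). Qed.

(** Linearity of the integral requires integrability of all products of coordinates; it is drawn
    from the second moment that the psi_1 norm controls. *)
Let coord_sqr_integrable j : P.-integrable setT (EFin \o (fun w => tnth (a w) j ^+ 2)%R).
Proof.
apply/integrableP; split; first by apply/measurable_EFinP; exact: measurable_funX.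
have := psi1_moment 1 (ltW K_gt0) (psi1_lin (l2norm_delta j)).
move=> h; apply: (@le_lt_trans _ _ ((2 * K) ^+ 2)%:E); last exact: ltry.
apply: le_trans h.
rewrite le_eqVlt; apply/orP; left; apply/eqP; apply: eq_integral => w _ /=.
by rewrite -coordE normrX.
Qed.

Lemma coord_mul_integrable i j :
  P.-integrable setT (EFin \o (fun w => tnth (a w) i * tnth (a w) j)%R).
Proof.
apply: (@le_integrable _ _ _ P setT _ _
  (fun w => (tnth (a w) i ^+ 2)%:E + (tnth (a w) j ^+ 2)%:E)) => //.
- by apply/measurable_EFinP; exact: measurable_funM.
- move=> w _ /=; rewrite lee_fin [leRHS]ger0_norm ?addr_ge0 ?sqr_ge0//.
  have := sqr_ge0 (tnth (a w) i - tnth (a w) j)%R.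
  have := sqr_ge0 (tnth (a w) i + tnth (a w) j)%R.
  by rewrite ler_norml => h1 h2; apply/andP; split; nra.
- by apply: integrableD => //; exact: coord_sqr_integrable.
Qed.

Lemma coord_integrable j : P.-integrable setT (EFin \o (fun w => tnth (a w) j)).
Proof.
apply: (@le_integrable _ _ _ P setT _ _ (fun w => 1%:E + (tnth (a w) j ^+ 2)%:E)) => //.
- exact/measurable_EFinP.
- move=> w _ /=; rewrite lee_fin [leRHS]ger0_norm ?addr_ge0 ?sqr_ge0//.
  have := sqr_ge0 (1 - `|tnth (a w) j|)%R.
  by rewrite sqrrB expr1n real_normK ?num_real// => h; have := sqr_ge0 (tnth (a w) j); nra.
- apply: integrableD => //; first exact: finite_measure_integrable_cst.
  exact: coord_sqr_integrable.
Qed.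

Hypothesis mean0 : mean_zero P a.
Hypothesis iso : isotropic P a.

Lemma lin_integrable v : P.-integrable setT (EFin \o (fun w => lin v (a w))).
Proof.
rewrite (_ : _ \o _ = fun w => \sum_j (v j 0)%:E * (tnth (a w) j)%:E); last first.
  by apply/funext => w /=; rewrite linE -sumEFin; apply: eq_bigr => j _; rewrite mulrC.
by apply: integrable_sum => // j _; apply: integrableZl => //; exact: coord_integrable.
Qed.

Lemma lin_mean v : \int[P]_w (lin v (a w))%:E = 0.
Proof.
rewrite (_ : (fun w => _) = fun w => \sum_j (v j 0)%:E * (tnth (a w) j)%:E); last first.
  by apply/funext => w /=; rewrite linE -sumEFin; apply: eq_bigr => j _; rewrite mulrC.
have ci j : P.-integrable setT (fun w => (v j 0)%:E * (tnth (a w) j)%:E).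
  by apply: integrableZl => //; exact: coord_integrable.
rewrite integral_sum// big1// => j _; rewrite integralZl//; last exact: coord_integrable.
by have := mean0 j; rewrite unlock => ->; rewrite mule0.
Qed.

Let lin_mulE g v w : (lin g (a w) * lin v (a w))%:E =
  \sum_i \sum_j (g i 0 * v j 0)%:E * (tnth (a w) i * tnth (a w) j)%:E.
Proof.
rewrite !linE mulr_suml -sumEFin; apply: eq_bigr => i _.
rewrite mulr_sumr -sumEFin; apply: eq_bigr => j _.
by rewrite -EFinM; congr EFin; ring.
Qed.

Let term_integrable (g v : 'cV[R]_D) i j : P.-integrable setT
  (fun w => (g i 0 * v j 0)%:E * (tnth (a w) i * tnth (a w) j)%:E).
Proof. by apply: integrableZl => //; exact: coord_mul_integrable. Qed.

Lemma lin_mul_integrable g v :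
  P.-integrable setT (EFin \o (fun w => lin g (a w) * lin v (a w))%R).
Proof.
rewrite (_ : _ \o _ = fun w => (lin g (a w) * lin v (a w))%:E)//.
under eq_fun do rewrite lin_mulE.
by apply: integrable_sum => // i _; apply: integrable_sum => // j _.
Qed.

Lemma lin_mul_mean g v : \int[P]_w (lin g (a w) * lin v (a w))%:E = (dotv g v)%:E.
Proof.
under eq_integral do rewrite lin_mulE.
rewrite integral_sum//; last first.
  by move=> i; apply: integrable_sum => // j _; exact: term_integrable.
rewrite /dotv -sumEFin; apply: eq_bigr => i _.
rewrite integral_sum// (bigD1 i)//= integralZl//; last exact: coord_mul_integrable.
have := iso i i; rewrite unlock => ->; rewrite eqxx mule1 big1 ?adde0// => j ji.
rewrite integralZl//; last exact: coord_mul_integrable.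
by have := iso i j; rewrite unlock => ->; rewrite eq_sym (negbTE ji) mule0.
Qed.

Lemma lin_sqr_mean v : \int[P]_w (lin v (a w) ^+ 2)%:E = (l2norm v ^+ 2)%:E.
Proof. by rewrite l2norm_sqr -lin_mul_mean. Qed.

Lemma lin_abs_mean v : (l2norm v <= 1)%R -> \int[P]_w (`|lin v (a w)|)%:E <= 1.
Proof.
move=> v1.
have i2 : P.-integrable setT (EFin \o (fun w => lin v (a w) ^+ 2)%R).
  exact: lin_mul_integrable.
apply: (@le_trans _ _ (\int[P]_w (2^-1%:E + 2^-1%:E * (lin v (a w) ^+ 2)%:E))).
  apply: ge0_le_integral => //.
  - by apply/measurable_EFinP; exact: measurableT_comp.
  - apply/measurable_EFinP; apply: measurable_funD => //; apply: measurable_funM => //.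
    exact: measurable_funX.
  - move=> w _; rewrite -EFinM -EFinD lee_fin.
    have := sqr_ge0 (1 - `|lin v (a w)|)%R.
    by rewrite sqrrB expr1n real_normK ?num_real//; lra.
rewrite integralD//; last 2 first.
- exact: finite_measure_integrable_cst.
- exact: integrableZl.
rewrite integral_cst//= probability_setT mule1 integralZl// lin_sqr_mean -EFinM -EFinD.
rewrite lee_fin; have : (l2norm v ^+ 2 <= 1)%R by rewrite expr_le1// l2norm_ge0.
lra.
Qed.

End LinearForms.

(** * Clipping and signs *)

Section Clip.
Context {R : realType}.
Implicit Types lam s t : R.

Definition clip lam s : R := Num.max (- lam) (Num.min s lam).

Lemma clip_cases lam s : 0 <= lam ->
  [\/ s <= - lam /\ clip lam s = - lam, - lam <= s <= lam /\ clip lam s = s |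
      lam <= s /\ clip lam s = lam].
Proof.
move=> lam0; rewrite /clip; have [h1|/ltW h1] := lerP s (- lam).
  constructor 1; split => //; rewrite min_l; last by lra.
  by rewrite max_l.
have [h2|/ltW h2] := lerP s lam.
  by constructor 2; split; [apply/andP|rewrite max_r].
by constructor 3; split; [|rewrite max_r//; lra].
Qed.

Lemma clip_le lam s : 0 <= lam -> `|clip lam s| <= lam.
Proof.
move=> lam0; rewrite ler_norml.
by have [[? ->]|[/andP[? ?] ->]|[? ->]] := clip_cases s lam0; apply/andP; split; lra.
Qed.

Lemma clip_shift lam s t : 0 <= lam -> 0 <= t ->
  0 <= clip lam (s + t) - clip lam (s - t) <= 2 * t.
Proof.
move=> lam0 t0.
by have [[? ->]|[/andP[? ?] ->]|[? ->]] := clip_cases (s + t) lam0;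
  have [[? ->]|[/andP[? ?] ->]|[? ->]] := clip_cases (s - t) lam0;
  apply/andP; split; lra.
Qed.

Lemma clip_sub lam s : 0 <= lam -> (s - clip lam s) ^+ 2 <= s ^+ 2 * (lam < `|s|)%R%:R.
Proof.
move=> lam0; have [[h ->]|[h ->]|[h ->]] := clip_cases s lam0.
- have s0 : s <= 0 by lra.
  rewrite ler0_norm//; have [h'|h'] := ltP lam (- s); first by rewrite mulr1; nra.
  have -> : s - - lam = 0 by lra.
  by rewrite expr0n/= mulr0.
- by rewrite subrr expr0n/= mulr_ge0 ?sqr_ge0.
- have s0 : 0 <= s by lra.
  rewrite ger0_norm//; have [h'|h'] := ltP lam s; first by rewrite mulr1; nra.
  have -> : s - lam = 0 by lra.
  by rewrite expr0n/= mulr0.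
Qed.

Lemma measurable_clip lam : measurable_fun setT (clip lam).
Proof. by apply: measurable_maxr => //; exact: measurable_minr. Qed.

Lemma sign_bit_abs t : `|sign_bit t| = 1.
Proof. by rewrite /sign_bit; case: ifP => _; rewrite ?normrN1 ?normr1. Qed.

Lemma sign_bit_le s t : s <= t -> sign_bit s <= sign_bit t.
Proof.
move=> st; rewrite /sign_bit; case: ifP => [s0|_]; first by rewrite (le_trans s0).
by case: ifP => _; lra.
Qed.

Lemma measurable_sign_bit : measurable_fun setT (@sign_bit R).
Proof. by apply: measurable_fun_ifT => //; exact: measurable_fun_ler. Qed.

End Clip.

(** * Averaging over the uniform dither *)

Section Dither.
Context {R : realType} d (T : measurableType d) (P : probability T R).
Local Open Scope ereal_scope.
Variables (tau : {RV P >-> R}) (lam : R).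
Hypothesis lam_gt0 : (0 < lam)%R.
Hypothesis tau_unif : uniform_on P (- lam) lam tau.

Lemma uniform_tail (s : R) :
  P (tau @^-1` [set t | (- s <= t)%R]) = ((lam + clip lam s) / (2 * lam))%:E.
Proof.
have [ab E] := tau_unif.
have mB : measurable [set t : R | (- s <= t)%R].
  rewrite (_ : [set t | _] = `[(- s)%R, +oo[%classic); first exact: measurable_itv.
  by apply/seteqP; split => t /=; rewrite in_itv/= andbT.
rewrite E// -[uniform_prob ab _]/((uniform_prob ab : {measure set _ -> \bar R}) _).
rewrite -(setIT [set t : R | (- s <= t)%R]) -integral_indic//.
rewrite (integral_uniform ab (f := fun t => (\1_[set t : R | (- s <= t)%R] t)%:E)).
2: by apply/measurable_EFinP; exact: measurable_indic.
2: by move=> x; rewrite lee_fin.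
rewrite integral_indic//.
rewrite (_ : _ `&` _ = `[(Num.max (- s) (- lam))%R, lam]%classic); last first.
  apply/seteqP; split => t /=; rewrite !in_itv/= ge_max.
    by move=> [-> /andP[-> ->]].
  by move=> /andP[/andP[-> ->] ->].
rewrite [X in _ * X](lebesgue_measure_itv `[(Num.max (- s) (- lam))%R, lam])/= lte_fin -EFinB.
have lamlam : (lam - - lam = 2 * lam)%R by ring.
rewrite lamlam.
have [[h1 ->]|[/andP[h1 h2] ->]|[h1 ->]] := clip_cases s (ltW lam_gt0).
- rewrite ifF ?mule0 ?subrr ?mul0r//; apply/negbTE; rewrite -leNgt le_max.
  by apply/orP; left; lra.
- rewrite max_l; last by lra.
  case: ltP => h; first by rewrite -EFinM; congr EFin; rewrite mulrC; congr (_ * _)%R; ring.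
  rewrite mule0 (_ : (lam + s = 0)%R) ?mul0r//; lra.
- rewrite max_r; last by lra.
  rewrite ifT; last by lra.
  by rewrite -EFinM; congr EFin; rewrite mulrC; congr (_ * _)%R; ring.
Qed.

(** [lam * sign_bit (s + tau)] is [2 lam] times the indicator of [- s <= tau], minus [lam]; the tail
    of the uniform law is affine in the clipped [s]. *)
Lemma dither_integral (s : R) :
  \int[P]_w (lam * sign_bit (s + tau w))%:E = (clip lam s)%:E.
Proof.
have mB : measurable [set t : R | (- s <= t)%R].
  rewrite (_ : [set t | _] = `[(- s)%R, +oo[%classic); first exact: measurable_itv.
  by apply/seteqP; split => t /=; rewrite in_itv/= andbT.
have mtB := measurable_preimage (measurable_funPT tau) mB.
rewrite (eq_integral (fun w => (2 * lam)%:E *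
    (\1_(tau @^-1` [set t | (- s <= t)%R]) w)%:E - lam%:E)); last first.
  move=> w _; rewrite -EFinM -EFinB /sign_bit; congr EFin.
  have [h|h] := leP 0%R (s + tau w)%R.
    by rewrite indicE mem_set/=; [lra|lra].
  by rewrite indicE memNset/=; [lra|apply/negP; rewrite -ltNge; lra].
rewrite integralB//; last 2 first.
- by apply: integrableZl => //; exact: integrable_indic.
- exact: finite_measure_integrable_cst.
rewrite integralZl//; last exact: integrable_indic.
rewrite integral_indic// setIT.
rewrite [X in _ * X - _](uniform_tail s) integral_cst//= probability_setT mule1.
by rewrite -EFinM -EFinB; congr EFin; field; rewrite gt_eqF.
Qed.

Context d1 (T1 : measurableType d1) (X : {RV P >-> T1}).
Hypothesis ind : forall A C, measurable A -> measurable C ->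
  P (X @^-1` A `&` tau @^-1` C) = P (X @^-1` A) * P (tau @^-1` C).

(** The weight [q] is left general: a linear form gives the correlations, its absolute value the
    sign flips. *)
Lemma dither_expectation (S q : T1 -> R) :
  measurable_fun setT S -> measurable_fun setT q ->
  P.-integrable setT (EFin \o (fun w => q (X w))) ->
  \int[P]_w (lam * sign_bit (S (X w) + tau w) * q (X w))%:E =
  \int[P]_w (clip lam (S (X w)) * q (X w))%:E.
Proof.
move=> mS mq iq; have lam0 := ltW lam_gt0.
have mX : measurable_fun setT X by exact: measurable_funPT.
have mtau : measurable_fun setT tau by exact: measurable_funPT.
have mqX : measurable_fun setT (fun w => q (X w)) by exact: measurableT_comp.
have le_int (f : T -> R) : measurable_fun setT f ->
    (forall w, (`|f w| <= lam)%R) ->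
    P.-integrable setT (EFin \o (fun w => f w * q (X w))%R).
  move=> mf fl.
  apply: (@le_integrable _ _ _ P setT _ _ (fun w => lam%:E * (q (X w))%:E)) => //.
  - by apply/measurable_EFinP; exact: measurable_funM.
  - by move=> w _ /=; rewrite lee_fin !normrM (ger0_norm lam0) ler_wpM2r.
  - exact: integrableZl.
have sgn_le t : (`|lam * sign_bit t| <= lam)%R.
  by rewrite normrM sign_bit_abs mulr1 ger0_norm.
apply: (indep_integral ind (F := fun z => (lam * sign_bit (S z.1 + z.2) * q z.1)%R)
  (Phi := fun x => (clip lam (S x) * q x)%R)).
- apply: measurable_funM; last exact: measurableT_comp.
  apply: measurable_funM => //; apply: measurableT_comp; first exact: measurable_sign_bit.
  by apply: measurable_funD => //; exact: measurableT_comp.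
- apply: measurable_funM => //; apply: measurableT_comp => //; exact: measurable_clip.
- apply: le_int => //; apply: measurable_funM => //.
  apply: measurableT_comp; first exact: measurable_sign_bit.
  by apply: measurable_funD => //; exact: measurableT_comp.
- apply: le_int => [|w]; last exact: clip_le.
  apply: measurableT_comp; first exact: measurable_clip.
  exact: measurableT_comp.
- move=> x /=.
  have ms : measurable_fun setT (fun w => (lam * sign_bit (S x + tau w))%R).
    apply: measurable_funM => //; apply: measurableT_comp; first exact: measurable_sign_bit.
    exact: measurable_funD.
  apply: (@le_integrable _ _ _ P setT _ _ (fun w => (lam * `|q x|)%:E)) => //.
  + by apply/measurable_EFinP; exact: measurable_funM.
  + move=> w _ /=; rewrite lee_fin normrM [leRHS]ger0_norm ?mulr_ge0//.
    by rewrite ler_wpM2r.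
  + exact: finite_measure_integrable_cst.
- move=> x /=; under eq_integral do rewrite mulrC EFinM.
  rewrite integralZl//; last first.
    apply: (@le_integrable _ _ _ P setT _ _ (fun w => lam%:E)) => //.
    + apply/measurable_EFinP; apply: measurable_funM => //; apply: measurableT_comp; first exact: measurable_sign_bit.
      exact: measurable_funD.
    + by move=> w _ /=; rewrite lee_fin [leRHS]ger0_norm.
    + exact: finite_measure_integrable_cst.
  by rewrite dither_integral -EFinM mulrC.
Qed.

End Dither.

(** * The bias caused by clipping *)

Section Bias.
Context {R : realType} d (T : measurableType d) (P : probability T R).
Variables (D : nat) (a : {RV P >-> D.-tuple R}) (xi tau : {RV P >-> R}) (lam K : R).
Local Open Scope ereal_scope.
Hypothesis lam_gt0 : (0 < lam)%R.
Hypothesis K_gt0 : (0 < K)%R.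
Hypothesis psi1_a : psi1_vec P a <= K%:E.
Hypothesis mean0 : mean_zero P a.
Hypothesis iso : isotropic P a.
Hypothesis ind : independent3 P a xi tau.
Variables (g v : 'cV[R]_D) (c e : R).
Hypothesis c_gt0 : (0 < c)%R.
Hypothesis psi1_xi : psi1 P xi <= (c / 8)%:E.
Hypothesis g_exp : \int[P]_w (expR (`|lin g (a w)| / c))%:E <= 2%:E.
Hypothesis v_le1 : (l2norm v <= 1)%R.
Hypothesis e_gt0 : (0 < e)%R.
Hypothesis tail_small : (32 * c ^+ 2 * expR (- (lam / (4 * c))) <= e ^+ 2 / 4)%R.

Let s w : R := (lin g (a w) + xi w)%R.

Let mlin u : measurable_fun setT (fun w => lin u (a w)).
Proof. by apply: measurableT_comp => //; exact: measurable_lin. Qed.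
Let ms : measurable_fun setT s. Proof. exact: measurable_funD. Qed.

Let lin_sqr_integrable u : P.-integrable setT (EFin \o (fun w => lin u (a w) ^+ 2)%R).
Proof. exact: (lin_mul_integrable K_gt0 psi1_a u u). Qed.

Let xi_sqr_integrable : P.-integrable setT (EFin \o (fun w => xi w ^+ 2)%R).
Proof.
apply/integrableP; split; first by apply/measurable_EFinP; exact: measurable_funX.
have c8 : (0 <= c / 8)%R by rewrite divr_ge0 ?(ltW c_gt0).
have h := psi1_moment 1 c8 psi1_xi.
apply: (@le_lt_trans _ _ ((2 * (c / 8)) ^+ 2)%:E); last exact: ltry.
apply: le_trans h.
rewrite le_eqVlt; apply/orP; left; apply/eqP; apply: eq_integral => w _ /=.
by rewrite normrX.
Qed.

Let xi_lin_integrable u : P.-integrable setT (EFin \o (fun w => xi w * lin u (a w))%R).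
Proof.
apply: (@le_integrable _ _ _ P setT _ _
  (fun w => (xi w ^+ 2)%:E + (lin u (a w) ^+ 2)%:E)) => //.
- by apply/measurable_EFinP; exact: measurable_funM.
- move=> w _ /=; rewrite lee_fin [leRHS]ger0_norm ?addr_ge0 ?sqr_ge0//.
  have := sqr_ge0 (xi w - lin u (a w))%R.
  have := sqr_ge0 (xi w + lin u (a w))%R.
  by rewrite ler_norml => h1 h2; apply/andP; split; nra.
- by apply: integrableD => //; exact: lin_sqr_integrable.
Qed.

Let ind_xi_a A C : measurable A -> measurable C ->
  P (xi @^-1` A `&` a @^-1` C) = P (xi @^-1` A) * P (a @^-1` C).
Proof.
move=> mA mC; have := ind mC mA measurableT.
by rewrite preimage_setT setIT probability_setT mule1 setIC muleC.
Qed.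

(** Independence and [E <a, v> = 0] remove the noise from the correlation, whatever its mean. *)
Let xi_lin_mean : \int[P]_w (xi w * lin v (a w))%:E = 0.
Proof.
transitivity (\int[P]_w (0%R : R)%:E); last by rewrite integral0.
apply: (indep_integral ind_xi_a (F := fun z => (z.1 * lin v z.2)%R)
  (Phi := fun=> 0%R)) => //.
- apply: measurable_funM => //; apply: measurableT_comp => //; exact: measurable_lin.
- exact: finite_measure_integrable_cst.
- move=> x /=; rewrite (_ : _ \o _ = fun w => x%:E * (lin v (a w))%:E)//.
  by apply: integrableZl => //; exact: (lin_integrable K_gt0 psi1_a).
- move=> x /=; under eq_integral do rewrite EFinM.
  by rewrite integralZl//; [rewrite (lin_mean K_gt0 psi1_a)// mule0|exact: (lin_integrable K_gt0 psi1_a)].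
Qed.

Let s_lin_mean : \int[P]_w (s w * lin v (a w))%:E = (dotv g v)%:E.
Proof.
under eq_integral do rewrite mulrDl EFinD.
rewrite integralD//; [|exact: (lin_mul_integrable K_gt0 psi1_a g v)|exact: xi_lin_integrable].
by rewrite xi_lin_mean adde0 (lin_mul_mean K_gt0 psi1_a).
Qed.

Let s_lin_integrable : P.-integrable setT (EFin \o (fun w => s w * lin v (a w))%R).
Proof.
rewrite (_ : _ \o _ = fun w => (lin g (a w) * lin v (a w))%:E + (xi w * lin v (a w))%:E).
  by apply: integrableD => //; [exact: (lin_mul_integrable K_gt0 psi1_a g v)|exact: xi_lin_integrable].
by apply/funext => w /=; rewrite mulrDl EFinD.
Qed.

Let E2 w : R := (expR (`|lin g (a w)| / c) + expR (`|xi w| / c))%R.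

Let mexp (f : T -> R) : measurable_fun setT f -> measurable_fun setT (fun w => expR (`|f w| / c)).
Proof.
move=> mf; apply: measurableT_comp => //; apply: measurable_funM => //.
exact: measurableT_comp.
Qed.

Let xi_exp : \int[P]_w (expR (`|xi w| / c))%:E <= 2%:E.
Proof.
apply: (psi1_exp _ _ _ psi1_xi) => //; first by rewrite divr_gt0.
by rewrite mulrCA mulfV// mulr1.
Qed.

Let exp_integrable (f : T -> R) : measurable_fun setT f ->
  \int[P]_w (expR (`|f w| / c))%:E <= 2%:E ->
  P.-integrable setT (EFin \o (fun w => expR (`|f w| / c))).
Proof.
move=> mf h; apply/integrableP; split; first by apply/measurable_EFinP; exact: mexp.
apply: (@le_lt_trans _ _ 2%:E); last exact: ltry.
apply: le_trans h; rewrite le_eqVlt; apply/orP; left; apply/eqP.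
by apply: eq_integral => w _ /=; rewrite ger0_norm ?expR_ge0.
Qed.

(* On [lam < |s|] the square of [s] is absorbed by [expR (|s| / (4 c))], and
   half of the remaining exponential moment pays for the small factor. *)
Let excess_le w : ((s w - clip lam (s w)) ^+ 2 <= e ^+ 2 / 8 * E2 w)%R.
Proof.
apply: le_trans (clip_sub (s w) (ltW lam_gt0)) _.
have c0 : (0 < 4 * c)%R by rewrite mulr_gt0.
have E20 : (0 <= E2 w)%R by rewrite addr_ge0// expR_ge0.
have [h|h] := ltP lam `|s w|%R; last first.
  by rewrite mulr0 mulr_ge0// divr_ge0// sqr_ge0.
rewrite mulr1.
set q := expR (`|s w| / (4 * c)).
have q0 : (0 < q)%R := expR_gt0 _.
have s2 : (s w ^+ 2 <= 32 * c ^+ 2 * q)%R.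
  have := sqr_le_expR (divr_ge0 (normr_ge0 (s w)) (ltW c0)).
  rewrite expr_div_n ler_pdivrMr ?exprn_gt0// real_normK ?num_real// exprMn -/q.
  by lra.
have q1 : (1 <= q * expR (- (lam / (4 * c))))%R.
  rewrite -expRD -[leLHS]expR0 ler_expR subr_ge0.
  by apply: ler_wpM2r; [rewrite invr_ge0 ltW|exact: ltW].
have q2 : (q * q <= E2 w / 2)%R.
  set x := (`|lin g (a w)| / (2 * c))%R; set y := (`|xi w| / (2 * c))%R.
  have e1 : (q * q <= expR x * expR y)%R.
    rewrite -!expRD ler_expR (_ : `|s w| / (4 * c) + `|s w| / (4 * c) = `|s w| / (2 * c))%R; last first.
      by field; rewrite gt_eqF.
    by rewrite -mulrDl ler_wpM2r ?invr_ge0 ?mulr_ge0 ?(ltW c_gt0)// ler_normD.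
  have ex : expR (`|lin g (a w)| / c) = (expR x ^+ 2)%R.
    by rewrite -expRM_natl; congr expR; rewrite /x; field; rewrite gt_eqF.
  have ey : expR (`|xi w| / c) = (expR y ^+ 2)%R.
    by rewrite -expRM_natl; congr expR; rewrite /y; field; rewrite gt_eqF.
  rewrite /E2 ex ey; have := sqr_ge0 (expR x - expR y)%R; nra.
have ts := tail_small; set t := expR (- (lam / (4 * c))) in q1 ts.
have t0 : (0 < t)%R := expR_gt0 _.
have c2 : (0 <= 32 * c ^+ 2)%R by rewrite mulr_ge0 ?sqr_ge0.
apply: (le_trans s2); apply: (@le_trans _ _ (32 * c ^+ 2 * q * (q * t)))%R.
  by rewrite ler_peMr// mulr_ge0// ltW.
have -> : (32 * c ^+ 2 * q * (q * t) = (32 * c ^+ 2 * t) * (q * q))%R by ring.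
have -> : (e ^+ 2 / 8 * E2 w = e ^+ 2 / 4 * (E2 w / 2))%R by field.
by apply: ler_pM => //; apply: mulr_ge0 => //; exact: ltW.
Qed.

Lemma dither_bias :
  (`|fine (\int[P]_w (clip lam (s w) * lin v (a w))%:E) - dotv g v| <= e)%R.
Proof.
have mclip : measurable_fun setT (fun w => clip lam (s w)).
  by apply: measurableT_comp => //; exact: measurable_clip.
(* Young's inequality with weight [e], followed by [excess_le]. The expectation is at most
   [e / 2 + (e / 16) * 4], below [e]. *)
pose B w : R := (e / 2 * lin v (a w) ^+ 2 + e / 16 * E2 w)%R.
have le_B w : (`|(s w - clip lam (s w)) * lin v (a w)| <= B w)%R.
  have h := excess_le w; set x := (s w - _)%R in h *; set z := lin v (a w).
  have h2 : (x ^+ 2 / (2 * e) <= e / 16 * E2 w)%R.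
    rewrite ler_pdivrMr ?mulr_gt0//; apply: le_trans h _.
    by rewrite le_eqVlt; apply/orP; left; apply/eqP; field.
  apply: (@le_trans _ _ (e / 2 * z ^+ 2 + x ^+ 2 / (2 * e)))%R; last by rewrite lerD2l.
  have := sqr_ge0 (e * `|z| - `|x|)%R; rewrite sqrrB exprMn !real_normK ?num_real// => h3.
  rewrite -subr_ge0 normrM.
  have -> : (e / 2 * z ^+ 2 + x ^+ 2 / (2 * e) - `|x| * `|z| =
    (e ^+ 2 * z ^+ 2 - e * `|z| * `|x| *+ 2 + x ^+ 2) / (2 * e))%R.
    by field; rewrite gt_eqF.
  by rewrite divr_ge0// mulr_ge0// ltW.
have iv2 : P.-integrable setT (fun w => (e / 2)%:E * (lin v (a w) ^+ 2)%:E).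
  by apply: integrableZl => //; exact: lin_sqr_integrable.
have iE2 : P.-integrable setT (fun w => (expR (`|lin g (a w)| / c))%:E + (expR (`|xi w| / c))%:E).
  by apply: integrableD => //; exact: exp_integrable.
have iB : P.-integrable setT (EFin \o B).
  rewrite (_ : EFin \o B = fun w => (e / 2)%:E * (lin v (a w) ^+ 2)%:E +
    (e / 16)%:E * ((expR (`|lin g (a w)| / c))%:E + (expR (`|xi w| / c))%:E))//.
  by apply: integrableD => //; exact: integrableZl.
have iX : P.-integrable setT (EFin \o (fun w => (s w - clip lam (s w)) * lin v (a w))%R).
  apply: le_integrable iB => //.
    by apply/measurable_EFinP; apply: measurable_funM => //; exact: measurable_funB.
  by move=> w _ /=; rewrite lee_fin (le_trans (le_B w))// ler_norm.
have intB : \int[P]_w (B w)%:E <= e%:E.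
  rewrite (_ : (fun w => (B w)%:E) = fun w => (e / 2)%:E * (lin v (a w) ^+ 2)%:E +
    (e / 16)%:E * ((expR (`|lin g (a w)| / c))%:E + (expR (`|xi w| / c))%:E))//.
  rewrite integralD//; last exact: integrableZl.
  rewrite !integralZl//; last exact: lin_sqr_integrable.
  rewrite integralD//; [|exact: exp_integrable|exact: exp_integrable].
  rewrite (lin_sqr_mean K_gt0 psi1_a)//.
  apply: (@le_trans _ _ ((e / 2)%:E * 1%:E + (e / 16)%:E * (2%:E + 2%:E))).
    apply: leeD; apply: lee_wpmul2l; rewrite ?lee_fin ?divr_ge0 ?(ltW e_gt0)//.
      by rewrite expr_le1// l2norm_ge0.
    exact: leeD.
  rewrite -[leLHS]/((e / 2 * 1 + e / 16 * (2 + 2))%R%:E) lee_fin.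
  by have := e_gt0; lra.
have iC : P.-integrable setT (EFin \o (fun w => clip lam (s w) * lin v (a w))%R).
  rewrite (_ : _ \o _ = fun w => (s w * lin v (a w))%:E -
     ((s w - clip lam (s w)) * lin v (a w))%:E); last first.
    by apply/funext => u /=; rewrite -EFinB; congr EFin; ring.
  exact: integrableB.
have -> : dotv g v = fine (\int[P]_w (s w * lin v (a w))%:E) by rewrite s_lin_mean.
rewrite -fineB ?integrable_fin_num// -integralB//.
rewrite (eq_integral (fun w => - ((s w - clip lam (s w)) * lin v (a w))%:E)); last first.
  by move=> w _; rewrite -EFinB -EFinN; congr EFin; ring.
rewrite integralN ?integrable_add_def// fineN normrN.
rewrite -lee_fin; apply: le_trans intB.
rewrite -[leLHS]/(`|(fine (\int[P]_w ((s w - clip lam (s w)) * lin v (a w))%:E))%:E|).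
rewrite fineK ?integrable_fin_num//.
apply: le_trans (le_abse_integral _ _ _) _ => //.
  by case/integrableP: iX.
apply: ge0_le_integral => //.
- by apply: measurableT_comp => //; case/integrableP: iX.
- by case/integrableP: iB.
- by move=> w _; rewrite lee_fin.
Qed.

End Bias.

(** * Deviations of the empirical sums at fixed vectors *)

Lemma measurable_ge {R : realType} d (T : measurableType d) (f : T -> R) (x : R) :
  measurable_fun setT f -> measurable [set w | x <= f w].
Proof.
move=> mf; rewrite (_ : [set w | _] = f @^-1` `[x, +oo[%classic).
  by apply: measurable_preimage => //; exact: measurable_itv.
by apply/seteqP; split => w /=; rewrite in_itv/= andbT.
Qed.

Section Concentration.
Context {R : realType} d (T : measurableType d) (P : probability T R).
Variables (D m : nat) (a : {RV P >-> D.-tuple R}) (xi tau : {RV P >-> R}).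
Variables (a_ : 'I_m -> {RV P >-> D.-tuple R}) (xi_ tau_ : 'I_m -> {RV P >-> R}).
Variables (lam L K e : R).
Local Open Scope ereal_scope.
Hypothesis lam_ge1 : (1 <= lam)%R.
Hypothesis L_ge1 : (1 <= L)%R.
Hypothesis lam_le : (lam <= expR L)%R.
Hypothesis K_gt0 : (0 < K)%R.
Hypothesis K_le : (8 * K <= lam)%R.
Hypothesis e01 : (0 < e <= 1)%R.
Hypothesis tau_unif : uniform_on P (- lam) lam tau.
Hypothesis psi1_a : psi1_vec P a <= K%:E.
Hypothesis mean0 : mean_zero P a.
Hypothesis iso : isotropic P a.
Hypothesis ind : independent3 P a xi tau.
Hypothesis indepZ : mutually_independent P (fun i w => (a_ i w, xi_ i w, tau_ i w)).
Hypothesis lawZ : forall i, same_law P (fun w => (a_ i w, xi_ i w, tau_ i w))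
                                       (fun w => (a w, xi w, tau w)).

Local Notation data := ((D.-tuple R * R) * R)%type.
Local Notation delta := (expR (- (m%:R * e ^+ 2 / (272 * lam ^+ 2 * L)))).

Let lam_gt0 : (0 < lam)%R. Proof. exact: lt_le_trans lam_ge1. Qed.

Let mZ i : measurable_fun setT (fun w => (a_ i w, xi_ i w, tau_ i w)).
Proof. by apply: measurable_fun_pair => //; exact: measurable_fun_pair. Qed.

Let mZ0 : measurable_fun setT (fun w => (a w, xi w, tau w)).
Proof. by apply: measurable_fun_pair => //; exact: measurable_fun_pair. Qed.

Let mlin11 v : measurable_fun setT (fun z : data => lin v z.1.1).
Proof.
apply: measurableT_comp; first exact: measurable_lin.
exact: measurableT_comp.
Qed.

Lemma empirical_mean_bound (f : data -> R) (v : 'cV[R]_D) (mu : R) :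
  measurable_fun setT f -> (l2norm v <= 1)%R ->
  (forall z, `|f z| <= lam * `|lin v z.1.1|)%R ->
  (fine (\int[P]_w (f (a w, xi w, tau w))%:E) <= mu)%R ->
  P [set w | m%:R * (mu + e) <= \sum_i f (a_ i w, xi_ i w, tau_ i w)]%R <= delta%:E.
Proof.
move=> mf v1 fle fmu.
have h2 : \int[P]_w (lin v (a w) ^+ 2)%:E <= 1.
  by rewrite (lin_sqr_mean K_gt0 psi1_a)// lee_fin expr_le1// l2norm_ge0.
have h3 := lin_exp_le K_gt0 psi1_a v1 K_le.
have mlin0 := mlin11 v.
have := bernstein mZ mZ0 indepZ lawZ lam_ge1 L_ge1 lam_le mf mlin0 fle h2 h3 e01.
have mS : measurable_fun setT (fun w => \sum_i f (a_ i w, xi_ i w, tau_ i w))%R.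
  by apply: measurable_sum => i; exact: (measurableT_comp mf (mZ i)).
apply: le_trans; apply: le_measure; rewrite ?inE; [exact: measurable_ge|exact: measurable_ge|].
move=> w /=; apply: le_trans; apply: ler_wpM2l => //.
by rewrite lerD2r.
Qed.

Let X : {RV P >-> (D.-tuple R * R)%type} := HB.pack (fun w => (a w, xi w))
  (isMeasurableFun.Build _ _ _ _ _ (measurable_fun_pair (measurable_funPT a) (measurable_funPT xi))).

Let ind_X A C : measurable A -> measurable C ->
  P (X @^-1` A `&` tau @^-1` C) = P (X @^-1` A) * P (tau @^-1` C).
Proof.
exact: (independent3_pair (measurable_funPT a) (measurable_funPT xi) (measurable_funPT tau) ind).
Qed.

Let mlin1 v : measurable_fun setT (fun z : D.-tuple R * R => lin v z.1).
Proof. by apply: measurableT_comp; first exact: measurable_lin. Qed.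

Let mshift g t : measurable_fun setT (fun z : D.-tuple R * R => lin g z.1 + z.2 + t)%R.
Proof. by apply: measurable_funD => //; exact: measurable_funD. Qed.

Let msign g t : measurable_fun setT
  (fun z : data => lam * sign_bit (lin g z.1.1 + z.1.2 + t + z.2))%R.
Proof.
apply: measurable_funM => //; apply: measurableT_comp; first exact: measurable_sign_bit.
apply: measurable_funD => //.
exact: (measurableT_comp (mshift g t) measurable_fst).
Qed.

(** One [e] pays for the clipping bias, the other for the random deviation. *)
Lemma sign_correlation_bound (g v : 'cV[R]_D) (c : R) :
  (0 < c)%R -> psi1 P xi <= (c / 8)%:E ->
  \int[P]_w (expR (`|lin g (a w)| / c))%:E <= 2%:E -> (l2norm v <= 1)%R ->
  (32 * c ^+ 2 * expR (- (lam / (4 * c))) <= e ^+ 2 / 4)%R ->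
  P [set w | m%:R * (dotv g v + e + e) <= \sum_i lam *
      sign_bit (lin g (a_ i w) + xi_ i w + tau_ i w) * lin v (a_ i w)]%R <= delta%:E.
Proof.
move=> c0 xic gexp v1 small.
have e0 : (0 < e)%R by case/andP: e01.
pose f (z : data) := (lam * sign_bit (lin g z.1.1 + z.1.2 + z.2) * lin v z.1.1)%R.
have mS : measurable_fun setT (fun z : D.-tuple R * R => lin g z.1 + z.2)%R.
  exact: measurable_funD.
have mf : measurable_fun setT f.
  apply: measurable_funM => //; apply: measurable_funM => //.
  apply: measurableT_comp; first exact: measurable_sign_bit.
  apply: measurable_funD => //; exact: (measurableT_comp mS measurable_fst).
apply: (@empirical_mean_bound f v (dotv g v + e)%R mf v1).
  by move=> z; rewrite /f !normrM sign_bit_abs mulr1 ger0_norm// ltW.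
have -> : \int[P]_w (f (a w, xi w, tau w))%:E =
  \int[P]_w (clip lam (lin g (a w) + xi w) * lin v (a w))%:E.
  apply: (dither_expectation lam_gt0 tau_unif ind_X mS (mlin1 v)).
  exact: (lin_integrable K_gt0 psi1_a).
have := dither_bias lam_gt0 K_gt0 psi1_a mean0 iso ind c0 xic gexp v1 e0 small.
by rewrite ler_norml => /andP[_]; lra.
Qed.

Lemma sign_flip_bound (g v : 'cV[R]_D) (t : R) : (0 <= t)%R -> (l2norm v <= 1)%R ->
  P [set w | m%:R * (t + e) <= \sum_i lam *
      ((sign_bit (lin g (a_ i w) + xi_ i w + t + tau_ i w) -
        sign_bit (lin g (a_ i w) + xi_ i w - t + tau_ i w)) / 2 *
       `|lin v (a_ i w)|)]%R <= delta%:E.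
Proof.
move=> t0 v1.
pose f (z : data) := (lam * ((sign_bit (lin g z.1.1 + z.1.2 + t + z.2) -
  sign_bit (lin g z.1.1 + z.1.2 - t + z.2)) / 2 * `|lin v z.1.1|))%R.
have mabs : measurable_fun setT (fun z : data => `|lin v z.1.1|)%R.
  exact: measurableT_comp.
have fE : f = fun z => (2^-1 * (lam * sign_bit (lin g z.1.1 + z.1.2 + t + z.2) * `|lin v z.1.1|
    - lam * sign_bit (lin g z.1.1 + z.1.2 - t + z.2) * `|lin v z.1.1|))%R.
  by apply/funext => z; rewrite /f; field.
have mf1 u : measurable_fun setT
    (fun z : data => lam * sign_bit (lin g z.1.1 + z.1.2 + u + z.2) * `|lin v z.1.1|)%R.
  by apply: measurable_funM => //; exact: (msign g u).
have mf : measurable_fun setT f.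
  by rewrite fE; apply: measurable_funM => //; exact: measurable_funB (mf1 t) (mf1 (- t)%R).
apply: (@empirical_mean_bound f v t mf v1).
  move=> z; rewrite /f !normrM (ger0_norm (ltW lam_gt0)) normr_id ler_wpM2l ?(ltW lam_gt0)//.
  rewrite ler_piMl// normfV (@ger0_norm _ 2)// ler_pdivrMr// mul1r.
  by rewrite (le_trans (ler_normB _ _))// !sign_bit_abs; lra.
have iq : P.-integrable setT (EFin \o (fun w => `|lin v (X w).1|%R)).
  rewrite (_ : _ \o _ = abse \o (EFin \o (fun w => lin v (a w))))//.
  by apply: integrable_abse; exact: (lin_integrable K_gt0 psi1_a).
have mq : measurable_fun setT (fun z : D.-tuple R * R => `|lin v z.1|%R).
  exact: measurableT_comp.
have mlinv : measurable_fun setT (fun w => `|lin v (a w)|%R).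
  by apply: measurableT_comp => //; exact: measurableT_comp (measurable_lin v) _.
have i1 u : P.-integrable setT
    (fun w => (lam * sign_bit (lin g (a w) + xi w + u + tau w) * `|lin v (a w)|)%:E).
  apply: (@le_integrable _ _ _ P setT _ _ (fun w => lam%:E * (`|lin v (a w)|)%:E)) => //.
  - by apply/measurable_EFinP; exact: (measurableT_comp (mf1 u) mZ0).
  - move=> w _ /=; rewrite lee_fin !normrM sign_bit_abs mulr1 normr_id ger0_norm ?(ltW lam_gt0)//.
  - exact: integrableZl.
have i2 u : P.-integrable setT
    (fun w => (clip lam (lin g (a w) + xi w + u) * `|lin v (a w)|)%:E).
  apply: (@le_integrable _ _ _ P setT _ _ (fun w => lam%:E * (`|lin v (a w)|)%:E)) => //.
  - apply/measurable_EFinP; apply: measurable_funM => //.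
    apply: measurableT_comp; first exact: measurable_clip.
    exact: (measurableT_comp (mshift g u) (measurable_funPT X)).
  - move=> w _ /=; rewrite lee_fin !normrM normr_id (ger0_norm (ltW lam_gt0)) ler_wpM2r//.
    by rewrite clip_le// ltW.
  - exact: integrableZl.
have dE u := dither_expectation lam_gt0 tau_unif ind_X (mshift g u) mq iq.
rewrite fE /=; under eq_integral do rewrite EFinM EFinB.
rewrite integralZl//; last exact: (integrableB _ (i1 t) (i1 (- t)%R)).
rewrite integralB//.
rewrite [X in _ * (X - _)](dE t) [X in _ * (_ - X)](dE (- t)%R).
rewrite -integralB//.
rewrite -lee_fin fineK; last first.
  rewrite fin_numM// integrable_fin_num//.
  exact: (integrableB _ (i2 t) (i2 (- t)%R)).
rewrite -integralZl//; last exact: (integrableB _ (i2 t) (i2 (- t)%R)).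
(* Shifting by [t] and by [- t] changes the clipped value by at most [2 t], and half of this
   multiplies [|<a, v>|], whose mean is at most 1. *)
apply: (@le_trans _ _ (\int[P]_w (t%:E * (`|lin v (a w)|)%:E))).
  have shift w := clip_shift (lin g (a w) + xi w)%R (ltW lam_gt0) t0.
  apply: ge0_le_integral => //.
  - move=> w _ /=; rewrite -EFinB -EFinM lee_fin -mulrBl mulr_ge0// mulr_ge0//.
    by case/andP: (shift w).
  - exact: (measurable_int P (integrableZl _ _ (integrableB _ (i2 t) (i2 (- t)%R)))).
  - by apply/measurable_EFinP; exact: measurable_funM.
  - move=> w _ /=; rewrite -EFinB -!EFinM lee_fin -mulrBl mulrA ler_wpM2r//.
    by case/andP: (shift w) => _; lra.
rewrite integralZl// -[leRHS]mule1 lee_wpmul2l ?lee_fin//.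
exact: (lin_abs_mean K_gt0 psi1_a).
Qed.

(** Applied to coordinate vectors, this bounds the total length of the samples, which multiplies the
    discretization error. *)
Lemma abs_lin_bound (v : 'cV[R]_D) : (l2norm v <= 1)%R ->
  P [set w | m%:R * (lam + e) <= \sum_i lam * `|lin v (a_ i w)|]%R <= delta%:E.
Proof.
move=> v1; pose f (z : data) := (lam * `|lin v z.1.1|)%R.
have mf : measurable_fun setT f.
  by apply: measurable_funM => //; exact: measurableT_comp.
apply: (@empirical_mean_bound f v lam mf v1).
  by move=> z; rewrite /f normrM normr_id ger0_norm// ltW.
have iq : P.-integrable setT (fun w => (`|lin v (a w)|)%:E).
  rewrite (_ : (fun w => _) = abse \o (EFin \o (fun w => lin v (a w))))//.
  by apply: integrable_abse; exact: (lin_integrable K_gt0 psi1_a).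
rewrite /f /=; under eq_integral do rewrite EFinM.
rewrite integralZl// fineM// ?integrable_fin_num//= ler_piMr ?(ltW lam_gt0)//.
rewrite -lee_fin fineK ?integrable_fin_num//.
exact: (lin_abs_mean K_gt0 psi1_a).
Qed.

End Concentration.

(** * Passing from net points to arbitrary vectors *)

Section Perturbation.
Context {R : realType}.
Variables (m D : nat) (a : 'I_m -> 'cV[R]_D) (xi tau : 'I_m -> R).
Variables (lam e t : R) (g g' v v' : 'cV[R]_D).

(* The sign at [g] lies between the signs at [g'] shifted by [-t] and [t], so a
   flipped sign is charged to the bracketing sum. *)
Lemma sign_correlation_perturb :
  0 <= lam -> 0 <= t ->
  (forall i, `|dotv (a i) (g - g')| <= t) ->
  lam * \sum_i `|dotv (a i) (v - v')| <= m%:R * e ->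
  lam * \sum_i (sign_bit (dotv (a i) g' + xi i + t + tau i) -
                sign_bit (dotv (a i) g' + xi i - t + tau i)) / 2 *
               `|dotv (a i) v'| <= m%:R * (2 * e) ->
  `|lam * \sum_i sign_bit (dotv (a i) g' + xi i + tau i) * dotv (a i) v' -
    m%:R * dotv g' v'| <= m%:R * (2 * e) ->
  `|dotv g' v' - dotv g v| <= e ->
  `|lam * \sum_i sign_bit (dotv (a i) g + xi i + tau i) * dotv (a i) v -
    m%:R * dotv g v| <= m%:R * (8 * e).
Proof.
move=> lam0 t0 gt ve flip conc gv.
pose y i := sign_bit (dotv (a i) g + xi i + tau i).
pose y' i := sign_bit (dotv (a i) g' + xi i + tau i).
pose q i := (sign_bit (dotv (a i) g' + xi i + t + tau i) -
  sign_bit (dotv (a i) g' + xi i - t + tau i)) / 2.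
have yq i : `|y i - y' i| <= 2 * q i.
  have := gt i; rewrite dotvBr ler_norml => /andP[h1 h2].
  have l1 : sign_bit (dotv (a i) g' + xi i - t + tau i) <= y i by apply: sign_bit_le; lra.
  have l2 : y i <= sign_bit (dotv (a i) g' + xi i + t + tau i) by apply: sign_bit_le; lra.
  have l3 : sign_bit (dotv (a i) g' + xi i - t + tau i) <= y' i by apply: sign_bit_le; lra.
  have l4 : y' i <= sign_bit (dotv (a i) g' + xi i + t + tau i) by apply: sign_bit_le; lra.
  by rewrite ler_norml /q; apply/andP; split; lra.
have E1 : `|\sum_i y i * dotv (a i) v - \sum_i y i * dotv (a i) v'| <=
    \sum_i `|dotv (a i) (v - v')|.
  rewrite -sumrB (le_trans (ler_norm_sum _ _ _))//; apply: ler_sum => i _.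
  by rewrite -mulrBr -dotvBr normrM sign_bit_abs mul1r.
have E2 : `|\sum_i y i * dotv (a i) v' - \sum_i y' i * dotv (a i) v'| <=
    2 * \sum_i q i * `|dotv (a i) v'|.
  rewrite -sumrB mulr_sumr (le_trans (ler_norm_sum _ _ _))//; apply: ler_sum => i _.
  by rewrite -mulrBl normrM mulrA ler_wpM2r.
have lamB A B C : `|A - B| <= C -> `|lam * A - lam * B| <= lam * C.
  by move=> h; rewrite -mulrBr normrM (ger0_norm lam0) ler_wpM2l.
have {}E1 := le_trans (lamB _ _ _ E1) ve.
have {}E2 := lamB _ _ _ E2.
have gv' : `|m%:R * dotv g' v' - m%:R * dotv g v| <= m%:R * e.
  by rewrite -mulrBr normrM ger0_norm// ler_wpM2l.
move: E1 E2 conc gv'; rewrite -/y !ler_norml.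
rewrite -[\sum_i sign_bit (dotv (a i) g + xi i + tau i) * dotv (a i) v]/(\sum_i y i * dotv (a i) v).
rewrite -[\sum_i sign_bit (dotv (a i) g' + xi i + tau i) * dotv (a i) v']/(\sum_i y' i * dotv (a i) v').
move: flip; rewrite -[X in lam * X <= _]/(\sum_i q i * `|dotv (a i) v'|).
move=> flip /andP[? ?] /andP[? ?] /andP[? ?] /andP[? ?].
(* The total 8 is 1 for replacing [v], 2 * 2 for the flipped signs, 2 for the concentration at the
   net points and 1 for the inner product. *)
by apply/andP; split; lra.
Qed.

End Perturbation.

(** * A grid in the unit ball *)

Section Net.
Context {R : realType}.
Variables (k N : nat).

(** Sign and magnitude are stored separately, so that truncation rounds towards zero and an
    approximation of a point of the unit ball stays in it. *)
Definition grid_point (f : {ffun 'I_k -> bool * 'I_N.+1}) : 'cV[R]_k :=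
  \col_j ((-1) ^+ (f j).1 * (f j).2%:R / N%:R).

Lemma card_grid : #|{ffun 'I_k -> bool * 'I_N.+1}| = ((2 * N.+1) ^ k)%N.
Proof. by rewrite card_ffun card_prod card_bool !card_ord. Qed.

Lemma grid_approx (w : 'cV[R]_k) : (0 < N)%N -> l2norm w <= 1 ->
  exists f, l2norm (w - grid_point f) <= k%:R / N%:R /\ l2norm (grid_point f) <= 1.
Proof.
move=> N0 w1; have NR : 0 < N%:R :> R by rewrite ltr0n.
have wj j : `|w j 0| <= 1.
  rewrite -(@expr_le1 _ 2)// real_normK ?num_real//.
  apply: le_trans (_ : l2norm w ^+ 2 <= _); last by rewrite expr_le1// l2norm_ge0.
  rewrite l2norm_sqr /dotv (bigD1 j)//= -expr2 lerDl.
  by apply: sumr_ge0 => i _; rewrite -expr2 sqr_ge0.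
pose u j : nat := Num.truncn (N%:R * `|w j 0|).
have u_itv j : (u j)%:R <= N%:R * `|w j 0| < (u j).+1%:R.
  by apply: truncn_itv; rewrite mulr_ge0.
have uN j : (u j < N.+1)%N.
  rewrite ltnS -(ler_nat R); have /andP[h _] := u_itv j.
  by apply: le_trans h _; rewrite ler_piMr// ltW.
pose f : {ffun 'I_k -> bool * 'I_N.+1} := [ffun j => (w j 0 < 0, Ordinal (uN j))].
have pE j : grid_point f j 0 = (-1) ^+ (w j 0 < 0)%R * (u j)%:R / N%:R.
  by rewrite mxE ffunE.
have p_abs j : `|grid_point f j 0| = (u j)%:R / N%:R.
  by rewrite pE !normrM normr_sign mul1r normfV !ger0_norm// ltW.
exists f; split.
  have -> : k%:R / N%:R = k%:R * N%:R^-1 :> R by [].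
  apply: l2norm_le_entries => [|j]; first by rewrite invr_ge0 ltW.
  have /andP[h1 h2] := u_itv j.
  rewrite !mxE -[in X in _ - X]/(f j) ffunE /=.
  have wE : w j 0 = (-1) ^+ (w j 0 < 0)%R * `|w j 0|.
    by rewrite [LHS]realEsign ?num_real.
  rewrite {1}wE -mulrA -mulrBr normrM normr_sign mul1r.
  have -> : `|w j 0| - (u j)%:R / N%:R = (N%:R * `|w j 0| - (u j)%:R) / N%:R.
    by field; rewrite gt_eqF.
  rewrite normrM [X in _ * X]ger0_norm ?invr_ge0 ?(ltW NR)// -[leRHS]mul1r.
  rewrite ler_wpM2r ?invr_ge0 ?(ltW NR)// ger0_norm ?subr_ge0//.
  by move: h2; rewrite -natr1; lra.
apply: le_trans w1; apply: ler_wsqrtr; apply: ler_sum => j _; rewrite -!expr2.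
rewrite -[leLHS]real_normK ?num_real// -[leRHS]real_normK ?num_real//.
rewrite ler_sqr ?nnegrE// p_abs ler_pdivrMr// mulrC.
by have /andP[] := u_itv j.
Qed.

Lemma l2norm_le_l1 (x : 'cV[R]_k) : l2norm x <= \sum_j `|x j 0|.
Proof.
apply: l2norm_le_sqr; first exact: sumr_ge0.
rewrite l2norm_sqr /dotv expr2 mulr_suml; apply: ler_sum => i _.
rewrite -[X in X <= _]ger0_norm ?sqr_ge0 -?expr2 ?sqr_ge0// normrX expr2.
by rewrite ler_wpM2l// (bigD1 i)//= lerDl sumr_ge0.
Qed.

End Net.

(** * The union bound *)

Section UnionBound.
Context {R : realType} d (T : measurableType d) (P : probability T R).

Lemma union_bound (I : finType) (B : I -> set T) (p : R) :
  (forall i, measurable (B i)) -> (forall i, (P (B i) <= p%:E)%E) ->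
  (P (\bigcup_i B i) <= (#|I|%:R * p)%:E)%E.
Proof.
move=> mB Bp.
have -> : \bigcup_i B i = \big[setU/set0]_(i <- enum I) B i.
  rewrite -bigcup_seq; apply/seteqP; split => x [i _ Bx]; exists i => //=.
  exact: mem_enum.
rewrite cardE; elim: (enum I) => [|i s IH]; first by rewrite big_nil measure0 mul0r.
have mbig : measurable (\big[setU/set0]_(j <- s) B j) by exact: bigsetU_measurable.
rewrite big_cons (le_trans (measureU2 _ (mB i) mbig))//=.
by rewrite -natr1 mulrDl mul1r addrC EFinD leeD.
Qed.

End UnionBound.

(** * Numerical consequences of the conditions on [lambda] and [m] *)

Section Budget.
Context {R : realType}.
Implicit Types (C eps lam L Rad u : R).

Lemma ln_ge1 C eps : 1 <= C -> 0 < eps -> eps <= 1 -> 1 <= ln (64 * C * eps^-1).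
Proof.
move=> C1 e0 e1; have X0 : 0 < 64 * C * eps^-1.
  by rewrite !mulr_gt0 ?invr_gt0//; lra.
rewrite -ler_expR lnK ?posrE//; apply: le_trans expR1_le4 _.
have : 1 <= eps^-1 by rewrite invf_ge1.
have C0 : 0 <= C by lra.
by move=> h; have := ler_wpM2l C0 h; lra.
Qed.

Lemma lambda_ge C eps lam : 1 <= C -> 0 < eps -> eps <= 1 ->
  4 * C * ln (64 * C * eps^-1) <= lam -> 4 * C <= lam.
Proof.
move=> C1 e0 e1; apply: le_trans; rewrite ler_peMr ?ln_ge1//; lra.
Qed.

(** The threshold on [lam] makes the exponential at most [(64 C / eps)^-2]. The powers of [C] cancel
    and [eps^2 / 512] remains. *)
Lemma lambda_tail C eps lam : 1 <= C -> 0 < eps -> eps <= 1 ->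
  4 * C * ln (64 * C * eps^-1) <= lam ->
  32 * (C / 2) ^+ 2 * expR (- (lam / (4 * (C / 2)))) <= eps ^+ 2 / 4.
Proof.
move=> C1 e0 e1 lamC; set X := 64 * C * eps^-1 in lamC.
have X0 : 0 < X by rewrite !mulr_gt0 ?invr_gt0//; lra.
have C0 : 0 < C by lra.
have h : expR (- (lam / (4 * (C / 2)))) <= X ^- 2.
  apply: (@le_trans _ _ (expR (- (2 * ln X)))).
    rewrite ler_expR lerN2 ler_pdivlMr; last by rewrite !mulr_gt0.
    by apply: le_trans lamC; rewrite le_eqVlt; apply/orP; left; apply/eqP; field.
  by rewrite expRN lef_pV2 ?posrE ?expR_gt0 ?exprn_gt0// expRM_natl lnK ?posrE.
apply: (@le_trans _ _ (32 * (C / 2) ^+ 2 * X ^- 2)).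
  by rewrite ler_wpM2l// mulr_ge0 ?sqr_ge0.
have -> : 32 * (C / 2) ^+ 2 * X ^- 2 = eps ^+ 2 / 512.
  by rewrite /X; field; rewrite !gt_eqF.
rewrite ler_wpM2l ?sqr_ge0// lef_pV2 ?posrE//; lra.
Qed.

(* Large enough that discretization costs at most [eps] even after the factor
   [m * D * lam], while the logarithm of the size of the net stays within the
   budget for [m]. *)
Definition net_size (m D r n : nat) : nat := (4 * m ^ 4 * D * r * 2 ^ n)%N.

Lemma net_size_le (m D r n : nat) Rad : (0 < m)%N -> (0 < D)%N -> (0 < r)%N ->
  0 < Rad -> r%:R <= 2 * Rad ->
  (2 * (net_size m D r n).+1)%:R <=
  expR (4 + 4 * ln m%:R + ln D%:R + ln (2 * Rad) + n%:R) :> R.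
Proof.
move=> m0 D0 r0 Rad0 rRad.
have N0 : (0 < net_size m D r n)%N by rewrite /net_size !muln_gt0 !expn_gt0 m0 D0 r0.
apply: (@le_trans _ _ (4 * net_size m D r n)%:R).
  by rewrite ler_nat -[4%N]/(2 * 2)%N -mulnA leq_mul2l/= mulSn mul1n -addn1 leq_add2l.
have two_le : 2 <= expR 1 :> R by have := @expR_ge1Dx R 1; lra.
have m0' : 0 < m%:R :> R by rewrite ltr0n.
have D0' : 0 < D%:R :> R by rewrite ltr0n.
rewrite 4!expRD lnK ?posrE// lnK ?posrE ?mulr_gt0//.
have -> : expR (4 * ln m%:R) = m%:R ^+ 4 :> R by rewrite expRM_natl lnK ?posrE.
have e4 : 16 <= expR 4 :> R.
  have -> : expR 4 = expR 1 ^+ 4 :> R by rewrite -expRM_natl mulr1.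
  rewrite (_ : 16 = 2 ^+ 4); last by ring.
  by rewrite lerXn2r ?nnegrE ?expR_ge0.
have en : 2 ^+ n <= expR n%:R :> R.
  have -> : expR n%:R = expR 1 ^+ n :> R by rewrite -expRM_natl mulr1.
  by rewrite lerXn2r ?nnegrE ?expR_ge0.
have -> : (4 * net_size m D r n)%:R = 16 * (m%:R ^+ 4) * D%:R * r%:R * 2 ^+ n :> R.
  by rewrite /net_size !natrM !natrX; ring.
have mm : 0 <= m%:R ^+ 4 :> R by rewrite exprn_ge0.
have D00 := ltW D0'.
have p1 : 0 <= 16 * m%:R ^+ 4 * D%:R :> R by rewrite mulr_ge0// mulr_ge0.
have h3 : 16 * m%:R ^+ 4 * D%:R <= expR 4 * m%:R ^+ 4 * D%:R :> R.
  by rewrite ler_wpM2r// ler_wpM2r.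
have h4 := ler_pM p1 (ler0n R r) h3 rRad.
exact: (ler_pM (mulr_ge0 p1 (ler0n R r)) (exprn_ge0 n (ler0n R 2)) h4 en).
Qed.

(** Each pair of net points carries three events, two sides of a correlation and one flip sum, and
    each coordinate carries one. The logarithm of their number is at most [23 * B0], so an exponent
    of [24 * (B0 + u)] leaves at least [u]. *)
Lemma net_budget (k n D m r : nat) Rad u lam L eps : (0 < k)%N -> (1 < n)%N ->
  (0 < D)%N -> (0 < m)%N -> (0 < r)%N -> 1 <= Rad -> r%:R <= 2 * Rad ->
  1 <= L -> 0 < lam -> 0 < eps -> 0 <= u ->
  272 * 24 * lam ^+ 2 * L ^+ 2 *
    (k%:R * n%:R * ln (expR 1 * D%:R) + k%:R * ln (2 * Rad) + k%:R * ln m%:R + u)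
    / eps ^+ 2 <= m%:R ->
  (3 * ((2 * (net_size m D r n).+1) ^ k)%:R ^+ 2 + D%:R) *
    expR (- (m%:R * eps ^+ 2 / (272 * lam ^+ 2 * L))) <= expR (- u).
Proof.
move=> k0 n1 D0 m0 r0 Rad1 rRad L1 lam0 eps0 u0.
have D0' : 0 < D%:R :> R by rewrite ltr0n.
rewrite lnM ?posrE ?expR_gt0// expRK.
set B0 := k%:R * n%:R * (1 + ln D%:R) + k%:R * ln (2 * Rad) + k%:R * ln m%:R.
have lnD : 0 <= ln D%:R :> R by rewrite ln_ge0// ler1n.
have lnm : 0 <= ln m%:R :> R by rewrite ln_ge0// ler1n.
have lnR : 0 <= ln (2 * Rad) by rewrite ln_ge0//; lra.
have k1 : 1 <= k%:R :> R by rewrite ler1n.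
have n2 : 2 <= n%:R :> R by rewrite ler_nat.
have kn : 2 <= k%:R * n%:R :> R by nra.
have knD : ln D%:R <= k%:R * n%:R * ln D%:R :> R by rewrite ler_peMl//; lra.
have kD : 2 * (k%:R * ln D%:R) <= k%:R * n%:R * ln D%:R :> R.
  rewrite mulrA ler_wpM2r// mulrC ler_wpM2l//; lra.
have kR0 : 0 <= k%:R * ln (2 * Rad) by rewrite mulr_ge0.
have km0 : 0 <= k%:R * ln m%:R :> R by rewrite mulr_ge0.
have B00 : 0 <= B0 by rewrite /B0; lra.
rewrite ler_pdivrMr ?exprn_gt0// => hm.
have L0 : 0 < L by lra.
have den0 : 0 < 272 * lam ^+ 2 * L by rewrite !mulr_gt0 ?exprn_gt0.
have h1 : 24 * (B0 + u) <= m%:R * eps ^+ 2 / (272 * lam ^+ 2 * L).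
  rewrite ler_pdivlMr//; apply: le_trans hm.
  have -> : 272 * 24 * lam ^+ 2 * L ^+ 2 * (B0 + u) =
    24 * (B0 + u) * (272 * lam ^+ 2 * L) * L by ring.
  apply: ler_peMr => //; apply: mulr_ge0; last exact: ltW.
  by apply: mulr_ge0 => //; exact: addr_ge0.
set x := m%:R * eps ^+ 2 / _ in h1 *.
set M : R := ((2 * (net_size m D r n).+1) ^ k)%:R.
have M1 : 1 <= M by rewrite ler1n expn_gt0.
have MB : M ^+ 2 <= expR (2 * k%:R * (4 + 4 * ln m%:R + ln D%:R + ln (2 * Rad) + n%:R)).
  set E := 4 + _ + _ + _ + _.
  have -> : 2 * k%:R * E = k%:R * (2%:R * E) by ring.
  rewrite expRM_natl expRM_natl -exprM mulnC exprM lerXn2r ?nnegrE ?exprn_ge0 ?expR_ge0//.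
  rewrite /M natrX lerXn2r ?nnegrE ?expR_ge0//.
  by apply: net_size_le => //; lra.
have MD : 3 * M ^+ 2 + D%:R <= 4 * M ^+ 2 * D%:R.
  have D1 : 1 <= D%:R :> R by rewrite ler1n.
  have M2 : 1 <= M ^+ 2 by rewrite expr_ge1.
  nra.
have four_le : 4 <= expR 2 :> R.
  have -> : expR 2 = expR 1 ^+ 2 :> R by rewrite -expRM_natl mulr1.
  have := @expR_ge1Dx R 1; nra.
apply: (@le_trans _ _ (expR 2 * expR (2 * k%:R * (4 + 4 * ln m%:R + ln D%:R + ln (2 * Rad) + n%:R))
   * expR (ln D%:R) * expR (- x))).
  rewrite ler_wpM2r ?expR_ge0// (le_trans MD)// lnK ?posrE// ler_wpM2r//.
  by rewrite ler_pM// sqr_ge0.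
rewrite -!expRD ler_expR.
suff : 2 + 2 * k%:R * (4 + 4 * ln m%:R + ln D%:R + ln (2 * Rad) + n%:R) + ln D%:R <= 23 * B0.
  by lra.
have k2 : k%:R * 2 <= k%:R * n%:R :> R by rewrite ler_wpM2l.
rewrite /B0; lra.
Qed.

End Budget.

(** * Real powers with half-integer exponents *)

Section RealPowers.
Context {R : realType}.
Implicit Types (q x : R) (n : nat).

Lemma powR_exprn q r n : 0 <= q -> (q `^ r) ^+ n = q `^ (r * n%:R).
Proof. by move=> q0; rewrite powRrM powR_mulrn// powR_ge0. Qed.

Lemma powR_half_sqr q n : 0 <= q -> (q `^ (n%:R / 2)) ^+ 2 = q ^+ n.
Proof. by move=> q0; rewrite powR_exprn// divfK// powR_mulrn. Qed.

Lemma powRN_half_sqr q n : 0 <= q -> (q `^ (- (n%:R / 2))) ^+ 2 = (q ^+ n)^-1.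
Proof. by move=> q0; rewrite powRN exprVn powR_half_sqr. Qed.

Lemma powR_half_sqrt n : 2 `^ (n%:R / 2) = Num.sqrt 2 ^+ n :> R.
Proof.
apply/eqP; rewrite -(@eqrXn2 _ 2) ?powR_ge0 ?exprn_ge0 ?sqrtr_ge0//.
by rewrite powR_half_sqr// -exprM mulnC exprM sqr_sqrtr.
Qed.

End RealPowers.

(** * Uniform correlation over the range of the network *)

Section UniformCorrelation.
Context {R : realType}.
Variables (dims : nat -> nat) (W : forall i, 'M[R]_(dims i.+1, dims i)).
Variables (n m : nat) (eps Rad C lam u : R).
Context disp (T : measurableType disp) (P : probability T R).
Variables (a : {RV P >-> (dims n).-tuple R}) (xi tau : {RV P >-> R}).
Variables (a_ : 'I_m -> {RV P >-> (dims n).-tuple R}).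
Variables (xi_ tau_ : 'I_m -> {RV P >-> R}).

Local Notation k := (dims 0).
Local Notation D := (dims n).
Local Notation G := (relu_net W n).
Let Tn : R := Num.sqrt 2 ^+ n.
(** Chosen so that [G] maps the ball of this radius into the ball of radius [Rad], on which
    [<a, G x0>] has exponential moments at scale [C / 2]. *)
Let rho0 : R := Rad * (2^-1 + eps) `^ (- (n%:R / 2)).
Let L : R := ln (lam * m%:R).

Hypothesis k_gt0 : (0 < k)%N.
Hypothesis n_gt1 : (1 < n)%N.
Hypothesis D_gt0 : (0 < D)%N.
Hypothesis m_gt0 : (0 < m)%N.
Hypothesis eps_gt0 : 0 < eps.
Hypothesis eps_le1 : eps <= 1.
Hypothesis neps : (1 + 2 * eps) ^+ n <= 4.
Hypothesis wdc : forall i, (i < n)%N -> WDC eps (W i).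
Hypothesis Rad_ge1 : 1 <= Rad.
Hypothesis u_ge0 : 0 <= u.
Hypothesis C_ge1 : 1 <= C.
Hypothesis psi1_a : (psi1_vec P a <= (C / (16 * Rad))%:E)%E.
Hypothesis psi1_xi : (psi1 P xi <= (C / 16)%:E)%E.
Hypothesis mean0 : mean_zero P a.
Hypothesis iso : isotropic P a.
Hypothesis tau_unif : uniform_on P (- lam) lam tau.
Hypothesis ind : independent3 P a xi tau.
Hypothesis indepZ : mutually_independent P (fun i w => (a_ i w, xi_ i w, tau_ i w)).
Hypothesis lawZ : forall i, same_law P (fun w => (a_ i w, xi_ i w, tau_ i w))
                                       (fun w => (a w, xi w, tau w)).
Hypothesis lam_C : 4 * C * ln (64 * C * eps^-1) <= lam.
Hypothesis budget : 272 * 24 * lam ^+ 2 * L ^+ 2 *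
    (k%:R * n%:R * ln (expR 1 * D%:R) + k%:R * ln (2 * Rad) + k%:R * ln m%:R + u)
    / eps ^+ 2 <= m%:R.

Let Rad_gt0 : 0 < Rad. Proof. exact: lt_le_trans Rad_ge1. Qed.
Let C_gt0 : 0 < C. Proof. exact: lt_le_trans C_ge1. Qed.
Let lam_ge4 : 4 * C <= lam. Proof. exact: lambda_ge lam_C. Qed.
Let lam_ge1 : 1 <= lam. Proof. by have := lam_ge4; have := C_ge1; lra. Qed.
Let lam_gt0 : 0 < lam. Proof. exact: lt_le_trans lam_ge1. Qed.
Let mR_ge1 : 1 <= m%:R :> R. Proof. by rewrite ler1n. Qed.
Let mR_gt0 : 0 < m%:R :> R. Proof. by rewrite ltr0n. Qed.
Let lamm_gt0 : 0 < lam * m%:R. Proof. exact: mulr_gt0. Qed.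

Let L_ge1 : 1 <= L.
Proof.
rewrite -ler_expR lnK ?posrE//; apply: le_trans expR1_le4 _.
have h := ler_wpM2l (ltW lam_gt0) mR_ge1.
by have := lam_ge4; have := C_ge1; lra.
Qed.

Let lam_leL : lam <= expR L.
Proof. by rewrite lnK ?posrE// ler_peMr// ltW. Qed.

Let Tn_gt0 : 0 < Tn. Proof. by rewrite exprn_gt0// sqrtr_gt0. Qed.
Let Tn_sqr : Tn ^+ 2 = 2 ^+ n.
Proof. by rewrite /Tn -exprM mulnC exprM sqr_sqrtr. Qed.

Let half_gt0 : 0 < 2^-1 + eps. Proof. by rewrite addr_gt0. Qed.
Let rho0_gt0 : 0 < rho0. Proof. by rewrite mulr_gt0// powR_gt0. Qed.

Let rho0_sqr : rho0 ^+ 2 = Rad ^+ 2 / (2^-1 + eps) ^+ n.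
Proof. by rewrite exprMn powRN_half_sqr// ltW. Qed.

Let half_expr : (2^-1 + eps) ^+ n = (1 + 2 * eps) ^+ n / Tn ^+ 2.
Proof. by rewrite Tn_sqr -expr_div_n; congr (_ ^+ _); field. Qed.

Let rho0_le : rho0 <= Rad * Tn.
Proof.
rewrite -ler_sqr ?nnegrE ?(ltW rho0_gt0) ?mulr_ge0 ?(ltW Rad_gt0) ?(ltW Tn_gt0)//.
rewrite rho0_sqr exprMn ler_wpM2l ?sqr_ge0// Tn_sqr -[leRHS]invrK.
rewrite lef_pV2 ?posrE ?invr_gt0 ?exprn_gt0// -exprVn.
by rewrite lerXn2r ?nnegrE ?invr_ge0 ?(ltW half_gt0)// lerDl ltW.
Qed.

Let G_le x : l2norm (G x) <= 2 / Tn * l2norm x.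
Proof.
apply: l2norm_le_sqr; first by rewrite !mulr_ge0 ?invr_ge0 ?(ltW Tn_gt0) ?l2norm_ge0.
apply: le_trans (relu_net_norm_le (ltW eps_gt0) x wdc) _.
rewrite half_expr exprMn ler_wpM2r ?sqr_ge0// expr_div_n ler_wpM2r ?invr_ge0 ?sqr_ge0//.
by apply: le_trans neps _; rewrite expr2; lra.
Qed.

Let G_ball x : l2norm x <= rho0 -> l2norm (G x) <= Rad.
Proof.
move=> xr; apply: l2norm_le_sqr; first exact: ltW.
apply: le_trans (relu_net_norm_le (ltW eps_gt0) x wdc) _.
apply: (@le_trans _ _ ((2^-1 + eps) ^+ n * rho0 ^+ 2)).
  by rewrite ler_wpM2l ?exprn_ge0 ?(ltW half_gt0)// ler_sqr ?nnegrE ?l2norm_ge0 ?(ltW rho0_gt0).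
by rewrite rho0_sqr mulrC divfK// gt_eqF// exprn_gt0.
Qed.

Let G_lip x z : l2norm (G x - G z) <= 2 * l2norm (x - z).
Proof.
apply: l2norm_le_sqr; first by rewrite mulr_ge0 ?l2norm_ge0.
apply: le_trans (relu_net_lipschitz (ltW eps_gt0) x z wdc) _.
by rewrite exprMn ler_wpM2r ?sqr_ge0//; apply: le_trans neps _; rewrite expr2; lra.
Qed.

Let r : nat := (Num.truncn Rad).+1.
Let N : nat := net_size m D r n.

Let r_itv : Rad <= r%:R <= 2 * Rad.
Proof.
have /andP[h1 h2] := truncn_itv (ltW Rad_gt0).
rewrite (ltW h2)/= /r -natr1; have := Rad_ge1; lra.
Qed.

Let N_gt0 : (0 < N)%N.
Proof. by rewrite /N /net_size !muln_gt0 !expn_gt0 m_gt0 D_gt0. Qed.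

(** The mesh [k / N] at the scale [Rad * Tn], which dominates [rho0]. It controls the discretization
    of both [G x0] and the normalized [G x]. *)
Let kap : R := Rad * Tn * k%:R / N%:R.

Let kap_ge0 : 0 <= kap.
Proof. by rewrite !mulr_ge0 ?invr_ge0 ?(ltW Rad_gt0) ?(ltW Tn_gt0). Qed.

(** With these facts the power [m^4] in the net size absorbs [lam], [k], [1 / eps] and the factor
    [m] from the sum over samples. *)
Let budget_facts : [/\ lam <= m%:R, k%:R <= m%:R :> R & 1 <= eps * m%:R].
Proof.
have lnD : 0 <= ln D%:R :> R by rewrite ln_ge0// ler1n.
have D0' : 0 < D%:R :> R by rewrite ltr0n.
have lnm : 0 <= ln m%:R :> R by rewrite ln_ge0.
have lnR : 0 <= ln (2 * Rad) by rewrite ln_ge0//; have := Rad_ge1; lra.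
have k1 : 1 <= k%:R :> R by rewrite ler1n.
have n2 : 2 <= n%:R :> R by rewrite ler_nat.
have kB : k%:R <= k%:R * n%:R * ln (expR 1 * D%:R) + k%:R * ln (2 * Rad)
    + k%:R * ln m%:R + u.
  rewrite lnM ?posrE ?expR_gt0// expRK.
  have k0 : 0 <= k%:R :> R by [].
  have h1 := mulr_ge0 k0 lnR; have h2 := mulr_ge0 k0 lnm.
  have h3 : k%:R * 1 <= k%:R * (n%:R * (1 + ln D%:R)) :> R.
    by apply: (ler_wpM2l k0); nra.
  by have := u_ge0; rewrite -mulrA; lra.
set B := _ + u in kB.
move: budget; rewrite -/B ler_pdivrMr ?exprn_gt0// => hm.
have L2 : 1 <= L ^+ 2 by exact: exprn_ege1.
have lam2 : lam <= lam ^+ 2 by rewrite expr2 ler_peMr// ltW.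
have e2 : eps ^+ 2 <= eps by rewrite expr2 ler_piMr// ltW.
have e21 : eps ^+ 2 <= 1 by rewrite expr_le1// ltW.
have LB : k%:R <= L ^+ 2 * B.
  apply: (le_trans kB); rewrite ler_peMl//; apply: le_trans kB; exact: le_trans k1.
have h0 : lam * k%:R <= m%:R * eps ^+ 2.
  apply: le_trans hm; apply: (@le_trans _ _ (lam ^+ 2 * (L ^+ 2 * B))).
    by rewrite ler_pM// ltW.
  have LB0 : 0 <= lam ^+ 2 * (L ^+ 2 * B).
    by rewrite mulr_ge0 ?sqr_ge0//; apply: le_trans LB.
  have -> : 272 * 24 * lam ^+ 2 * L ^+ 2 * B = 272 * 24 * (lam ^+ 2 * (L ^+ 2 * B)) by ring.
  by rewrite ler_peMl//; lra.
have m0 : 0 <= m%:R :> R by [].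
have h1 : m%:R * eps ^+ 2 <= m%:R * 1 by rewrite ler_wpM2l.
have h2 : m%:R * eps ^+ 2 <= m%:R * eps by rewrite ler_wpM2l.
have h3 : lam * 1 <= lam * k%:R by rewrite ler_wpM2l// ltW.
have h4 : 1 * k%:R <= lam * k%:R by rewrite ler_wpM2r.
by have := lam_ge1; split; lra.
Qed.

Let kap_small : 4 * m%:R * D%:R * lam * kap <= eps.
Proof.
have [lamm km em] := budget_facts; have /andP[Rr _] := r_itv.
have NE : N%:R = 4 * m%:R ^+ 4 * D%:R * r%:R * 2 ^+ n :> R.
  by rewrite /N /net_size !natrM !natrX.
have NR : 0 < N%:R :> R by rewrite ltr0n.
have Tn2 : Tn <= 2 ^+ n.
  rewrite /Tn lerXn2r ?nnegrE ?sqrtr_ge0// -[leRHS]ger0_norm// -sqrtr_sqr ler_wsqrtr//.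
  by rewrite expr2; lra.
rewrite /kap mulrA ler_pdivrMr// NE.
have Tn0 := ltW Tn_gt0; have Rad0 := ltW Rad_gt0; have lam0 := ltW lam_gt0.
have h1 : Rad * Tn <= r%:R * 2 ^+ n by rewrite ler_pM.
have h2 : lam * k%:R <= m%:R * m%:R by rewrite ler_pM.
have h3 : (Rad * Tn) * (lam * k%:R) <= (r%:R * 2 ^+ n) * (m%:R * m%:R).
  by rewrite ler_pM// mulr_ge0.
have h4 : 1 * ((r%:R * 2 ^+ n) * (m%:R * m%:R)) <= (eps * m%:R) * ((r%:R * 2 ^+ n) * (m%:R * m%:R)).
  by rewrite ler_wpM2r// mulr_ge0// mulr_ge0.
have c0 : 0 <= 4 * m%:R * D%:R :> R by rewrite mulr_ge0// mulr_ge0.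
rewrite mul1r in h4; have := ler_wpM2l c0 (le_trans h3 h4).
have -> : 4 * m%:R * D%:R * (Rad * Tn * (lam * k%:R)) =
  4 * m%:R * D%:R * lam * (Rad * Tn * k%:R) by ring.
move=> h; apply: le_trans h _; rewrite le_eqVlt; apply/orP; left; apply/eqP; ring.
Qed.

Local Notation data_a i w := (cV_of_tuple (a_ i w)).
Local Notation netI := {ffun 'I_k -> bool * 'I_N.+1}.

(* Grid points outside the unit ball are sent to [0], so that every index
   denotes a point of the ball. *)
Let pt (f : netI) : 'cV[R]_k :=
  if l2norm ((grid_point f : 'cV[R]_k)) <= 1 then (grid_point f : 'cV[R]_k) else 0.
Let gN f := G (rho0 *: pt f).
(* [G] is positively homogeneous and has norm at most [2 / Tn] on the unit ball. *)
Let vN f := (Tn / 2) *: G (pt f).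
(** The margin for sign flips: a sample has length at most [2 m D] on the good event, and [G x0]
    lies within [2 * kap] of its net point. *)
Let gam := 4 * m%:R * D%:R * kap.

Let pt_le1 f : l2norm (pt f) <= 1.
Proof. by rewrite /pt; case: ifP => // _; rewrite l2norm0. Qed.

Let gN_le f : l2norm (gN f) <= Rad.
Proof.
by apply: G_ball; rewrite l2normZ (gtr0_norm rho0_gt0) ler_piMr ?pt_le1// ltW.
Qed.

Let vN_le f : l2norm (vN f) <= 1.
Proof.
have T20 : 0 < Tn / 2 by rewrite divr_gt0.
rewrite l2normZ gtr0_norm//; apply: le_trans (ler_wpM2l (ltW T20) (G_le (pt f))) _.
have -> : Tn / 2 * (2 / Tn * l2norm (pt f)) = l2norm (pt f) by field; rewrite gt_eqF.
exact: pt_le1.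
Qed.

Let gam_ge0 : 0 <= gam.
Proof. by apply: mulr_ge0 => //; rewrite mulr_ge0// mulr_ge0. Qed.

Let gam_le : gam <= eps.
Proof.
by apply: le_trans kap_small; rewrite /gam ler_wpM2r// ler_peMr.
Qed.

Let K_gt0 : 0 < C / (16 * Rad). Proof. by rewrite divr_gt0// mulr_gt0. Qed.

Let K_le : 8 * (C / (16 * Rad)) <= lam.
Proof.
have -> : 8 * (C / (16 * Rad)) = C / 2 / Rad by field; rewrite gt_eqF.
rewrite ler_pdivrMr//; apply: (@le_trans _ _ (lam * 1)); last by rewrite ler_wpM2l// ltW.
by have := lam_ge4; have := C_gt0; lra.
Qed.

Let g_exp f : (\int[P]_w (expR (`|lin (gN f) (a w)| / (C / 2)))%:E <= 2%:E)%E.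
Proof.
have v1 : l2norm (Rad^-1 *: gN f) <= 1.
  by rewrite l2normZ gtr0_norm ?invr_gt0// mulrC ler_pdivrMr// mul1r.
have Kc : 8 * (C / (16 * Rad)) <= C / 2 / Rad.
  by rewrite le_eqVlt; apply/orP; left; apply/eqP; field; rewrite gt_eqF.
apply: le_trans (lin_exp_le K_gt0 psi1_a v1 Kc).
rewrite le_eqVlt; apply/orP; left; apply/eqP; apply: eq_integral => w _.
congr (expR _)%:E; rewrite /lin dotvZr normrM gtr0_norm ?invr_gt0//.
by field; rewrite !gt_eqF.
Qed.

Let signed (b : bool) (v : 'cV[R]_D) := if b then v else - v.

Let signed_le b f : l2norm (signed b (vN f)) <= 1.
Proof. by case: b; rewrite /signed ?l2normN vN_le. Qed.

Local Notation badI := ((netI * netI * option bool) + 'I_D)%type.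
Local Notation delta := (expR (- (m%:R * eps ^+ 2 / (272 * lam ^+ 2 * L)))).

(* [Some b] : a correlation between two net points deviates, on the side given
   by [b]; [None] : too many signs can flip within the margin [gam]; [inr j] :
   the [j]-th coordinates of the data are too large. *)
Let bad (j : badI) : set T :=
  match j with
  | inl (f1, f2, Some b) => [set w | m%:R * (dotv (gN f1) (signed b (vN f2)) + eps + eps) <=
      \sum_i lam * sign_bit (lin (gN f1) (a_ i w) + xi_ i w + tau_ i w) *
        lin (signed b (vN f2)) (a_ i w)]
  | inl (f1, f2, None) => [set w | m%:R * (gam + eps) <= \sum_i lam *
      ((sign_bit (lin (gN f1) (a_ i w) + xi_ i w + gam + tau_ i w) -
        sign_bit (lin (gN f1) (a_ i w) + xi_ i w - gam + tau_ i w)) / 2 *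
       `|lin (vN f2) (a_ i w)|)]
  | inr j => [set w | m%:R * (lam + eps) <=
      \sum_i lam * `|lin (delta_mx j ord0) (a_ i w)|]
  end.

Let mlin_a v i : measurable_fun setT (fun w => lin v (a_ i w)).
Proof. by apply: measurableT_comp => //; exact: measurable_lin. Qed.

Let msign_a g s i : measurable_fun setT
  (fun w => sign_bit (lin g (a_ i w) + xi_ i w + s + tau_ i w)).
Proof.
apply: measurableT_comp; first exact: measurable_sign_bit.
by apply: measurable_funD => //; apply: measurable_funD => //; exact: measurable_funD.
Qed.

Let measurable_bad j : measurable (bad j).
Proof.
case: j => [[[f1 f2] [b|]]|j]; apply: measurable_ge; apply: measurable_sum => i.
- apply: measurable_funM => //; apply: measurable_funM => //.
  apply: measurableT_comp; first exact: measurable_sign_bit.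
  by apply: measurable_funD => //; exact: measurable_funD.
- apply: measurable_funM => //; apply: measurable_funM.
    by apply: measurable_funM => //; exact: measurable_funB.
  exact: measurableT_comp.
- by apply: measurable_funM => //; exact: measurableT_comp.
Qed.

Let P_bad j : (P (bad j) <= delta%:E)%E.
Proof.
have e01 : 0 < eps <= 1 by rewrite eps_gt0.
have c0 : 0 < C / 2 by rewrite divr_gt0.
have xic : (psi1 P xi <= (C / 2 / 8)%:E)%E.
  by rewrite (_ : C / 2 / 8 = C / 16)//; field.
have small := lambda_tail C_ge1 eps_gt0 eps_le1 lam_C.
case: j => [[[f1 f2] [b|]]|j].
- exact: (sign_correlation_bound lam_ge1 L_ge1 lam_leL K_gt0 K_le e01 tau_unif psi1_a
    mean0 iso ind indepZ lawZ c0 xic (g_exp f1) (signed_le b f2) small).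
- exact: (sign_flip_bound lam_ge1 L_ge1 lam_leL K_gt0 K_le e01 tau_unif psi1_a
    iso ind indepZ lawZ (gN f1) gam_ge0 (vN_le f2)).
- apply: (abs_lin_bound lam_ge1 L_ge1 lam_leL K_gt0 K_le e01 psi1_a iso indepZ lawZ).
  by rewrite l2norm_delta.
Qed.

Let good : set T := ~` \bigcup_j bad j.

Let measurable_good : measurable good.
Proof. by apply: measurableC; apply: fin_bigcup_measurable. Qed.

Let P_good : ((1 - expR (- u))%:E <= P good)%E.
Proof.
have /andP[_ r2] := r_itv.
have card : #|{: badI}|%:R = 3 * ((2 * N.+1) ^ k)%:R ^+ 2 + D%:R :> R.
  rewrite card_sum !card_prod card_option card_bool card_ord card_grid natrD !natrM; ring.
have := union_bound measurable_bad P_bad.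
rewrite card => h.
have := net_budget k_gt0 n_gt1 D_gt0 m_gt0 (ltn0Sn _) Rad_ge1 r2 L_ge1 lam_gt0 eps_gt0
  u_ge0 budget.
rewrite -lee_fin => /(le_trans h) {}h.
rewrite probability_setC; last exact: fin_bigcup_measurable.
by rewrite EFinB leeB.
Qed.

Let good_not_bad w j : good w -> ~ bad j w.
Proof. by move=> gw bw; apply: gw; exists j. Qed.

Let good_correlation w f1 f2 : good w ->
  `|lam * \sum_i sign_bit (dotv (data_a i w) (gN f1) + xi_ i w + tau_ i w) *
      dotv (data_a i w) (vN f2) - m%:R * dotv (gN f1) (vN f2)| <= m%:R * (2 * eps).
Proof.
move=> gw; have := @good_not_bad w (inl (f1, f2, Some true)) gw.
have := @good_not_bad w (inl (f1, f2, Some false)) gw.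
rewrite /bad /= => /negP; rewrite -ltNge => h1 /negP; rewrite -ltNge => h2.
set S := \sum_i _ * dotv _ _.
have E1 : \sum_i lam * sign_bit (lin (gN f1) (a_ i w) + xi_ i w + tau_ i w) *
    lin (vN f2) (a_ i w) = lam * S.
  by rewrite mulr_sumr; apply: eq_bigr => i _; rewrite -mulrA.
have E2 : \sum_i lam * sign_bit (lin (gN f1) (a_ i w) + xi_ i w + tau_ i w) *
    lin (- vN f2) (a_ i w) = - (lam * S).
  by rewrite -E1 -sumrN; apply: eq_bigr => i _; rewrite /lin dotvNr mulrN.
rewrite E2 dotvNr in h1; rewrite E1 in h2.
by rewrite ler_norml; apply/andP; split; lra.
Qed.

Let good_flip w f1 f2 : good w ->
  lam * \sum_i (sign_bit (dotv (data_a i w) (gN f1) + xi_ i w + gam + tau_ i w) -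
                sign_bit (dotv (data_a i w) (gN f1) + xi_ i w - gam + tau_ i w)) / 2 *
               `|dotv (data_a i w) (vN f2)| <= m%:R * (2 * eps).
Proof.
move=> gw; have := @good_not_bad w (inl (f1, f2, None)) gw.
rewrite /bad /= => /negP; rewrite -ltNge => h1.
rewrite mulr_sumr (le_trans (ltW h1))// ler_wpM2l//.
by have := gam_le; lra.
Qed.

Let good_coord w j : good w -> \sum_i `|data_a i w j 0| <= 2 * m%:R.
Proof.
move=> gw; have := @good_not_bad w (inr j) gw.
rewrite /bad /= => /negP; rewrite -ltNge -mulr_sumr => h1.
have -> : \sum_i `|data_a i w j 0| = \sum_i `|lin (delta_mx j ord0) (a_ i w)|.
  apply: eq_bigr => i _; congr `|_|; rewrite /lin /dotv (bigD1 j)//= !mxE !eqxx mulr1.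
  by rewrite big1 ?addr0// => l lj; rewrite [X in _ * X]mxE (negbTE lj) mulr0.
rewrite -(@ler_pM2l _ lam)//; apply: le_trans (ltW h1) _.
have := ler_wpM2l (ltW mR_gt0) (le_trans eps_le1 lam_ge1).
lra.
Qed.

Let good_norm w : good w -> \sum_i l2norm (data_a i w) <= 2 * m%:R * D%:R.
Proof.
move=> gw; apply: (@le_trans _ _ (\sum_i \sum_j `|data_a i w j 0|)).
  by apply: ler_sum => i _; exact: l2norm_le_l1.
rewrite exchange_big /=; apply: (@le_trans _ _ (\sum_(j < D) 2 * m%:R)).
  by apply: ler_sum => j _; exact: good_coord.
by rewrite sumr_const card_ord -[leLHS]mulr_natr lexx.
Qed.

Let net_approx (x : 'cV[R]_k) : l2norm x <= 1 ->
  exists f, l2norm (x - pt f) <= k%:R / N%:R.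
Proof.
move=> x1; have [f [h1 h2]] := grid_approx N_gt0 x1.
by exists f; rewrite /pt h2.
Qed.

(** Positive homogeneity writes [G x] as [2 ||x|| / Tn] times a vector [v] of norm at most 1, and
    the error [8 * eps] for [v] becomes [16 * eps]. *)
Lemma uniform_correlation : with_prob_at_least P (1 - expR (- u))
  [set w | forall x0, l2norm x0 <= rho0 -> forall x,
    `|lam / m%:R * \sum_i sign_bit (dotv (data_a i w) (G x0) + xi_ i w + tau_ i w) *
        dotv (data_a i w) (G x) - dotv (G x0) (G x)| <=
    16 * eps * (l2norm x / Tn)].
Proof.
exists good => //; split; last exact: P_good.
move=> w gw x0 x0r x.
have [->|x_neq0] := eqVneq x 0.
  have G0 : G 0 = 0 by have := relu_netZ W n (0 : 'cV[R]_k) (lexx 0); rewrite !scale0r.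
  rewrite G0 dotv0r big1 ?mulr0 ?subrr ?normr0; last by move=> i _; rewrite dotv0r mulr0.
  by rewrite l2norm0 mul0r mulr0.
have nx : 0 < l2norm x by rewrite l2norm_gt0.
have kN0 : 0 <= k%:R / N%:R :> R by rewrite divr_ge0.
have [f1 hf1] : exists f, l2norm (rho0^-1 *: x0 - pt f) <= k%:R / N%:R.
  by apply: net_approx; rewrite l2normZ gtr0_norm ?invr_gt0// mulrC ler_pdivrMr// mul1r.
have x1 : l2norm (normalize x) = 1.
  by rewrite /normalize l2normZ gtr0_norm ?invr_gt0// mulVf// gt_eqF.
have [f2 hf2] : exists f, l2norm (normalize x - pt f) <= k%:R / N%:R.
  by apply: net_approx; rewrite x1.
pose v := (Tn / 2) *: G (normalize x).
have T20 : 0 < Tn / 2 by rewrite divr_gt0.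
have vle : l2norm v <= 1.
  rewrite l2normZ gtr0_norm//; apply: le_trans (ler_wpM2l (ltW T20) (G_le (normalize x))) _.
  rewrite x1; have -> : Tn / 2 * (2 / Tn * 1) = 1 by field; rewrite gt_eqF.
  by [].
have GxE : G x = (2 * (l2norm x / Tn)) *: v.
  rewrite /v scalerA {1}(l2norm_normalize x_neq0) relu_netZ ?l2norm_ge0//; congr (_ *: _).
  by field; rewrite gt_eqF.
have gg' : l2norm (G x0 - gN f1) <= 2 * kap.
  apply: le_trans (G_lip _ _) _; rewrite ler_wpM2l//.
  have -> : x0 - rho0 *: pt f1 = rho0 *: (rho0^-1 *: x0 - pt f1).
    by rewrite scalerBr scalerA mulfV ?scale1r// gt_eqF.
  rewrite l2normZ gtr0_norm// /kap -mulrA; apply: ler_pM => //; first exact: ltW.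
  exact: l2norm_ge0.
(* The factor [Rad] anticipates the inner product with [gN f1], whose norm is at most [Rad]. *)
have vv' : Rad * l2norm (v - vN f2) <= kap.
  rewrite /v /vN -scalerBr l2normZ gtr0_norm//.
  have h := ler_wpM2l (ler0n R 2) hf2.
  have := le_trans (G_lip (normalize x) (pt f2)) h => {}h.
  have c0 : 0 <= Rad * (Tn / 2) by rewrite mulr_ge0// ltW.
  rewrite mulrA; apply: le_trans (ler_wpM2l c0 h) _.
  by rewrite /kap le_eqVlt; apply/orP; left; apply/eqP; field; rewrite gt_eqF// ltr0n.
have vv'1 : l2norm (v - vN f2) <= kap.
  by apply: le_trans vv'; rewrite ler_peMl// l2norm_ge0.
have Sn := good_norm gw.
have D1 : 1 <= D%:R :> R by rewrite ler1n.
have pre0 : 0 <= m%:R * D%:R * lam by rewrite !mulr_ge0// ltW.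
have big1 : 1 <= m%:R * D%:R * lam.
  by rewrite -[leLHS]mulr1 ler_pM// -[leLHS]mulr1 ler_pM.
have kap4 : 4 * kap <= eps.
  apply: le_trans kap_small; have -> : 4 * m%:R * D%:R * lam * kap = 4 * (m%:R * D%:R * lam * kap) by ring.
  by rewrite ler_wpM2l// ler_peMl.
have main : `|lam * \sum_i sign_bit (dotv (data_a i w) (G x0) + xi_ i w + tau_ i w) *
    dotv (data_a i w) v - m%:R * dotv (G x0) v| <= m%:R * (8 * eps).
  apply: (sign_correlation_perturb (g' := gN f1) (v' := vN f2) (t := gam)) => //.
  - exact: ltW.
  - move=> i; apply: le_trans (cauchy_schwarz _ _) _.
    apply: (@le_trans _ _ (2 * m%:R * D%:R * (2 * kap))).
      apply: ler_pM; rewrite ?l2norm_ge0//; apply: le_trans Sn.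
      by rewrite (bigD1 i)//= lerDl sumr_ge0// => j _; rewrite l2norm_ge0.
    by rewrite /gam le_eqVlt; apply/orP; left; apply/eqP; ring.
  - apply: (@le_trans _ _ (lam * ((2 * m%:R * D%:R) * kap))).
      rewrite ler_wpM2l ?(ltW lam_gt0)//.
      apply: (@le_trans _ _ (\sum_i l2norm (data_a i w) * l2norm (v - vN f2))).
        by apply: ler_sum => i _; exact: cauchy_schwarz.
      by rewrite -mulr_suml ler_pM ?l2norm_ge0// sumr_ge0// => i _; exact: l2norm_ge0.
    apply: (@le_trans _ _ eps); last by rewrite ler_peMl// ltW.
    apply: le_trans kap_small.
    have := mulr_ge0 pre0 kap_ge0; lra.
  - exact: good_flip.
  - exact: good_correlation.
  - have -> : dotv (gN f1) (vN f2) - dotv (G x0) v =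
      - dotv (gN f1) (v - vN f2) - dotv (G x0 - gN f1) v.
      by rewrite dotvBr dotvBl; ring.
    rewrite (le_trans (ler_normB _ _))// normrN.
    have h1 : `|dotv (gN f1) (v - vN f2)| <= kap.
      apply: le_trans (cauchy_schwarz _ _) _; apply: le_trans vv'.
      by rewrite ler_wpM2r ?l2norm_ge0.
    have h2 : `|dotv (G x0 - gN f1) v| <= 2 * kap.
      apply: le_trans (cauchy_schwarz _ _) _; rewrite -[leRHS]mulr1.
      by rewrite ler_pM ?l2norm_ge0.
    by have := kap_ge0; lra.
set s := 2 * (l2norm x / Tn) in GxE.
have s0 : 0 <= s by rewrite mulr_ge0// divr_ge0// ltW.
rewrite GxE dotvZr.
under eq_bigr do rewrite dotvZr mulrCA.
rewrite -mulr_sumr.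
set S := \sum_i _ in main *.
have -> : lam / m%:R * (s * S) - s * dotv (G x0) v =
  s / m%:R * (lam * S - m%:R * dotv (G x0) v) by field; rewrite gt_eqF.
have sm0 : 0 <= s / m%:R by rewrite divr_ge0.
rewrite normrM (ger0_norm sm0); apply: le_trans (ler_wpM2l sm0 main) _.
rewrite le_eqVlt; apply/orP; left; apply/eqP; rewrite /s; field.
by rewrite !gt_eqF.
Qed.

End UniformCorrelation.

(** * Choice of the constants and assembly *)

Lemma psi1_ge0 (R : realType) d (T : measurableType d) (P : probability T R) (X : T -> R) :
  (0 <= psi1 P X)%E.
Proof.
apply: (@le_trans _ _ ((1^-1)%:E * 'N[P]_(1%:E)[EFin \o X])%E).
  by rewrite mule_ge0// ?Lnorm_ge0// lee_fin invr_ge0.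
by apply: ereal_sup_ubound; exists 1 => //=.
Qed.

(** In dimension 0 the unit sphere is empty and the supremum would be [-oo]. *)
Lemma psi1_vec_ge0 (R : realType) d (T : measurableType d) (P : probability T R) n
  (a : T -> n.-tuple R) : (0 < n)%N -> (0 <= psi1_vec P a)%E.
Proof.
move=> n0; pose t : 'cV[R]_n := delta_mx (Ordinal n0) ord0.
apply: (le_trans (psi1_ge0 P (fun w => dotv (cV_of_tuple (a w)) t))).
by apply: ereal_sup_ubound; exists t => //=; exact: l2norm_delta.
Qed.

Lemma delta3_lt_rho (R : realType) (b : R) (n k : nat) (x0 : 'cV[R]_k) :
  0 < b -> 1000 * b <= 1 -> (1 < n)%N -> x0 != 0 ->
  delta3 (b / 4) n x0 < rho n * l2norm x0.
Proof.
move=> b0 b1 n1 x00; have nx : 0 < l2norm x0 by rewrite l2norm_gt0.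
have n5 : n%:R ^- 5 <= 1 :> R.
  rewrite invf_le1; first by rewrite exprn_ege1// ler1n ltnW.
  by rewrite exprn_gt0// ltr0n ltnW.
have rho4 : 4^-1 <= rho n :> R.
  by rewrite rho_cos ?cos_varrho_ge// ltnW.
rewrite /delta3 ltr_pM2r//; apply: le_lt_trans (_ : b / 4 * 1 < _).
  by rewrite ler_wpM2l// divr_ge0// ltW.
lra.
Qed.

Theorem theorem3p10 (R : realType) :
  exists c0 c1 c2 c3 c4 : R,
  [/\ 0 < c0, 0 < c1, 0 < c2, 0 < c3 & 0 < c4] /\
  (forall (n : nat) (dims : nat -> nat)
          (W : forall i, 'M[R]_(dims i.+1, dims i)) (eps : R)
          (disp : measure_display) (T : measurableType disp)
          (P : probability T R)
          (a : {RV P >-> (dims n).-tuple R}) (xi tau : {RV P >-> R})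
          (m : nat)
          (a_ : 'I_m -> {RV P >-> (dims n).-tuple R})
          (xi_ tau_ : 'I_m -> {RV P >-> R})
          (lambda Rad u : R),
    let k := dims 0%N in
    let d := dims n in
    let G := relu_net W n in
    let C := Num.max (c0 * (Rad * fine (psi1_vec P a) + fine (psi1 P xi))) 1 in
    (1 < n)%N ->
    (n < d)%N ->
    (forall i, (0 < i <= n)%N -> (dims i <= d)%N) ->
    0 < eps ->
    (forall i, (i < n)%N -> WDC eps (W i)) ->
    c1 * n%:R ^+ 3 * eps `^ 4^-1 <= 1 ->
    mean_zero P a ->
    isotropic P a ->
    (psi1_vec P a < +oo)%E ->
    (psi1 P xi < +oo)%E ->
    uniform_on P (- lambda) lambda tau ->
    independent3 P a xi tau ->
    mutually_independent P (fun i w => (a_ i w, xi_ i w, tau_ i w)) ->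
    (forall i, same_law P (fun w => (a_ i w, xi_ i w, tau_ i w))
                          (fun w => (a w, xi w, tau w))) ->
    1 <= Rad ->
    0 <= u ->
    lambda >= 4 * C * ln (64 * C * eps^-1) ->
    (0 < m)%N ->
    m%:R >= c2 * lambda ^+ 2 * ln (lambda * m%:R) ^+ 2
            * (k%:R * n%:R * ln (expR 1 * d%:R) + k%:R * ln (2 * Rad)
               + k%:R * ln m%:R + u) / eps ^+ 2 ->
    with_prob_at_least P (1 - 2 * c3 * expR (- u))
      [set w | forall x0 : 'cV[R]_k,
         let av i := cV_of_tuple (a_ i w) in
         let y i := sign_bit (dotv (av i) (G x0) + xi_ i w + tau_ i w) in
         let L := loss G lambda y av in
         x0 != 0 ->
         l2norm x0 <= Rad * (2^-1 + eps) `^ (- (n%:R / 2)) ->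
         l2norm x0 >= 2 `^ (n%:R / 2) * eps `^ 2^-1 ->
         forall phi zeta : R, rho n <= phi <= 1 -> rho n <= zeta <= 1 ->
         forall x z : 'cV[R]_k,
           l2ball (phi *: x0) (delta3 c4 n x0) x ->
           l2ball (- zeta *: x0) (delta3 c4 n x0) z ->
           L x < L z]) /\
  (forall (n k : nat) (x0 : 'cV[R]_k), (1 < n)%N -> x0 != 0 ->
     delta3 c4 n x0 < rho n * l2norm x0 /\
     forall phi zeta : R, rho n <= phi <= 1 -> rho n <= zeta <= 1 ->
       ~ l2ball (phi *: x0) (delta3 c4 n x0) 0 /\
       ~ l2ball (- zeta *: x0) (delta3 c4 n x0) 0).
Proof.
have [b [b0 b1]] : exists b : R, 0 < b /\ 1000 * b <= 1.
  have h : 0 < 1000 :> R by rewrite ltr0n.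
  exists 1000^-1; split; first by rewrite invr_gt0.
  by rewrite mulfV ?lexx ?gt_eqF.
(* With 16, the bounds [C / (16 Rad)] and [C / 16] on the psi_1 norms give exponential moments at
   scale [C / 2]. [b^-1] turns the smallness condition into [n^3 y <= b]. [272 * 24] is the
   Bernstein constant times the union-bound constant. *)
exists 16, b^-1, (272 * 24), 1, (b / 4).
split; first by split; rewrite ?(ltr0n, invr_gt0, divr_gt0, mulr_gt0).
split; last first.
  move=> n k x0 n1 x00; have h := delta3_lt_rho b0 b1 n1 x00; split => //.
  have nx := l2norm_ge0 x0.
  have rho0 : 0 <= rho n :> R.
    by rewrite rho_cos ?(ltnW n1)// (le_trans _ (cos_varrho_ge n1))// invr_ge0.
  move=> phi zeta /andP[phi0 _] /andP[zeta0 _]; rewrite /l2ball /=.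
  split; rewrite sub0r l2normN l2normZ ?normrN ger0_norm ?(le_trans rho0)// => /le_lt_trans/(_ h).
    by rewrite ltNge ler_wpM2r.
  by rewrite ltNge ler_wpM2r.
move=> n dims W eps disp T P a xi tau m a_ xi_ tau_ lambda Rad u k d G C n1 nd _ eps0 wdc
  small mean0 iso psia psixi unif ind indep law Rad1 u0 lamC m0 budget.
(* When [k = 0] there is no nonzero [x0] and the whole space serves as the event. *)
have [k0|k_gt0] := posnP k.
  exists setT => //; split.
    move=> w _ x0 /=; suff -> : x0 = 0 by rewrite eqxx.
    by apply/matrixP => i; have := ltn_ord i; rewrite [X in (_ < X)%N]k0.
  by rewrite probability_setT lee_fin mulr1 gerBl mulr_ge0// expR_ge0.
have d0 : (0 < d)%N by apply: leq_ltn_trans nd.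
pose y := eps `^ 4^-1.
have y0 : 0 < y by rewrite powR_gt0.
have y4 : y ^+ 4 = eps by rewrite powR_exprn ?ltW// mulVf// powRr1// ltW.
have y2 : eps `^ 2^-1 = y ^+ 2.
  by rewrite powR_exprn ?ltW//; congr (_ `^ _); field.
have n2 : 2 <= n%:R :> R by rewrite ler_nat.
have ysmall : n%:R ^+ 3 * y <= b.
  by move: small; rewrite -mulrA mulrC ler_pdivrMr// mul1r.
have n3 : n%:R <= n%:R ^+ 3 :> R by rewrite -[leLHS]expr1 ler_weXn2l//; lra.
have ny : n%:R * y <= b by apply: le_trans ysmall; rewrite ler_wpM2r// ltW.
have yle : y <= 1.
  have := ler_wpM2r (ltW y0) n2; lra.
have epsy : eps <= y by rewrite -y4 -[leRHS]expr1 ler_wiXn2l// ltW.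
have eps1 : eps <= 1 by apply: le_trans yle.
have neps : n%:R * eps <= b.
  by apply: le_trans ny; rewrite ler_wpM2l.
have neps4 : (1 + 2 * eps) ^+ n <= 4.
  apply: le_trans (expr1D_le _ _) _; first by rewrite mulr_ge0// ltW.
    lra.
  lra.
have Ka0 := psi1_vec_ge0 P a d0; have Kx0 := psi1_ge0 P xi.
have KaE : psi1_vec P a = (fine (psi1_vec P a))%:E by rewrite fineK// ge0_fin_numE.
have KxE : psi1 P xi = (fine (psi1 P xi))%:E by rewrite fineK// ge0_fin_numE.
have Ka0' := fine_ge0 Ka0; have Kx0' := fine_ge0 Kx0.
have Rad0 : 0 < Rad by apply: lt_le_trans Rad1.
have C16 : 16 * (Rad * fine (psi1_vec P a) + fine (psi1 P xi)) <= C by rewrite le_max lexx.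
have RK0 : 0 <= Rad * fine (psi1_vec P a) by rewrite mulr_ge0// ltW.
have C1 : 1 <= C by rewrite le_max lexx orbT.
have psi1_a : (psi1_vec P a <= (C / (16 * Rad))%:E)%E.
  rewrite KaE lee_fin ler_pdivlMr ?mulr_gt0//; lra.
have psi1_x : (psi1 P xi <= (C / 16)%:E)%E.
  rewrite KxE lee_fin ler_pdivlMr//; lra.
have [A mA [AE PA]] := uniform_correlation k_gt0 n1 d0 m0 eps0 eps1 neps4 wdc Rad1 u0 C1
  psi1_a psi1_x mean0 iso unif ind indep law lamC budget.
exists A => //; split; last first.
  apply: le_trans PA; rewrite lee_fin mulr1 lerD2l lerN2 ler_peMl ?expR_ge0//.
  lra.
move=> w /AE good x0 av yy L x00 x0R x0l phi zeta hphi hzeta x z xB zB.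
apply: (landscape_gap n1 b0 b1 y0 ysmall _ x00 _ _ hphi hzeta xB zB).
- by move=> i ilt; rewrite y4; exact: wdc.
- by rewrite ler_pdivlMr ?exprn_gt0 ?sqrtr_gt0// mulrC -powR_half_sqrt -y2.
move=> x'; rewrite y4 /L /loss.
have := good x0 x0R x'.
set S := \sum_i _; set Q := dotv _ _ => h.
(* The loss contains twice the correlation, so the error 16 becomes the 32 of [landscape_gap]. *)
have -> : l2norm (G x') ^+ 2 - 2 * lambda / m%:R * S - (l2norm (G x') ^+ 2 - 2 * Q) =
  - (2 * (lambda / m%:R * S - Q)) by ring.
rewrite normrN normrM ger0_norm//; lra.
Qed.
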